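(* Let $q\in\mathbb{C}^\times$ be such that $q^2$ has finite multiplicative order $\ell\geq 3$, and let $n\geq \ell-1$. Let $Q_n(\ell)=\mathrm{TL}_n(q)/R_n$, where $R_n$ is the two-sided ideal of $\mathrm{TL}_n(q)$ generated by the Jones-Wenzl idempotent $E_{\ell-1}\in\mathrm{TL}_{\ell-1}(q)\subseteq\mathrm{TL}_n(q)$. Then the simple $Q_n(\ell)$-modules are (up to isomorphism) precisely the simple $\mathrm{TL}_n(q)$-modules $L_t(n)$ with $0\leq t\leq n$, $t\equiv n\pmod 2$ and $t\leq \ell-2$ (on which $R_n$ acts as zero).
   Context: For $n\geq 0$, $\mathrm{TL}_n(q)$ is the associative unital $\mathbb{C}$-algebra with generators $f_1,\dots,f_{n-1}$ and relations $f_i^2=-(q+q^{-1})f_i$, $f_if_{i\pm1}f_i=f_i$, $f_if_j=f_jf_i$ if $|i-j|\geq 2$. Equivalently, it has as basis the planar Temperley-Lieb diagrams from $n$ to $n$. Here a Temperley-Lieb diagram from $t$ to $n$ is a non-crossing pairing (up to isotopy) of $t$ bottom points and $n$ top points; diagrams are composed by stacking, with each closed loop replaced by the scalar $-(q+q^{-1})$, and $f_i$ is the diagram with one cup and one cap at positions $i,i+1$. For $m\le n$, $\mathrm{TL}_m(q)$ is the subalgebra of $\mathrm{TL}_n(q)$ generated by $f_1,\dots,f_{m-1}$. A diagram $t\to n$ is monic if every bottom point is joined to a top point. For $0\leq t\leq n$ with $t\equiv n \pmod 2$, the cell module $W_t(n)$ has as basis the monic diagrams $t\to n$; $\mathrm{TL}_n(q)$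 acts by composition, where non-monic results are set to $0$. There is a bilinear form on $W_t(n)$ defined on monic diagrams $D_1,D_2$ as follows: with $D^*$ the reflection of $D$ in a horizontal line, if $D_1^*D_2$ is a scalar multiple of the identity diagram $\mathrm{id}_t$, then $D_1^*D_2=(D_1,D_2)\,\mathrm{id}_t$; otherwise $(D_1,D_2)=0$. Its radical $\mathrm{Rad}_t$ is a submodule, and $L_t(n):=W_t(n)/\mathrm{Rad}_t$. The modules $L_t(n)$ ($0\leq t\leq n$, $t\equiv n\pmod 2$) form a complete set of pairwise non-isomorphic simple $\mathrm{TL}_n(q)$-modules. The Jones-Wenzl idempotent $E_{\ell-1}$ is the unique nonzero idempotent of $\mathrm{TL}_{\ell-1}(q)$ satisfying $f_iE_{\ell-1}=E_{\ell-1}f_i=0$ for $1\leq i\leq \ell-2$. *)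

(* Defs.v *)
From HB Require Import structures.
From mathcomp Require Import all_boot all_algebra.
From mathcomp Require Import zify.
From mathcomp Require Import boolp reals complex.
Set Implicit Arguments.
Unset Strict Implicit.
Unset Printing Implicit Defensive.
Import GRing.Theory.

Section Components.
Variable V : finType.
Implicit Types (e : rel V) (O : {pred V}).

Definition component e (x : V) : {set V} := [set y | connect e x y].

Definition components_off e O : {set {set V}} :=
  [set C in [set component e x | x : V] | [disjoint C & O]].

Lemma components_offP e O C :
  reflect (exists2 x, C = component e x & forall y, connect e x y -> y \notin O)
          (C \in components_off e O).
Proof.
rewrite inE; apply: (iffP andP) => [[/imsetP[x _ ->] dj]|[x -> h]].
  by exists x => // y xy; rewrite (disjointFr dj) // inE.
split; first exact: imset_f.
rewrite disjoint_subset; apply/subsetP => y; rewrite inE => /h.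
by rewrite inE.
Qed.

Lemma eq_components_off e e' O O' :
  e =2 e' -> O =i O' -> components_off e O = components_off e' O'.
Proof.
move=> ee' OO'; apply/setP => C.
have ce x : component e x = component e' x.
  by apply/setP=> y; rewrite !inE (eq_connect ee').
apply/components_offP/components_offP => -[x -> h]; exists x => // y.
- by rewrite -(eq_connect ee') -OO' => /h.
- by rewrite (eq_connect ee') OO' => /h.
Qed.

Lemma component_eq e x y :
  connect_sym e -> connect e x y -> component e x = component e y.
Proof. by move=> se xy; apply/setP => z; rewrite !inE (same_connect se xy). Qed.

Lemma connect_ind e (P : V -> Prop) x :
  P x -> (forall y z, connect e x y -> P y -> e y z -> P z) ->
  forall y, connect e x y -> P y.
Proof.
move=> Px st y /connectP[p]; elim/last_ind: p y => [|p z IH] y /=; first by move=> _ ->.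
rewrite rcons_path last_rcons => /andP[ep ez] ->.
apply: (st (last x p)) => //; first by apply/connectP; exists p.
exact: IH.
Qed.
End Components.

Lemma components_off_embed (V V' : finType) (f : V -> V') (e : rel V) (e' : rel V')
    (O : {pred V}) (O' : {pred V'}) :
  injective f -> connect_sym e' ->
  (forall x y, e' (f x) (f y) = e x y) ->
  (forall x y, e' (f x) y -> exists z, y = f z) ->
  (forall x, (f x \in O') = (x \in O)) ->
  (forall y, y \notin O' -> exists x, y = f x) ->
  (forall x y, connect e' (f x) (f y) = connect e x y) /\
  #|components_off e' O'| = #|components_off e O|.
Proof.
move=> fI se' ee clo OO out.
have c1 x : forall y, connect e x y -> connect e' (f x) (f y).
  refine (connect_ind _ _) => [|y' z _ xy yz]; first exact: connect0.
  by apply: connect_trans xy (connect1 _); rewrite ee.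
have c2 x : forall y, connect e' (f x) y -> exists2 z, y = f z & connect e x z.
  refine (connect_ind _ _) => [|_ z _ [y' -> xy'] yz]; first by exists x.
  have [w zw] := clo _ _ yz; exists w => //.
  by apply: connect_trans xy' (connect1 _); rewrite -ee -zw.
have cc x y : connect e' (f x) (f y) = connect e x y.
  by apply/idP/idP => [/c2[z /fI->]|/c1].
have compE x : component e' (f x) = f @: component e x.
  apply/setP => y; rewrite inE; apply/idP/imsetP.
    by move=> /c2[z -> xz]; exists z; rewrite ?inE.
  by move=> [z]; rewrite inE => xz ->; rewrite cc.
split=> //; suff -> : components_off e' O' = [set f @: C | C : {set V} in components_off e O].
  by rewrite card_imset //; apply: imset_inj.
apply/setP => C; apply/components_offP/imsetP.
  move=> [y -> h]; have [x xy] := out _ (h _ (connect0 _ _)); subst y.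
  exists (component e x); last by rewrite compE.
  by apply/components_offP; exists x => // y; rewrite -cc => /h; rewrite OO.
move=> [_ /components_offP[x -> h] ->]; exists (f x); first by rewrite compE.
by move=> y /c2[z -> /h]; rewrite OO.
Qed.

(* The graph eA + eB on V is compared with the graph eR + eS on W, where eR
   records which points of W are joined by eA and eS is eB seen on W. *)
Section Contract.
Variables (V W : finType) (f : W -> V) (eA eB : rel V) (eR eS : rel W).
Variable (O : {pred W}).
Hypotheses (fI : injective f) (sA : symmetric eA) (sB : symmetric eB).
Hypothesis eBf : forall x y, eB x y -> exists w w', [/\ x = f w, y = f w' & eS w w'].
Hypothesis eSf : forall w w', eS w w' -> eB (f w) (f w').
Hypothesis eRf : forall w w', connect eR w w' = connect eA (f w) (f w').

Let e : rel V := relU eA eB.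
Let eW : rel W := relU eR eS.

Let se : connect_sym e.
Proof. by apply: sym_connect_sym => x y; rewrite /e /= sA sB. Qed.

Let subA x y : connect eA x y -> connect e x y.
Proof. by apply: connect_sub => u v uv; apply: connect1; rewrite /e /eW /= uv. Qed.
Let subR x y : connect eR x y -> connect eW x y.
Proof. by apply: connect_sub => u v uv; apply: connect1; rewrite /e /eW /= uv. Qed.

Lemma contract_connect w w' : connect eW w w' = connect e (f w) (f w').
Proof.
apply/idP/idP.
  move: w'; refine (connect_ind _ _) => [|y z _ wy /orP[] yz]; first exact: connect0.
    by apply: connect_trans wy (subA _); rewrite -eRf connect1.
  by apply: connect_trans wy (connect1 _); rewrite /e /= (eSf yz) orbT.
suff H : forall x, connect e (f w) x -> forall v, connect eA x (f v) -> connect eW w v.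
  by move=> /H; apply.
refine (connect_ind _ _) => [v|y z _ IH /orP[] yz v zv].
- by rewrite -eRf => /subR.
- by apply: IH; apply: connect_trans (connect1 yz) zv.
have [u [u' [yE zE uu']]] := eBf yz; subst y z.
have wu := IH u (connect0 _ _).
apply: connect_trans wu (connect_trans (connect1 (y := u') _) (subR _)).
  by rewrite /eW /= uu' orbT.
by rewrite eRf.
Qed.

Lemma contract_components :
  #|components_off e [pred x | [exists w in O, x == f w]]| =
  #|components_off eW O| + #|components_off eA [in codom f]|.
Proof.
set O' := [pred x | _].
have fO w : (f w \in O') = (w \in O).
  apply/existsP/idP => [[w' /andP[Ow' /eqP/fI->]] //|Ow].
  by exists w; rewrite Ow eqxx.
set X := components_off e O'.
rewrite -(cardsID [set C : {set V} | ~~ [disjoint C & codom f]] X); congr (_ + _).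
  rewrite -(card_in_imset (f := fun C : {set V} => f @^-1: C)).
    apply: eq_card => C; apply/imsetP/components_offP.
      move=> [D /setIP[/components_offP[x DE h] hD] CE]; subst C D.
      move: hD; rewrite inE => /pred0Pn[z /andP[/=]]; rewrite inE => xw /codomP[w zE]; subst z.
      exists w; first by apply/setP => v; rewrite !inE contract_connect (same_connect se xw).
      by move=> v; rewrite contract_connect -fO => wv; apply/h/(connect_trans xw).
    move=> [w -> h]; exists (component e (f w)).
      rewrite inE; apply/andP; split.
        apply/components_offP; exists (f w) => // y wy.
        apply/existsPn => v; apply/negP => /andP[Ov /eqP yv]; subst y.
        by move: wy; rewrite -contract_connect => /h; rewrite Ov.
      rewrite inE; apply/pred0Pn; exists (f w).
      by rewrite /= inE connect0 codom_f.
    by apply/setP => v; rewrite !inE contract_connect.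
  move=> D D' /setIP[/components_offP[x DE _] hx] /setIP[/components_offP[y DE' _] _] E.
  subst D D'; move: hx; rewrite inE => /pred0Pn[z /andP[/=]].
  rewrite inE => xw /codomP[w zE]; subst z.
  have yw : connect e y (f w).
    by have := congr1 (fun A : {set W} => w \in A) E; rewrite !inE xw => <-.
  by rewrite (component_eq se xw) (component_eq se yw).
apply: eq_card => C; rewrite in_setD !inE negbK.
have key x : (forall y, connect eA x y -> y \notin codom f) ->
   forall y, connect e x y = connect eA x y.
  move=> h y; apply/idP/idP; last exact: subA.
  move: y; refine (connect_ind _ _) => [|u v _ xu /orP[] uv]; first exact: connect0.
    exact: connect_trans xu (connect1 uv).
  have [w [w' [uE _ _]]] := eBf uv.
  by have := h _ xu; rewrite uE codom_f.
have keyC x : (forall y, connect eA x y -> y \notin codom f) ->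
   component e x = component eA x.
  by move=> h; apply/setP=> y; rewrite !inE key.
apply/andP/andP => -[].
  move=> dj /andP[/imsetP[x _ CE] _]; subst C.
  have h y : connect eA x y -> y \notin codom f.
    by move=> /subA xy; rewrite (disjointFr dj) // inE.
  by split=> //; rewrite keyC ?imset_f.
move=> /imsetP[x _ CE] dj; subst C.
have h y : connect eA x y -> y \notin codom f.
  by move=> xy; rewrite (disjointFr dj) // inE.
split; first by [].
apply/andP; split; first by rewrite -keyC ?imset_f.
apply: disjointWr dj; apply/subsetP => y /existsP[w /andP[_ /eqP ->]].
exact: codom_f.
Qed.
End Contract.

(* In the graph of two involutions without common fixed point, a component
   containing a fixed point of one of them contains exactly two such points. *)
Section TwoInvolutions.
Variables (V : finType) (a b : V -> V).
Hypotheses (aK : involutive a) (bK : involutive b).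
Hypothesis ab : forall x, a x = x -> b x <> x.
Let e : rel V := fun x y => (a x == y) || (b x == y).
Let g x := b (a x).
Let gI : injective g.
Proof. exact: inj_comp (inv_inj bK) (inv_inj aK). Qed.

Let gb k y : iter k g (b (iter k g y)) = b y.
Proof.
elim: k => [//|k IH]; rewrite iterSr /= -[RHS]IH; congr (iter k g _).
by rewrite /g bK aK.
Qed.

Lemma involutions_end x : b x = x ->
  exists y, [/\ (a y == y) || (b y == y), y != x, connect e x y &
    forall z, (a z == z) || (b z == z) -> connect e x z -> z = x \/ z = y].
Proof.
move=> bx.
have ge y : connect e y (g y).
  apply: (@connect_trans _ _ (a y)); apply: connect1; rewrite /e /g ?eqxx //.
  by rewrite orbT.
have gke k y : connect e y (iter k g y).
  by elim: k => [|k IH] /=; [exact: connect0 | exact: connect_trans IH (ge _)].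
have gbx k : iter k g (b (iter k g x)) = x by rewrite gb.
have gax k : iter k.+1 g (a (iter k g x)) = x.
  by rewrite iterSr /g aK; apply: gbx.
have orb z : connect e x z -> exists2 k, k < order g x & z = iter k g x.
  move=> xz; suff : fconnect g x z.
    by move=> xz'; exists (findex g x z); rewrite ?findex_max ?iter_findex.
  move: z xz; refine (connect_ind _ _) => [|y z _ xy]; first exact: connect0.
  have -> : y = iter (findex g x y) g x by rewrite iter_findex.
  set k := findex _ _ _.
  move=> /orP[]/eqP <-; rewrite fconnect_sym //.
    by rewrite -{2}(gax k) fconnect_iter.
  by rewrite -{2}(gbx k) fconnect_iter.
pose N := order g x; have N0 : 0 < N by rewrite /N order_gt0.
have itN : iter N g x = x by rewrite iter_order.
have small m : 0 < m < N -> iter m g x <> x.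
  move=> /andP[m0 mN] E; have := findex_iter mN; rewrite E findex0 => m0'.
  by rewrite -m0' in m0.
have per m : m < N.*2 -> iter m g x = x -> m = 0 \/ m = N.
  move=> m2 E; case: (posnP m) => [|m0]; first by left.
  right; case: (ltngtP m N) => // mN.
    by case: (small m); rewrite ?m0.
  have [] := small (m - N); first by lia.
  by rewrite -{1}itN -iterD subnK // ltnW.
have bfix k : b (iter k g x) = iter k g x -> iter k.*2 g x = x.
  by move=> E; rewrite -addnn iterD -E gbx.
have afix k : a (iter k g x) = iter k g x -> iter k.*2.+1 g x = x.
  by move=> E; rewrite -addnn -addSn iterD -E gax.
pose k := N./2; pose y := iter k g x.
have Nk : N = odd N + k.*2 by rewrite odd_double_half.
have itI m : injective (iter m g) by elim: m => [|m IH] u v //= /gI/IH.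
have Oy : (a y == y) || (b y == y).
  case: (boolP (odd N)) Nk => _ /= Nk; apply/orP; [left|right]; apply/eqP.
    by apply: (itI k.+1); rewrite gax /y -iterD addSn addnn -add1n -Nk itN.
  by apply: (itI k); rewrite gbx /y -iterD addnn -[_.*2]add0n -Nk itN.
exists y; split=> //.
- apply/eqP => yx; have k0 : k = 0.
    case: (posnP k) => // kp; case: (small k) => //; rewrite kp /=; lia.
  have N1 : odd N by case: (odd N) Nk; rewrite k0 //= => Nk; lia.
  rewrite N1 k0 /= in Nk.
  have := @ab x; rewrite bx; apply=> //.
  by apply: gI; rewrite {1}/g aK bx -[LHS]itN Nk.
- exact: gke.
move=> z Oz /orb[m mN zE]; subst z.
case/orP: Oz => /eqP E.
  right; congr (iter _ g x); have := per _ _ (afix _ E) => /(_ ltac:(lia))[//|].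
  by move: Nk; case: (odd N) => /=; lia.
case: (per _ _ (bfix _ E)); first by lia.
  by case: m {mN E} => // _; left.
by move=> mE; right; congr (iter _ g x); move: Nk; case: (odd N) => /=; lia.
Qed.
End TwoInvolutions.

Lemma fpf_involution_even (T : finType) (f : T -> T) (S : {set T}) :
  {in S, forall x, f (f x) = x} -> {in S, forall x, f x != x} ->
  {in S, forall x, f x \in S} -> odd #|S| = false.
Proof.
have [m] := ubnP #|S|; elim: m S => // m IH S Sm fK fne fS.
have [->|[x xS]] := set_0Vmem S; first by rewrite cards0.
pose S' := S :\ x :\ f x.
have sub y : y \in S' -> y \in S by rewrite !inE => /and3P[].
have cS : #|S| = #|S'|.+2.
  by rewrite (cardsD1 x) xS (cardsD1 (f x)) !inE fne ?fS.
rewrite cS /= negbK; apply: IH; first by lia.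
- by move=> y /sub/fK.
- by move=> y /sub/fne.
move=> y yS'; have yS := sub _ yS'; rewrite !inE fS // andbT.
move: yS'; rewrite !inE yS andbT => /andP[yfx yx]; apply/andP; split.
  by apply: contra yx => /eqP E; rewrite -(fK y) // E fK.
by apply: contra yfx => /eqP E; rewrite -(fK y) // E.
Qed.

(* The boundary points of a diagram t -> n: [inl i] is the i-th bottom point
   and [inr j] the j-th top point, both counted from the left and from 0. *)
Definition points (t n : nat) : Type := ('I_t + 'I_n)%type.
HB.instance Definition _ t n := Finite.on (points t n).

(* Position of a point on the boundary of the rectangle, read from the bottom
   left corner: the bottom from left to right, then the top from right to left. *)
Definition position t n (x : points t n) : nat :=
  match x with inl i => i | inr j => (t + n).-1 - j end.

Definition noncrossing_pairing t n (f : {ffun points t n -> points t n}) : bool :=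
  [&& [forall x, f x != x], [forall x, f (f x) == x]
    & [forall x, forall y, ~~ [&& position x < position y,
        position y < position (f x) & position (f x) < position (f y)]]].

Record diagram t n := Diagram {
  partner :> {ffun points t n -> points t n};
  partnerP : noncrossing_pairing partner }.
HB.instance Definition _ t n := [isSub for @partner t n].
HB.instance Definition _ t n := [Finite of diagram t n by <:].

Section Partner.
Variables (t n : nat) (D : diagram t n).

Lemma partnerK : involutive D.
Proof. by case/and3P: (partnerP D) => _ /forallP h _ x; apply/eqP. Qed.

Lemma partner_neq x : D x != x.
Proof. by case/and3P: (partnerP D) => /forallP h _ _. Qed.

Lemma partner_noncrossing x y : position x < position y ->
  position y < position (D x) -> position (D x) < position (D y) -> False.
Proof.
case/and3P: (partnerP D) => _ _ /forallP /(_ x) /forallP /(_ y) h a b c.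
by rewrite a b c in h.
Qed.
End Partner.

Lemma diagram_eq t n (D D' : diagram t n) : D =1 D' -> D = D'.
Proof. by move=> h; apply/val_inj/ffunP. Qed.

Lemma position_inj t n : injective (@position t n).
Proof.
move=> [i|i] [j|j] /= h; try (congr inl; apply: val_inj => /=; lia);
  try (congr inr; apply: val_inj => /=); move: (ltn_ord i) (ltn_ord j); lia.
Qed.

(* edges of a diagram whose points are embedded in a larger set of vertices *)
Definition edges t n (V : finType) (g : points t n -> V) (D : diagram t n) : rel V :=
  fun x y => [exists u, (x == g u) && (y == g (D u))].

Section Edges.
Variables (t n : nat) (V : finType) (g : points t n -> V) (D : diagram t n).

Lemma edgesP x y : reflect (exists2 u, x = g u & y = g (D u)) (edges g D x y).
Proof.
apply: (iffP existsP) => [[u /andP[/eqP-> /eqP->]]|[u -> ->]]; exists u => //.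
by rewrite !eqxx.
Qed.

Lemma edges_sym : symmetric (edges g D).
Proof.
by move=> x y; apply/edgesP/edgesP => -[u -> ->]; exists (D u); rewrite ?partnerK.
Qed.

Lemma edges_partner u : edges g D (g u) (g (D u)).
Proof. by apply/edgesP; exists u. Qed.

Hypothesis gI : injective g.

Lemma edges_image u v : edges g D (g u) (g v) = (v == D u).
Proof.
by apply/edgesP/eqP => [[w /gI-> /gI]|->] //; exists u.
Qed.

Lemma connect_edges x y : connect (edges g D) x y = (x == y) || edges g D x y.
Proof.
apply/idP/orP => [|[/eqP->|]]; [|exact: connect0|exact: connect1].
move: y; refine (connect_ind _ _) => [|y z _ h /edgesP[u yE zE]]; first by left.
subst y z; case: h => [/eqP->|/edgesP[v -> /gI ->]]; last by left; rewrite partnerK.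
by right; apply: edges_partner.
Qed.
End Edges.

(* vertices of a diagram n -> m stacked on a diagram t -> n: bottom, middle, top *)
Definition level3 (t n m : nat) : Type := ('I_t + 'I_n + 'I_m)%type.
HB.instance Definition _ t n m := Finite.on (level3 t n m).

Definition lower3 t n m (x : points t n) : level3 t n m := inl x.
Definition upper3 t n m (x : points n m) : level3 t n m :=
  match x with inl j => inl (inr j) | inr k => inr k end.
Definition outer3 t n m (x : points t m) : level3 t n m :=
  match x with inl i => inl (inl i) | inr k => inr k end.

(* D on top of E *)
Definition stack t n m (D : diagram n m) (E : diagram t n) : rel (level3 t n m) :=
  relU (edges (@lower3 t n m) E) (edges (@upper3 t n m) D).

Lemma lower3_inj t n m : injective (@lower3 t n m).
Proof. by move=> ? ? []. Qed.
Lemma upper3_inj t n m : injective (@upper3 t n m).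
Proof. by move=> [?|?] [?|?] // []->. Qed.
Lemma outer3_inj t n m : injective (@outer3 t n m).
Proof. by move=> [?|?] [?|?] // []->. Qed.

Lemma stack_sym t n m (D : diagram n m) (E : diagram t n) : symmetric (stack D E).
Proof. by move=> x y; rewrite /stack /= edges_sym [X in _ || X]edges_sym. Qed.

(* the other outer point in the component of x; see [connect_outer] *)
Definition compose_partner t n m (D : diagram n m) (E : diagram t n) :
    {ffun points t m -> points t m} :=
  [ffun x => odflt x
    [pick y | (y != x) && connect (stack D E) (outer3 n x) (outer3 n y)]].

(* a closed loop is a component without outer points *)
Definition loops t n m (D : diagram n m) (E : diagram t n) : nat :=
  #|components_off (stack D E) [in codom (@outer3 t n m)]|.

Section Compose.
Variables (t n m : nat) (D : diagram n m) (E : diagram t n).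
Local Notation V := (level3 t n m).
Local Notation e := (stack D E).

Let low (x : V) : V :=
  match x with inl u => inl (E u) | inr k => inr k end.
Let up (x : V) : V :=
  match x with inl (inl i) => inl (inl i) | inl (inr j) => upper3 t (D (inl j))
  | inr k => upper3 t (D (inr k)) end.

Let lowK : involutive low.
Proof. by case=> [u|k] //=; rewrite partnerK. Qed.
Let up_upper x : up (upper3 t x) = upper3 t (D x).
Proof. by case: x. Qed.
Let upK : involutive up.
Proof.
case=> [[i|j]|k] //.
  by rewrite [up (inl (inr j))]/= up_upper partnerK.
by rewrite [up (inr k)]/= up_upper partnerK.
Qed.

Let low_fix x : (low x == x) = if x is inr _ then true else false.
Proof.
case: x => [u|k] /=; last exact: eqxx.
by apply/negbTE; apply: contra_neq (partner_neq E u) => -[].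
Qed.
Let up_fix x : (up x == x) = if x is inl (inl _) then true else false.
Proof.
have H y : (up (upper3 t y) == upper3 t y) = false.
  rewrite up_upper; apply/negbTE.
  by apply: contra_neq (partner_neq D y) => /upper3_inj.
case: x => [[i|j]|k]; [by rewrite eqxx | exact: (H (inl j)) | exact: (H (inr k))].
Qed.

Let se : connect_sym e.
Proof. exact/sym_connect_sym/stack_sym. Qed.

Lemma stack_connectE : connect e =2 connect (fun x y => (low x == y) || (up x == y)).
Proof.
move=> x y; apply/idP/idP.
  apply: connect_sub => u v /orP[]/edgesP[w -> ->]; apply: connect1.
    by rewrite eqxx.
  by rewrite up_upper eqxx orbT.
apply: connect_sub => u v /orP[]/eqP <-.
  case: u => [u|k] /=; last exact: connect0.
  by apply: connect1; rewrite /stack /= (edges_partner (@lower3 t n m) E u).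
case: u => [[i|j]|k]; first exact: connect0.
  apply: connect1; rewrite /stack /=.
  by rewrite (edges_partner (@upper3 t n m) D (inl j)) orbT.
apply: connect1; rewrite /stack /=.
by rewrite (edges_partner (@upper3 t n m) D (inr k)) orbT.
Qed.

Lemma outer3P (z : V) :
  reflect (exists y, z = outer3 n y) ((low z == z) || (up z == z)).
Proof.
rewrite low_fix up_fix; apply: (iffP orP) => [|[[i|k] ->]]; [|by right|by left].
case: z => [[i|j]|k] [] // _; first by exists (inl i).
by exists (inr k).
Qed.

Lemma stack_end (x : points t m) : exists y, [/\ y != x,
  connect e (outer3 n x) (outer3 n y) &
  forall z, connect e (outer3 n x) (outer3 n z) -> z = x \/ z = y].
Proof.
have main (a b : V -> V) (aK : involutive a) (bK : involutive b)
    (ab : forall x, a x = x -> b x <> x)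
    (O : forall z, (a z == z) || (b z == z) = ((low z == z) || (up z == z)))
    (E' : connect e =2 connect (fun x y => (a x == y) || (b x == y))) :
    b (outer3 n x) = outer3 n x -> exists y, [/\ y != x,
  connect e (outer3 n x) (outer3 n y) &
  forall z, connect e (outer3 n x) (outer3 n z) -> z = x \/ z = y].
  move=> /(involutions_end aK bK ab)[z []].
  rewrite O => /outer3P[y ->] zx; rewrite -E' => xy h; exists y; split=> //.
    by apply: contra_neq zx => ->.
  move=> w xw; case: (h (outer3 n w)).
  - by rewrite O; apply/outer3P; exists w.
  - by rewrite -E'.
  - by move=> /outer3_inj; left.
  - by move=> /outer3_inj; right.
have ab z : low z = z -> up z <> z.
  by move=> /eqP + /eqP; rewrite low_fix up_fix; case: z => [[]|].
case: x main => [i|k] main; first by apply: (main low up) => //; apply: stack_connectE.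
apply: (main up low) => //; first by move=> z h /ab.
  by move=> z; rewrite orbC.
by move=> y z; rewrite stack_connectE; apply: eq_connect => u v; rewrite orbC.
Qed.

Lemma connect_outer x y : connect e (outer3 n x) (outer3 n y) =
  (y == x) || (y == compose_partner D E x).
Proof.
have [z [zx xz h]] := stack_end x.
have -> : compose_partner D E x = z.
  rewrite ffunE; case: pickP => [w /andP[wx /h[wE|//]]|/(_ z)].
    by rewrite wE eqxx in wx.
  by rewrite zx xz.
apply/idP/orP => [/h[]->|[/eqP->|/eqP->]]; rewrite ?eqxx //; first by left.
by right.
Qed.

Lemma compose_partner_neq x : compose_partner D E x != x.
Proof.
rewrite ffunE; case: pickP => [w /andP[] //|].
by have [z [zx xz h]] := stack_end x => /(_ z); rewrite zx xz.
Qed.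

Lemma compose_partner_connect x :
  connect e (outer3 n x) (outer3 n (compose_partner D E x)).
Proof. by rewrite connect_outer eqxx orbT. Qed.

Lemma compose_partnerK x : compose_partner D E (compose_partner D E x) = x.
Proof.
set y := compose_partner D E x.
have : connect e (outer3 n y) (outer3 n x) by rewrite se compose_partner_connect.
rewrite connect_outer eq_sym (negbTE (compose_partner_neq x)) => /eqP.
by move=> <-.
Qed.
End Compose.

(* Planarity of a composite: for a component C of the stacked graph, the parity
   of the number of points of C to the left of x on the row of x does not change
   when x moves along an edge outside C. *)
Section Parity.

Definition leftof t n (S : {pred points t n}) (x : points t n) : nat :=
  match x with
  | inl i => \sum_(i' < t) ((inl i' \in S) && (i' < i))
  | inr j => \sum_(j' < n) ((inr j' \in S) && (j' < j)) end.

Definition before t n (S : {pred points t n}) (x : points t n) : nat :=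
  \sum_(u : points t n) ((u \in S) && (position u < position x)).

Lemma sum_points t n (F : points t n -> nat) :
  \sum_u F u = \sum_i F (inl i) + \sum_j F (inr j).
Proof. exact: big_sumType. Qed.

Lemma card_points t n (S : {pred points t n}) : #|S| = \sum_u (u \in S).
Proof. by rewrite -sum1_card big_mkcond; apply: eq_bigr => u _; case: ifP. Qed.

Lemma before_leftof t n (S : {pred points t n}) x :
  odd #|S| = false -> x \notin S -> odd (before S x) = odd (leftof S x).
Proof.
rewrite card_points /before !sum_points => oS; case: x => [i|j] xS /=.
  rewrite [X in _ + X]big1 ?addn0 // => j _; apply/eqP.
  by rewrite eqb0 negb_and; apply/orP; right; move: (ltn_ord i) (ltn_ord j); lia.
have -> : \sum_(i < t) ((inl i \in S) && (i < (t + n).-1 - j)) =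
          \sum_(i < t) (inl i \in S).
  apply: eq_bigr => i _; rewrite (_ : (i < _) = true) ?andbT //.
  by move: (ltn_ord i) (ltn_ord j); lia.
have H : \sum_(j' < n) ((inr j' \in S) && ((t + n).-1 - j' < (t + n).-1 - j)) +
         \sum_(j' < n) ((inr j' \in S) && (j' < j)) = \sum_(j' < n) (inr j' \in S).
  rewrite -big_split /=; apply: eq_bigr => j' _.
  have [->|ne] := eqVneq j' j; first by rewrite (negbTE xS).
  have : (j' : nat) != j by [].
  case: (inr j' \in S) => //=; move: (ltn_ord j) (ltn_ord j'); lia.
by move: oS; rewrite -H !oddD; case: odd; case: odd; case: odd.
Qed.

Lemma before_partner t n (D : diagram t n) (S : {pred points t n}) x :
  (forall u, u \in S -> D u \in S) -> x \notin S ->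
  odd (before S x) = odd (before S (D x)).
Proof.
move=> cl.
wlog lt : x / position x < position (D x) => [main|] xS.
  case: (ltngtP (position x) (position (D x))) => [h|h|/position_inj <-] //.
    exact: main.
  have DxS : D x \notin S by apply: contra xS => /cl; rewrite partnerK.
  by have := main (D x); rewrite partnerK => ->.
have DxS : D x \notin S by apply: contra xS => /cl; rewrite partnerK.
pose B := [set u in S | (position x < position u) && (position u < position (D x))].
suff -> : before S (D x) = before S x + #|B|.
  rewrite oddD (@fpf_involution_even _ D) ?addbF // => u.
  - by rewrite partnerK.
  - by rewrite partner_neq.
  rewrite !inE => /and3P[uS xu ux]; rewrite cl //=; apply/andP; split.
    rewrite ltnNge leq_eqVlt; apply/norP; split.
      apply: contra xS => /eqP/position_inj <-; exact: cl.
    by apply/negP => h; apply: (@partner_noncrossing _ _ D (D u) x); rewrite ?partnerK.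
  rewrite ltnNge leq_eqVlt; apply/norP; split.
    apply: contra DxS => /eqP/position_inj ->; exact: cl.
  by apply/negP => h; apply: (@partner_noncrossing _ _ D x u).
rewrite card_points -big_split /=; apply: eq_bigr => u _; rewrite inE.
case: (boolP (u \in S)) => uS //=.
have : position u != position x.
  by apply: contra xS => /eqP/position_inj <-.
by move: lt; lia.
Qed.

Lemma closed_even t n (D : diagram t n) (S : {pred points t n}) :
  (forall u, u \in S -> D u \in S) -> odd #|S| = false.
Proof.
move=> cl; rewrite -cardsE; apply: (@fpf_involution_even _ D) => u.
- by rewrite partnerK.
- by rewrite partner_neq.
by rewrite !inE => /cl.
Qed.

Lemma leftof_partner t n (D : diagram t n) (S : {pred points t n}) x :
  (forall u, u \in S -> D u \in S) -> x \notin S ->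
  odd (leftof S x) = odd (leftof S (D x)).
Proof.
move=> cl xS; have cS := closed_even cl.
have DxS : D x \notin S by apply: contra xS => /cl; rewrite partnerK.
by rewrite -!before_leftof // -before_partner.
Qed.

End Parity.

Section Planarity.
Variables (t n m : nat) (D : diagram n m) (E : diagram t n).
Local Notation e := (stack D E).

Let leftof3 (C : {set level3 t n m}) (x : level3 t n m) : nat :=
  match x with
  | inl u => leftof [pred v | lower3 m v \in C] u
  | inr k => leftof [pred v | upper3 t v \in C] (inr k) end.

Let leftof3_upper C x :
  leftof3 C (upper3 t x) = leftof [pred v | upper3 t v \in C] x.
Proof. by case: x. Qed.
Let leftof3_outer C x :
  leftof3 C (outer3 n x) = leftof [pred v | outer3 n v \in C] x.
Proof. by case: x. Qed.

Let leftof3_step (C : {set level3 t n m}) x y : closed e (mem C) ->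
  e x y -> x \notin C -> odd (leftof3 C x) = odd (leftof3 C y).
Proof.
move=> cl /orP[]/edgesP[u -> ->] uC.
  apply: leftof_partner => // v; rewrite !inE => vC.
  rewrite -[_ \in C](cl (lower3 m v)) //.
  by rewrite /stack /= (edges_partner (@lower3 t n m)).
rewrite !leftof3_upper; apply: leftof_partner => // v; rewrite !inE => vC.
rewrite -[_ \in C](cl (upper3 t v)) //.
by rewrite /stack /= (edges_partner (@upper3 t n m)) orbT.
Qed.

Lemma compose_noncrossing : noncrossing_pairing (compose_partner D E).
Proof.
have se : connect_sym e by exact/sym_connect_sym/stack_sym.
set F := compose_partner D E.
apply/and3P; split; first by apply/forallP => x; apply: compose_partner_neq.
  by apply/forallP => x; rewrite compose_partnerK.
apply/forallP => x; apply/forallP => y; apply/negP => /and3P[xy yx xFy].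
pose C := component e (outer3 n x).
have cl : closed e (mem C).
  by move=> u v uv; rewrite !inE; apply: (same_connect_r se (connect1 uv)).
pose S := [pred v | outer3 n v \in C].
have SE v : (v \in S) = (v == x) || (v == F x).
  by rewrite !inE connect_outer.
have yS : y \notin S.
  by rewrite SE negb_or; apply/andP; split; apply/eqP => E'; move: xy yx; rewrite E'; lia.
have eyFy : connect e (outer3 n y) (outer3 n (F y)) by apply: compose_partner_connect.
have par : odd (leftof3 C (outer3 n y)) = odd (leftof3 C (outer3 n (F y))).
  move: (outer3 n (F y)) eyFy; refine (connect_ind _ _) => // u v yu -> uv.
  apply: leftof3_step => //; apply: contra yS => uC.
  by rewrite /S inE; rewrite (closed_connect cl yu).
have FyS : F y \notin S by rewrite inE -(closed_connect cl eyFy).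
have cS : #|S| = 2.
  have -> : 2 = #|[set x; F x]| by rewrite cards2 eq_sym compose_partner_neq.
  by apply: eq_card => v; rewrite SE !inE.
have befE z : before S z = (position x < position z) + (position (F x) < position z).
  rewrite /before (bigD1 x) //= SE eqxx /=; congr (_ + _).
  rewrite (bigD1 (F x)) ?compose_partner_neq //= SE eqxx orbT /= big1 ?addn0 //.
  by move=> u /andP[ux uFx]; rewrite SE (negbTE ux) (negbTE uFx).
move: par; rewrite !leftof3_outer -!before_leftof ?cS // !befE.
lia.
Qed.

Definition compose : diagram t m := Diagram compose_noncrossing.

Lemma connect_stack x y :
  connect e (outer3 n x) (outer3 n y) = (y == x) || (y == compose x).
Proof. exact: connect_outer. Qed.

Lemma compose_unique (F : diagram t m) :
  (forall x, connect e (outer3 n x) (outer3 n (F x))) -> compose = F.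
Proof.
move=> h; apply: diagram_eq => x; have := h x.
by rewrite connect_stack (negbTE (partner_neq F x)) => /eqP.
Qed.
End Planarity.

Lemma connect_compose t n m (D : diagram n m) (E : diagram t n) x :
  connect (stack D E) (outer3 n x) (outer3 n (compose D E x)).
Proof. by rewrite connect_stack eqxx orbT. Qed.

Section Associativity.
Variables (a b c d : nat) (D1 : diagram a b) (D2 : diagram b c) (D3 : diagram c d).
Local Notation level4 := ('I_a + 'I_b + 'I_c + 'I_d)%type.

Let i12 (x : points a b) : level4 := inl (inl x).
Let i23 (x : points b c) : level4 :=
  match x with inl j => inl (inl (inr j)) | inr k => inl (inr k) end.
Let i34 (x : points c d) : level4 :=
  match x with inl k => inl (inr k) | inr l => inr l end.
Let outer4 (x : points a d) : level4 :=
  match x with inl i => inl (inl (inl i)) | inr l => inr l end.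
Let e1 := edges i12 D1.
Let e2 := edges i23 D2.
Let e3 := edges i34 D3.
Let O4 := [in codom outer4].

Let i12I : injective i12. Proof. by move=> ? ? []. Qed.
Let i23I : injective i23. Proof. by move=> [?|?] [?|?] // []->. Qed.
Let i34I : injective i34. Proof. by move=> [?|?] [?|?] // []->. Qed.

Let fL (x : level3 a c d) : level4 :=
  match x with inl (inl i) => inl (inl (inl i)) | inl (inr k) => inl (inr k)
  | inr l => inr l end.
Let fR (x : level3 a b d) : level4 :=
  match x with inl (inl i) => inl (inl (inl i)) | inl (inr j) => inl (inl (inr j))
  | inr l => inr l end.
Let fLI : injective fL. Proof. by move=> [[?|?]|?] [[?|?]|?] // []->. Qed.
Let fRI : injective fR. Proof. by move=> [[?|?]|?] [[?|?]|?] // []->. Qed.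

Let e12 : rel level4 := relU e1 e2.
Let e23 : rel level4 := relU e2 e3.
Let s12 : symmetric e12.
Proof. by move=> x y; rewrite /e12 /= /e1 /e2 edges_sym [X in _ || X]edges_sym. Qed.
Let s23 : symmetric e23.
Proof. by move=> x y; rewrite /e23 /= /e2 /e3 edges_sym [X in _ || X]edges_sym. Qed.

Let isolated (T : finType) (e : rel T) x : (forall y, ~~ e x y) ->
  forall y, connect e x y = (x == y).
Proof.
move=> h y; apply/idP/eqP => [|<-]; last exact: connect0.
by case/connectP => -[|z p] /=; [move=> _ -> | rewrite (negbTE (h z))].
Qed.

Let g12 (x : level3 a b c) : level4 := inl x.
Let g23 (x : level3 b c d) : level4 :=
  match x with inl (inl j) => inl (inl (inr j)) | inl (inr k) => inl (inr k)
  | inr l => inr l end.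
Let g23I : injective g23. Proof. by move=> [[?|?]|?] [[?|?]|?] // []->. Qed.

Let e12_stack x y : e12 (g12 x) (g12 y) = stack D2 D1 x y.
Proof.
apply/orP/orP => -[]/edgesP[u].
- by move=> [->] [->]; left; apply: edges_partner.
- move=> xE yE; right; apply/edgesP; exists u.
    by case: u xE {yE} => [?|?] [->].
  by case: (D2 u) yE => [?|?] [->].
- by move=> -> ->; left; apply/edgesP; exists u.
move=> -> ->; right; apply/edgesP; exists u; first by case: u.
by case: (D2 u).
Qed.

Let e23_stack x y : e23 (g23 x) (g23 y) = stack D3 D2 x y.
Proof.
have L v : i23 v = g23 (lower3 d v) by case: v.
have U v : i34 v = g23 (upper3 b v) by case: v.
apply/orP/orP => -[]/edgesP[u].
- by rewrite !L => /g23I -> /g23I ->; left; apply/edgesP; exists u.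
- by rewrite !U => /g23I -> /g23I ->; right; apply/edgesP; exists u.
- by move=> -> ->; left; apply/edgesP; exists u; rewrite L.
by move=> -> ->; right; apply/edgesP; exists u; rewrite U.
Qed.

Let trace12 : (forall x y, connect e12 (g12 x) (g12 y) = connect (stack D2 D1) x y) /\
  #|components_off e12 [in codom fL]| = loops D2 D1.
Proof.
apply: components_off_embed => //.
- by move=> ? ? [].
- exact: sym_connect_sym.
- move=> x y /orP[]/edgesP[u _ ->]; first by eexists.
  by rewrite /i23; case: (D2 u) => z; eexists.
- move=> x; apply/codomP/codomP => -[y].
    case: y => [[i|k]|l] // [->]; first by exists (inl i).
    by exists (inr k).
  by case: y => [i|k] ->; [exists (inl (inl i)) | exists (inl (inr k))].
move=> [x|l]; first by exists x.
by move=> /negP[]; apply/codomP; exists (inr l).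
Qed.

Let trace23 : (forall x y, connect e23 (g23 x) (g23 y) = connect (stack D3 D2) x y) /\
  #|components_off e23 [in codom fR]| = loops D3 D2.
Proof.
apply: components_off_embed => //.
- exact: sym_connect_sym.
- move=> x y /orP[]/edgesP[u _ ->].
    by case: (D2 u) => z; [exists (inl (inl z)) | exists (inl (inr z))].
  by case: (D3 u) => z; [exists (inl (inr z)) | exists (inr z)].
- move=> x; apply/codomP/codomP => -[y].
    case: y => [[i|k]|l]; case: x => [[?|?]|?] // [->]; first by exists (inl k).
    by exists (inr l).
  by case: y => [i|k] ->; [exists (inl (inr i)) | exists (inr k)].
move=> [[[i|j]|k]|l].
- by move=> /negP[]; apply/codomP; exists (inl (inl i)).
- by exists (inl (inl j)).
- by exists (inl (inr k)).
- by exists (inr l).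
Qed.

Let reduceL w w' : connect (edges (@lower3 a c d) (compose D2 D1)) w w' =
  connect e12 (fL w) (fL w').
Proof.
have isoR l y : connect (edges (@lower3 a c d) (compose D2 D1)) (inr l) y = (inr l == y).
  by apply: isolated => z; apply/negP => /edgesP[].
have isoA l y : connect e12 (inr l) y = (inr l == y).
  by apply: isolated => z; apply/negP => /orP[]/edgesP[] // [].
have F u : fL (inl u) = g12 (outer3 b u) by case: u.
case: w => [u|l]; last by rewrite isoR isoA -(inj_eq fLI).
case: w' => [u'|l].
  rewrite !F trace12.1 connect_stack.
  rewrite connect_edges; last exact: lower3_inj.
  by rewrite edges_image 1?eq_sym //; apply: lower3_inj.
rewrite sym_connect_sym; last exact: edges_sym.
by rewrite isoR sym_connect_sym // isoA -(inj_eq fLI).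
Qed.

Let reduceR w w' : connect (edges (@upper3 a b d) (compose D3 D2)) w w' =
  connect e23 (fR w) (fR w').
Proof.
have isoR i y : connect (edges (@upper3 a b d) (compose D3 D2)) (inl (inl i)) y
    = (inl (inl i) == y).
  by apply: isolated => z; apply/negP => /edgesP[[]].
have isoA i y : connect e23 (inl (inl (inl i))) y = (inl (inl (inl i)) == y).
  by apply: isolated => z; apply/negP => /orP[]/edgesP[[]].
have F u : fR (upper3 a u) = g23 (outer3 c u) by case: u.
have cases (v : level3 a b d) :
    (exists i, v = inl (inl i)) \/ (exists u, v = upper3 a u).
  case: v => [[i|j]|l]; first by left; exists i.
    by right; exists (inl j).
  by right; exists (inr l).
case: (cases w) => [[i ->]|[u ->]]; first by rewrite isoR isoA -(inj_eq fRI).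
case: (cases w') => [[i ->]|[u' ->]].
  rewrite sym_connect_sym; last exact: edges_sym.
  by rewrite isoR sym_connect_sym // isoA -(inj_eq fRI).
rewrite !F trace23.1 connect_stack.
rewrite connect_edges; last exact: upper3_inj.
rewrite edges_image; last exact: upper3_inj.
by rewrite (inj_eq (@upper3_inj _ _ _)) eq_sym.
Qed.

Let edgesL x y : e3 x y -> exists w w',
  [/\ x = fL w, y = fL w' & edges (@upper3 a c d) D3 w w'].
Proof.
have U v : i34 v = fL (upper3 a v) by case: v.
move=> /edgesP[u -> ->]; exists (upper3 a u), (upper3 a (D3 u)).
by rewrite !U edges_partner.
Qed.

Let edgesL' w w' : edges (@upper3 a c d) D3 w w' -> e3 (fL w) (fL w').
Proof.
have U v : i34 v = fL (upper3 a v) by case: v.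
by move=> /edgesP[u -> ->]; apply/edgesP; exists u; rewrite U.
Qed.

Let edgesR x y : e1 x y -> exists w w',
  [/\ x = fR w, y = fR w' & edges (@lower3 a b d) D1 w w'].
Proof.
have U v : i12 v = fR (lower3 d v) by case: v.
move=> /edgesP[u -> ->]; exists (lower3 d u), (lower3 d (D1 u)).
by rewrite !U edges_partner.
Qed.

Let edgesR' w w' : edges (@lower3 a b d) D1 w w' -> e1 (fR w) (fR w').
Proof.
have U v : i12 v = fR (lower3 d v) by case: v.
by move=> /edgesP[u -> ->]; apply/edgesP; exists u; rewrite U.
Qed.

Let connectL x y : connect (stack D3 (compose D2 D1)) (outer3 c x) (outer3 c y) =
  connect (relU e12 e3) (outer4 x) (outer4 y).
Proof.
have o v : outer4 v = fL (outer3 c v) by case: v.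
by rewrite !o -(contract_connect edgesL edgesL' reduceL).
Qed.

Let connectR x y : connect (stack (compose D3 D2) D1) (outer3 b x) (outer3 b y) =
  connect (relU e12 e3) (outer4 x) (outer4 y).
Proof.
have o v : outer4 v = fR (outer3 b v) by case: v.
rewrite !o [RHS](_ : _ = connect (relU e23 e1) (fR (outer3 b x)) (fR (outer3 b y))).
  rewrite -(contract_connect edgesR edgesR' reduceR).
  by apply: eq_connect => u v; rewrite /stack /= orbC.
by apply: eq_connect => u v; rewrite /e12 /e23 /= [RHS]orbC orbA.
Qed.

Lemma composeA : compose D3 (compose D2 D1) = compose (compose D3 D2) D1.
Proof.
apply: compose_unique => x; rewrite connectL -connectR; exact: connect_compose.
Qed.

Lemma loopsA : loops D2 D1 + loops D3 (compose D2 D1) =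
  loops D3 D2 + loops (compose D3 D2) D1.
Proof.
have := contract_components [in codom (@outer3 a c d)] fLI s12 (edges_sym i34 D3)
  edgesL edgesL' reduceL.
have := contract_components [in codom (@outer3 a b d)] fRI s23 (edges_sym i12 D1)
  edgesR edgesR' reduceR.
rewrite trace12.2 trace23.2 => hR hL.
rewrite addnC [RHS]addnC -[LHS]hL /loops.
rewrite (@eq_components_off _ (stack (compose D3 D2) D1)
  (relU (edges (@upper3 a b d) (compose D3 D2)) (edges (@lower3 a b d) D1))
  [in codom (@outer3 a b d)] [in codom (@outer3 a b d)]) //; last first.
  by move=> u v; rewrite /stack /= orbC.
rewrite -[RHS]hR; congr #|pred_of_set _|; apply: eq_components_off.
  by move=> u v; rewrite /e12 /e23 /= -/e1 -/e3 -orbA orbC.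
have oL v : outer4 v = fL (outer3 c v) by case: v.
have oR v : outer4 v = fR (outer3 b v) by case: v.
move=> x; apply/existsP/existsP => -[w /andP[/codomP[u ->] /eqP ->]].
  by exists (outer3 b u); rewrite codom_f -oL -oR eqxx.
by exists (outer3 c u); rewrite codom_f -oL -oR eqxx.
Qed.
End Associativity.

Definition id_partner n : {ffun points n n -> points n n} :=
  [ffun x => match x with inl i => inr i | inr i => inl i end].

Lemma id_noncrossing n : noncrossing_pairing (id_partner n).
Proof.
apply/and3P; split; first by apply/forallP => -[i|i]; rewrite ffunE.
  by apply/forallP => -[i|i]; rewrite !ffunE.
apply/forallP => x; apply/forallP => y; rewrite !ffunE.
by case: x y => i [] j /=; move: (ltn_ord i) (ltn_ord j); lia.
Qed.

Definition id_diagram n : diagram n n := Diagram (id_noncrossing n).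

Lemma id_diagramE n x :
  id_diagram n x = match x with inl i => inr i | inr i => inl i end.
Proof. exact: ffunE. Qed.

Lemma compose_id t n (D : diagram t n) : compose (id_diagram n) D = D.
Proof.
apply: compose_unique => x.
have top j : connect (stack (id_diagram n) D) (inr j) (inl (inr j)).
  apply: connect1; rewrite /stack /=; apply/orP; right.
  by apply/edgesP; exists (inr j); rewrite ?id_diagramE.
have se : connect_sym (stack (id_diagram n) D) by exact/sym_connect_sym/stack_sym.
have low u : connect (stack (id_diagram n) D) (outer3 n u) (lower3 n u).
  by case: u => [i|j]; [exact: connect0 | exact: top].
apply: connect_trans (low _) _; apply: (@connect_trans _ _ (lower3 n (D x))).
  by apply: connect1; rewrite /stack /= (edges_partner (@lower3 t n n)).
by rewrite se.
Qed.

Lemma loops_id t n (D : diagram t n) : loops (id_diagram n) D = 0.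
Proof.
apply/eqP; rewrite cards_eq0; apply/eqP/setP => C; rewrite [RHS]inE.
apply/negP => /components_offP[x _ h].
case: x h => [[i|j]|k] h.
- by move: (h _ (connect0 _ _)); rewrite (codom_f _ (inl i)).
- have := h (inr j); rewrite (codom_f _ (inr j)) => H; suff : ~~ true by []; apply: H.
  apply: connect1; rewrite /stack /=; apply/orP; right.
  by apply/edgesP; exists (inl j); rewrite ?id_diagramE.
- by move: (h _ (connect0 _ _)); rewrite (codom_f _ (inr k)).
Qed.

Definition flip t n (x : points t n) : points n t :=
  match x with inl i => inr i | inr i => inl i end.
Lemma flipK t n : cancel (@flip t n) (@flip n t). Proof. by case. Qed.

Definition reflect_partner t n (D : diagram t n) : {ffun points n t -> points n t} :=
  [ffun x => flip (D (flip x))].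

Lemma position_flip t n (x : points t n) : position (flip x) = (t + n).-1 - position x.
Proof. by case: x => i /=; move: (ltn_ord i); lia. Qed.

Lemma position_lt t n (x : points t n) : position x < t + n.
Proof. by case: x => i /=; move: (ltn_ord i); lia. Qed.

Lemma reflect_noncrossing t n (D : diagram t n) : noncrossing_pairing (reflect_partner D).
Proof.
apply/and3P; split; apply/forallP => x; rewrite !ffunE.
- by apply: contra_neq (partner_neq D (flip x)) => E; rewrite -{2}E flipK.
- by rewrite flipK partnerK flipK.
apply/forallP => y; apply/negP; rewrite !ffunE.
have E (z : points n t) : position z = (t + n).-1 - position (flip z).
  by rewrite -{1}(flipK z) position_flip.
rewrite !position_flip (E x) (E y); move: (flip x) (flip y) => u v {x y E}.
move=> /and3P[uv vu uDv].
move: (position_lt u) (position_lt v) (position_lt (D u)) (position_lt (D v)) => ? ? ? ?.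
apply: (@partner_noncrossing _ _ D (D v) (D u)); rewrite ?partnerK; lia.
Qed.

Definition reflection t n (D : diagram t n) : diagram n t := Diagram (reflect_noncrossing D).

Lemma reflectionE t n (D : diagram t n) x : reflection D x = flip (D (flip x)).
Proof. exact: ffunE. Qed.

Lemma reflectionK t n (D : diagram t n) : reflection (reflection D) = D.
Proof. by apply: diagram_eq => x; rewrite !reflectionE !flipK. Qed.

Lemma reflection_id n : reflection (id_diagram n) = id_diagram n.
Proof. by apply: diagram_eq => -[i|i]; rewrite reflectionE !id_diagramE. Qed.

Section ReflectCompose.
Variables (t n m : nat) (D : diagram n m) (E : diagram t n).
Let f (x : level3 t n m) : level3 m n t :=
  match x with inl (inl i) => inr i | inl (inr j) => inl (inr j)
  | inr k => inl (inl k) end.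
Let fI : injective f. Proof. by move=> [[?|?]|?] [[?|?]|?] // []->. Qed.
Let fsurj y : exists x, y = f x.
Proof. by case: y => [[i|j]|k]; [exists (inr i)|exists (inl (inr j))|exists (inl (inl k))]. Qed.
Let f_lower u : f (lower3 m u) = upper3 m (flip u). Proof. by case: u. Qed.
Let f_upper u : f (upper3 t u) = lower3 t (flip u). Proof. by case: u. Qed.
Let f_outer u : f (outer3 n u) = outer3 n (flip u). Proof. by case: u. Qed.

Let stack_reflect x y :
  stack (reflection E) (reflection D) (f x) (f y) = stack D E x y.
Proof.
apply/orP/orP => -[]/edgesP[u].
- move: (flip u) (flipK u) => v <-; rewrite reflectionE flipK -!f_upper => /fI-> /fI->.
  by right; apply: edges_partner.
- move: (flip u) (flipK u) => v <-; rewrite reflectionE flipK -!f_lower => /fI-> /fI->.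
  by left; apply: edges_partner.
- move=> -> ->; right; rewrite !f_lower; apply/edgesP; exists (flip u) => //.
  by rewrite reflectionE flipK.
- move=> -> ->; left; rewrite !f_upper; apply/edgesP; exists (flip u) => //.
  by rewrite reflectionE flipK.
Qed.

Let embed : (forall x y, connect (stack (reflection E) (reflection D)) (f x) (f y)
    = connect (stack D E) x y) /\
  loops (reflection E) (reflection D) = loops D E.
Proof.
apply: components_off_embed => //; first exact/sym_connect_sym/stack_sym.
move=> x; apply/codomP/codomP => -[u]; last by move=> ->; exists (flip u).
by move: (flip u) (flipK u) => v <-; rewrite -f_outer => /fI ->; eexists.
Qed.

Lemma loops_reflection : loops (reflection E) (reflection D) = loops D E.
Proof. exact: embed.2. Qed.

Lemma compose_reflection :
  compose (reflection E) (reflection D) = reflection (compose D E).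
Proof.
apply: compose_unique => x; move: (flip x) (flipK x) => v <-.
rewrite reflectionE flipK -!f_outer embed.1.
exact: connect_compose.
Qed.
End ReflectCompose.

Lemma id_compose t n (D : diagram t n) : compose D (id_diagram t) = D.
Proof.
by rewrite -[LHS]reflectionK -compose_reflection reflection_id compose_id reflectionK.
Qed.

Lemma loops_id_r t n (D : diagram t n) : loops D (id_diagram t) = 0.
Proof. by rewrite -loops_reflection reflection_id loops_id. Qed.

Local Open Scope ring_scope.

(* TL_n(q) with its basis of diagrams. The carrier does not mention q, which
   only selects the product below; [TL_gen_sq], [TL_gen_neighbours] and
   [TL_gen_distant] are the defining relations of the generators. *)
Definition TL (K : fieldType) (q : K) (n : nat) : Type := {ffun diagram n n -> K^o}.
HB.instance Definition _ (K : fieldType) (q : K) n :=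
  GRing.Lmodule.copy (TL q n) {ffun diagram n n -> K^o}.

Definition is_monic t n (D : diagram t n) : bool :=
  [forall i : 'I_t, exists j : 'I_n, D (inl i) == inr j].

Definition monic_diagram t n : Type := {D : diagram t n | is_monic D}.
HB.instance Definition _ t n := SubFinite.on (monic_diagram t n).

Definition cell (K : fieldType) (q : K) (t n : nat) : Type :=
  {ffun monic_diagram t n -> K}.
HB.instance Definition _ (K : fieldType) (q : K) t n :=
  GRing.Zmodule.copy (cell q t n) {ffun monic_diagram t n -> K}.

Section StructureConstants.
Variables (K : fieldType) (q : K).

Definition loop_value : K := - (q + q^-1).

(* coefficient of the diagram F in the product of the diagrams D and E *)
Definition mul_coef t n m (D : diagram n m) (E : diagram t n) (F : diagram t m) : K :=
  if compose D E == F then loop_value ^+ loops D E else 0.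

Lemma sum_mul_coef_l t n m (D : diagram n m) (E : diagram t n) (f : diagram t m -> K) :
  \sum_G mul_coef D E G * f G = loop_value ^+ loops D E * f (compose D E).
Proof.
rewrite (bigD1 (compose D E)) //= /mul_coef eqxx big1 ?addr0 // => G.
by rewrite eq_sym => /negbTE ->; rewrite mul0r.
Qed.

Lemma mul_coefA a b c d (D1 : diagram a b) (D2 : diagram b c) (D3 : diagram c d) F :
  \sum_G mul_coef D2 D1 G * mul_coef D3 G F = \sum_G mul_coef D3 D2 G * mul_coef G D1 F.
Proof.
rewrite !sum_mul_coef_l /mul_coef composeA; case: eqP => _; rewrite ?mulr0 //.
by rewrite -!exprD loopsA.
Qed.

Lemma mul_coef_id t n (D F : diagram t n) : mul_coef (id_diagram n) D F = (D == F)%:R.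
Proof. by rewrite /mul_coef compose_id loops_id; case: eqP. Qed.
Lemma mul_coef_id_r t n (D F : diagram t n) : mul_coef D (id_diagram t) F = (D == F)%:R.
Proof. by rewrite /mul_coef id_compose loops_id_r; case: eqP. Qed.

Lemma mul_coef_reflection t n m (D : diagram n m) (E : diagram t n) F :
  mul_coef (reflection E) (reflection D) (reflection F) = mul_coef D E F.
Proof.
rewrite /mul_coef compose_reflection loops_reflection.
by rewrite (inj_eq (can_inj (@reflectionK t m))).
Qed.

Local Notation TL := (TL q).
Local Notation cell := (cell q).

Definition TL_basis n (D : diagram n n) : TL n := [ffun F => (F == D)%:R].

Definition TL_one n : TL n := TL_basis (id_diagram n).
Definition TL_mul n (a b : TL n) : TL n :=
  [ffun F => \sum_D \sum_E a D * b E * mul_coef D E F].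

Lemma TL_mulA n : associative (@TL_mul n).
Proof.
move=> a b c; apply/ffunP => F; rewrite !ffunE.
transitivity (\sum_D3 \sum_D2 \sum_D1 a D3 * b D2 * c D1 *
    \sum_G mul_coef D2 D1 G * mul_coef D3 G F).
  apply: eq_bigr => D3 _.
  under eq_bigr => G _ do rewrite ffunE mulr_sumr mulr_suml.
  rewrite exchange_big; apply: eq_bigr => D2 _.
  under eq_bigr => G _ do rewrite mulr_sumr mulr_suml.
  rewrite exchange_big; apply: eq_bigr => D1 _.
  by rewrite mulr_sumr; apply: eq_bigr => G _; rewrite !mulrA.
transitivity (\sum_D3 \sum_D2 \sum_D1 a D3 * b D2 * c D1 *
    \sum_G mul_coef D3 D2 G * mul_coef G D1 F).
  by do 3!(apply: eq_bigr => ? _); rewrite mul_coefA.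
rewrite [RHS](eq_bigr (fun G => \sum_D1 \sum_D3 \sum_D2
   a D3 * b D2 * mul_coef D3 D2 G * c D1 * mul_coef G D1 F)); last first.
  move=> G _; apply: eq_bigr => D1 _; rewrite ffunE !mulr_suml.
  by apply: eq_bigr => D3 _; rewrite !mulr_suml.
rewrite [RHS]exchange_big /=.
under [RHS]eq_bigr => D1 _ do rewrite exchange_big /=.
under [RHS]eq_bigr => D1 _ do under eq_bigr => D3 _ do rewrite exchange_big /=.
rewrite [RHS]exchange_big /=; apply: eq_bigr => D3 _.
rewrite [RHS]exchange_big /=; apply: eq_bigr => D2 _; apply: eq_bigr => D1 _.
by rewrite mulr_sumr; apply: eq_bigr => G _; rewrite !mulrA [in RHS](mulrAC _ _ (c D1)).
Qed.

Lemma TL_mul1 n : left_id (@TL_one n) (@TL_mul n).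
Proof.
move=> a; apply/ffunP => F; rewrite ffunE (bigD1 (id_diagram n)) //= [X in _ + X]big1.
  rewrite addr0 (bigD1 F) //= big1 ?addr0.
    by rewrite ffunE eqxx mul1r mul_coef_id eqxx mulr1.
  by move=> E /negbTE EF; rewrite mul_coef_id EF mulr0.
move=> D /negbTE Did; rewrite big1 // => E _.
by rewrite ffunE Did !mul0r.
Qed.

Lemma TL_mulr1 n : right_id (@TL_one n) (@TL_mul n).
Proof.
move=> a; apply/ffunP => F; rewrite ffunE exchange_big (bigD1 (id_diagram n)) //=.
rewrite [X in _ + X]big1.
  rewrite addr0 (bigD1 F) //= big1 ?addr0.
    by rewrite ffunE eqxx mulr1 mul_coef_id_r eqxx mulr1.
  by move=> E /negbTE EF; rewrite mul_coef_id_r EF mulr0.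
move=> D /negbTE Did; rewrite big1 // => E _.
by rewrite ffunE Did mulr0 mul0r.
Qed.

Lemma TL_mulDl n : left_distributive (@TL_mul n) +%R.
Proof.
move=> a b c; apply/ffunP => F; rewrite !ffunE -big_split; apply: eq_bigr => D _.
by rewrite -big_split; apply: eq_bigr => E _; rewrite /= !ffunE !mulrDl.
Qed.

Lemma TL_mulDr n : right_distributive (@TL_mul n) +%R.
Proof.
move=> a b c; apply/ffunP => F; rewrite !ffunE -big_split; apply: eq_bigr => D _.
by rewrite -big_split; apply: eq_bigr => E _; rewrite /= !ffunE mulrDr !mulrDl.
Qed.

Lemma TL_one_neq0 n : TL_one n != 0.
Proof.
apply/eqP => /ffunP /(_ (id_diagram n)); rewrite !ffunE eqxx.
by apply/eqP/oner_neq0.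
Qed.

HB.instance Definition _ n := GRing.Zmodule_isNzRing.Build (TL n)
  (@TL_mulA n) (@TL_mul1 n) (@TL_mulr1 n) (@TL_mulDl n) (@TL_mulDr n) (TL_one_neq0 n).

Lemma TL_scalerAl n (k : K) (a b : TL n) : k *: (a * b) = (k *: a) * b.
Proof.
apply/ffunP => F; rewrite !ffunE scaler_sumr; apply: eq_bigr => D _.
by rewrite scaler_sumr; apply: eq_bigr => E _; rewrite ffunE /GRing.scale /= !mulrA.
Qed.

Lemma TL_scalerAr n (k : K) (a b : TL n) : k *: (a * b) = a * (k *: b).
Proof.
apply/ffunP => F; rewrite !ffunE scaler_sumr; apply: eq_bigr => D _.
rewrite scaler_sumr; apply: eq_bigr => E _; rewrite ffunE /GRing.scale /= !mulrA.
by rewrite [k * _]mulrC.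
Qed.

HB.instance Definition _ n :=
  GRing.Lmodule_isLalgebra.Build K (TL n) (@TL_scalerAl n).
HB.instance Definition _ n :=
  GRing.Lalgebra_isAlgebra.Build K (TL n) (@TL_scalerAr n).

Lemma compose_monic t n m (D : diagram n m) (E : diagram t n) :
  is_monic (compose D E) -> is_monic E.
Proof.
move=> /forallP h; apply/forallP => i; case Ei : (E (inl i)) => [i'|j]; last first.
  by apply/existsP; exists j.
have /existsP[k /eqP] := h i; suff -> : compose D E (inl i) = inl i' by [].
have := connect_stack D E (inl i) (inl i').
rewrite connect1; last first.
  by rewrite /stack /=; apply/orP; left; apply/edgesP; exists (inl i) => //; rewrite Ei.
case/esym/orP => /eqP // E'.
by case: E' => E'; case/negP: (partner_neq E (inl i)); rewrite Ei E'.
Qed.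

Lemma monic_id t : is_monic (id_diagram t).
Proof. by apply/forallP => i; apply/existsP; exists i; rewrite id_diagramE. Qed.

(* only the coefficients of the monic diagrams are kept *)
Definition cell_act t n (a : TL n) (v : cell t n) : cell t n :=
  [ffun F => \sum_D \sum_(E : monic_diagram t n)
     a D * v E * mul_coef D (val E) (val F)].

Lemma sum_monic t n (f : diagram t n -> K) :
  (forall D, ~~ is_monic D -> f D = 0) ->
  \sum_(E : monic_diagram t n) f (val E) = \sum_D f D.
Proof.
move=> f0; rewrite -(big_sub (@is_monic t n) f) [LHS]big_mkcond; apply: eq_bigr => D _.
by case: ifPn => // Dm; rewrite f0.
Qed.

Lemma mul_coef_nonmonic t n m (D : diagram n m) (E : diagram t n) F :
  ~~ is_monic E -> is_monic F -> mul_coef D E F = 0.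
Proof.
by rewrite /mul_coef; case: eqP => // <- + /compose_monic => /negbTE ->.
Qed.

Lemma cell_actA t n (a b : TL n) (v : cell t n) :
  cell_act a (cell_act b v) = cell_act (a * b) v.
Proof.
apply/ffunP => F; rewrite !ffunE.
transitivity (\sum_D3 \sum_D2 \sum_(D1 : monic_diagram t n) a D3 * b D2 * v D1 *
    \sum_G mul_coef D2 (val D1) G * mul_coef D3 G (val F)).
  apply: eq_bigr => D3 _.
  under eq_bigr => G _ do rewrite ffunE mulr_sumr mulr_suml.
  rewrite exchange_big; apply: eq_bigr => D2 _.
  under eq_bigr => G _ do rewrite mulr_sumr mulr_suml.
  rewrite exchange_big; apply: eq_bigr => D1 _.
  rewrite -sum_monic; last first.
    by move=> D Dm; rewrite [X in _ * X]mul_coef_nonmonic ?mulr0 // (valP F).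
  by rewrite mulr_sumr; apply: eq_bigr => G _; rewrite !mulrA.
transitivity (\sum_D3 \sum_D2 \sum_(D1 : monic_diagram t n) a D3 * b D2 * v D1 *
    \sum_G mul_coef D3 D2 G * mul_coef G (val D1) (val F)).
  by do 3!(apply: eq_bigr => ? _); rewrite mul_coefA.
rewrite [RHS](eq_bigr (fun G => \sum_(D1 : monic_diagram t n) \sum_D3 \sum_D2
   a D3 * b D2 * mul_coef D3 D2 G * v D1 * mul_coef G (val D1) (val F))); last first.
  move=> G _; apply: eq_bigr => D1 _; rewrite ffunE !mulr_suml.
  by apply: eq_bigr => D3 _; rewrite !mulr_suml.
rewrite [RHS]exchange_big /=.
under [RHS]eq_bigr => D1 _ do rewrite exchange_big /=.
under [RHS]eq_bigr => D1 _ do under eq_bigr => D3 _ do rewrite exchange_big /=.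
rewrite [RHS]exchange_big /=; apply: eq_bigr => D3 _.
rewrite [RHS]exchange_big /=; apply: eq_bigr => D2 _; apply: eq_bigr => D1 _.
by rewrite mulr_sumr; apply: eq_bigr => G _; rewrite !mulrA [in RHS](mulrAC _ _ (v D1)).
Qed.

Lemma cell_act1 t n : left_id 1 (@cell_act t n).
Proof.
move=> v; apply/ffunP => F; rewrite ffunE (bigD1 (id_diagram n)) //= [X in _ + X]big1.
  rewrite addr0 (bigD1 F) //= big1 ?addr0.
    by rewrite ffunE eqxx mul1r mul_coef_id eqxx mulr1.
  by move=> E /negbTE EF; rewrite mul_coef_id (inj_eq val_inj) EF mulr0.
move=> D /negbTE Did; rewrite big1 // => E _.
by rewrite ffunE Did !mul0r.
Qed.

Lemma cell_actDr t n : right_distributive (@cell_act t n) +%R.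
Proof.
move=> a v w; apply/ffunP => F; rewrite !ffunE -big_split; apply: eq_bigr => D _.
by rewrite -big_split; apply: eq_bigr => E _; rewrite /= !ffunE mulrDr mulrDl.
Qed.

Lemma cell_actDl t n (v : cell t n) : {morph (@cell_act t n)^~ v : a b / a + b}.
Proof.
move=> a b; apply/ffunP => F; rewrite !ffunE -big_split; apply: eq_bigr => D _.
by rewrite -big_split; apply: eq_bigr => E _; rewrite /= !ffunE !mulrDl.
Qed.

HB.instance Definition _ t n := GRing.Zmodule_isLmodule.Build (TL n) (cell t n)
  (@cell_actA t n) (@cell_act1 t n) (@cell_actDr t n) (@cell_actDl t n).

(* (D1, D2) is the coefficient of the identity in D1^* D2 *)
Definition cell_form t n (v w : cell t n) : K :=
  \sum_(D : monic_diagram t n) \sum_(E : monic_diagram t n)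
    v D * w E * mul_coef (reflection (val D)) (val E) (id_diagram t).

Definition TL_star n (a : TL n) : TL n := [ffun D => a (reflection D)].

Lemma mul_coef_nonmonic_l t n (D E : diagram t n) :
  ~~ is_monic D -> mul_coef (reflection D) E (id_diagram t) = 0.
Proof.
move=> Dm; rewrite -mul_coef_reflection reflectionK reflection_id.
by rewrite mul_coef_nonmonic // monic_id.
Qed.

Lemma cell_form_act t n (a : TL n) (v w : cell t n) :
  cell_form (a *: v) w = cell_form v (TL_star a *: w).
Proof.
transitivity (\sum_D \sum_(E : monic_diagram t n) \sum_(G : monic_diagram t n)
  a D * v E * w G * \sum_F mul_coef D (val E) F *
    mul_coef (reflection F) (val G) (id_diagram t)).
  rewrite /cell_form.
  under eq_bigr => F _ do under eq_bigr => G _ do rewrite ffunE !mulr_suml.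
  under eq_bigr => F _ do rewrite exchange_big /=.
  rewrite exchange_big /=; apply: eq_bigr => D _.
  under eq_bigr => F _ do under eq_bigr => G _ do rewrite !mulr_suml.
  under eq_bigr => F _ do rewrite exchange_big /=.
  rewrite exchange_big /=; apply: eq_bigr => E _.
  rewrite exchange_big /=; apply: eq_bigr => G _.
  rewrite -sum_monic; last first.
    by move=> F Fm; rewrite [X in _ * X]mul_coef_nonmonic_l ?mulr0.
  rewrite mulr_sumr; apply: eq_bigr => F _.
  by rewrite mulrA; congr (_ * _); rewrite mulrAC.
rewrite /cell_form.
under [RHS]eq_bigr => E _ do under eq_bigr => H _ do rewrite ffunE mulr_sumr mulr_suml.
under [RHS]eq_bigr => E _ do rewrite exchange_big /=.
rewrite [RHS]exchange_big /=.
rewrite [RHS](reindex_inj (can_inj (@reflectionK n n))) /=; apply: eq_bigr => D _.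
apply: eq_bigr => E _.
under [RHS]eq_bigr => H _ do rewrite mulr_sumr mulr_suml.
rewrite [RHS]exchange_big /=; apply: eq_bigr => G _.
transitivity (a D * v E * w G * \sum_H mul_coef (reflection D) (val G) H *
    mul_coef (reflection (val E)) H (id_diagram t)).
  rewrite mul_coefA (reindex (@reflection n t)) /=; last first.
    by apply: onW_bij; exists (@reflection t n); apply: reflectionK.
  congr (_ * _); apply: eq_bigr => F _.
  by rewrite -(mul_coef_reflection D) !reflectionK.
rewrite -sum_monic; last first.
  move=> F Fm; rewrite [X in _ * X]mul_coef_nonmonic ?mulr0 //; exact: monic_id.
rewrite mulr_sumr; apply: eq_bigr => F _.
by rewrite ffunE reflectionK !mulrA [a D * v E]mulrC.
Qed.

Lemma cell_formDl t n (u v w : cell t n) :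
  cell_form (u + v) w = cell_form u w + cell_form v w.
Proof.
rewrite /cell_form -big_split; apply: eq_bigr => D _ /=.
by rewrite -big_split; apply: eq_bigr => E _; rewrite ffunE !mulrDl.
Qed.

Definition radical t n : {pred cell t n} :=
  [pred v | `[< forall w : cell t n, cell_form v w = 0 >]].
Arguments radical : clear implicits.

Lemma radical_submod t n : submod_closed (radical t n).
Proof.
split=> [|a u v /asboolP u0 /asboolP v0].
  apply/asboolP => w; apply: (addrI (cell_form 0 w)).
  by rewrite -cell_formDl !addr0.
by apply/asboolP => w; rewrite cell_formDl cell_form_act u0 v0 addr0.
Qed.

End StructureConstants.
Arguments radical {K} q t n.
Arguments radical_submod {K} q t n.
Local Open Scope quotient_scope.

Section QuotientModule.
Variables (A : pzRingType) (M : lmodType A) (S0 : {pred M}) (S0_submod : submod_closed S0).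

Let S : zmodClosed M :=
  HB.pack S0 (GRing.isZmodClosed.Build M S0 (GRing.submod_closedB S0_submod)).

Definition quot_module : Type := Quotient.quot S.
HB.instance Definition _ := GRing.Zmodule.on quot_module.

Definition quot_scale (a : A) (x : quot_module) : quot_module :=
  \pi_(Quotient.quot S) (a *: repr x).

Lemma pi_quot_scale a (v : M) :
  quot_scale a (\pi_(Quotient.quot S) v) = \pi_(Quotient.quot S) (a *: v).
Proof.
apply/eqP; rewrite /quot_scale -Quotient.idealrBE -scalerBr.
apply: (GRing.subsemimod_closedZ (GRing.submod_closed_semi S0_submod)).
by rewrite -[_ \in S0]/(_ \in S) Quotient.idealrBE reprK.
Qed.

Fact quot_scaleA a b v : quot_scale a (quot_scale b v) = quot_scale (a * b) v.
Proof. by rewrite -[v]reprK [quot_scale b _]pi_quot_scale !pi_quot_scale scalerA. Qed.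
Fact quot_scale1 : left_id 1 quot_scale.
Proof. by move=> v; rewrite -[v]reprK pi_quot_scale scale1r. Qed.
Fact quot_scaleDr : right_distributive quot_scale +%R.
Proof.
move=> a u v; rewrite -[u]reprK -[v]reprK -[_ + _](raddfD \pi_(Quotient.quot S)).
by rewrite !pi_quot_scale scalerDr raddfD.
Qed.
Fact quot_scaleDl v : {morph quot_scale^~ v : a b / a + b}.
Proof. by move=> a b; rewrite -[v]reprK !pi_quot_scale scalerDl raddfD. Qed.

HB.instance Definition _ := GRing.Zmodule_isLmodule.Build A quot_module
  quot_scaleA quot_scale1 quot_scaleDr quot_scaleDl.
End QuotientModule.

Section TwoSidedIdeal.
Variables (A : pzRingType) (x : A).

Definition ideal2 : {pred A} :=
  [pred y | `[< exists s : seq (A * A), y = \sum_(p <- s) p.1 * x * p.2 >]].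

Fact ideal2_zmod_closed : zmod_closed ideal2.
Proof.
split=> [|_ _ /asboolP[s ->] /asboolP[s' ->]]; apply/asboolP.
  by exists [::]; rewrite big_nil.
exists (s ++ [seq (- p.1, p.2) | p <- s']); rewrite big_cat big_map /=; congr (_ + _).
by rewrite -sumrN; apply: eq_bigr => p _; rewrite !mulNr.
Qed.
HB.instance Definition _ := GRing.isZmodClosed.Build A ideal2 ideal2_zmod_closed.

Lemma ideal2_mull a y : y \in ideal2 -> a * y \in ideal2.
Proof.
move=> /asboolP[s ->]; apply/asboolP; exists [seq (a * p.1, p.2) | p <- s].
by rewrite big_map mulr_sumr; apply: eq_bigr => p _; rewrite !mulrA.
Qed.
Lemma ideal2_mulr a y : y \in ideal2 -> y * a \in ideal2.
Proof.
move=> /asboolP[s ->]; apply/asboolP; exists [seq (p.1, p.2 * a) | p <- s].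
by rewrite big_map mulr_suml; apply: eq_bigr => p _; rewrite !mulrA.
Qed.

Definition quot_ring : Type := Quotient.quot ideal2.
HB.instance Definition _ := GRing.Zmodule.on quot_ring.

Definition quot_proj (a : A) : quot_ring := \pi_(Quotient.quot ideal2) a.

Definition quot_mul (u v : quot_ring) : quot_ring := quot_proj (repr u * repr v).

Lemma quot_projP a b : (quot_proj a == quot_proj b) = (a - b \in ideal2).
Proof. by rewrite Quotient.idealrBE. Qed.

Lemma quot_projK u : quot_proj (repr u) = u.
Proof. exact: reprK. Qed.

Lemma quot_projM : {morph quot_proj : a b / a * b >-> quot_mul a b}.
Proof.
move=> a b; apply/eqP; rewrite quot_projP.
set a' := repr _; set b' := repr _.
have -> : a * b - a' * b' = (a - a') * b + a' * (b - b').
  by rewrite mulrBl mulrBr addrA subrK.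
by apply: rpredD; [apply: ideal2_mulr|apply: ideal2_mull]; rewrite -quot_projP quot_projK.
Qed.

Fact quot_proj_zmod_morphism : zmod_morphism quot_proj.
Proof. by move=> a b; rewrite /quot_proj raddfB. Qed.
HB.instance Definition _ :=
  GRing.isZmodMorphism.Build A quot_ring quot_proj quot_proj_zmod_morphism.

Fact quot_mulA : associative quot_mul.
Proof.
by move=> u v w; rewrite -[u]quot_projK -[v]quot_projK -[w]quot_projK -!quot_projM mulrA.
Qed.
Fact quot_mul1 : left_id (quot_proj 1) quot_mul.
Proof. by move=> u; rewrite -[u]quot_projK -!quot_projM mul1r. Qed.
Fact quot_mulr1 : right_id (quot_proj 1) quot_mul.
Proof. by move=> u; rewrite -[u]quot_projK -!quot_projM mulr1. Qed.
Fact quot_mulDl : left_distributive quot_mul +%R.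
Proof.
move=> u v w; rewrite -[u]quot_projK -[v]quot_projK -[w]quot_projK.
by rewrite -raddfD -!quot_projM mulrDl raddfD.
Qed.
Fact quot_mulDr : right_distributive quot_mul +%R.
Proof.
move=> u v w; rewrite -[u]quot_projK -[v]quot_projK -[w]quot_projK.
by rewrite -raddfD -!quot_projM mulrDr raddfD.
Qed.
HB.instance Definition _ := GRing.Zmodule_isPzRing.Build quot_ring
  quot_mulA quot_mul1 quot_mulr1 quot_mulDl quot_mulDr.

Fact quot_proj_monoid_morphism : monoid_morphism quot_proj.
Proof. by split=> [|a b]; rewrite ?quot_projM. Qed.
HB.instance Definition _ :=
  GRing.isMonoidMorphism.Build A quot_ring quot_proj quot_proj_monoid_morphism.
End TwoSidedIdeal.

Definition restrict_scalars (A B : pzRingType) (f : {rmorphism A -> B})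
    (M : lmodType B) : Type := M.

Section Restriction.
Variables (A B : pzRingType) (f : {rmorphism A -> B}) (M : lmodType B).
Local Notation restrict_scalars := (restrict_scalars f M).
HB.instance Definition _ := GRing.Zmodule.copy restrict_scalars M.
Definition restrict_scale (a : A) (v : restrict_scalars) : restrict_scalars :=
  f a *: (v : M).
Fact restrict_scaleA a b v :
  restrict_scale a (restrict_scale b v) = restrict_scale (a * b) v.
Proof. by rewrite /restrict_scale scalerA rmorphM. Qed.
Fact restrict_scale1 : left_id 1 restrict_scale.
Proof. by move=> v; rewrite /restrict_scale rmorph1 scale1r. Qed.
Fact restrict_scaleDr : right_distributive restrict_scale +%R.
Proof. by move=> a u v; rewrite /restrict_scale scalerDr. Qed.
Fact restrict_scaleDl v : {morph restrict_scale^~ v : a b / a + b}.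
Proof. by move=> a b; rewrite /restrict_scale rmorphD scalerDl. Qed.
HB.instance Definition _ := GRing.Zmodule_isLmodule.Build A restrict_scalars
  restrict_scaleA restrict_scale1 restrict_scaleDr restrict_scaleDl.
End Restriction.

Definition simple_module (A : pzRingType) (M : lmodType A) : Prop :=
  (exists v : M, v != 0) /\
  forall S : {pred M}, submod_closed S -> S =i pred1 0 \/ S =i predT.

Definition isomorphic (A : pzRingType) (M N : lmodType A) : Prop :=
  exists phi : {linear M -> N}, bijective phi.

Definition generated_subalgebra (K : pzRingType) (A : algType K)
    (X : A -> Prop) (x : A) : Prop :=
  forall S : {pred A}, subalg_closed S -> (forall y, X y -> y \in S) -> x \in S.

(* the diagram with a cup and a cap at positions i and i + 1 (from 0) *)
Section CupCap.
Variables (n : nat) (i : 'I_n.-1).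

Fact cupcap_subproof : (i < n)%N /\ (i.+1 < n)%N.
Proof. by case: i => k /= /[dup]; lia. Qed.
Let l : 'I_n := Ordinal cupcap_subproof.1.
Let r : 'I_n := Ordinal cupcap_subproof.2.

Definition cupcap_partner : {ffun points n n -> points n n} :=
  [ffun x => match x with
     | inl k => if k == l then inl r else if k == r then inl l else inr k
     | inr k => if k == l then inr r else if k == r then inr l else inl k end].

Fact cupcap_noncrossing : noncrossing_pairing cupcap_partner.
Proof.
have lr : (l == r) = false by apply/negbTE/eqP => /(congr1 val) /=; lia.
have rl : (r == l) = false by rewrite eq_sym.
apply/and3P; split; apply/forallP => x.
- by rewrite ffunE; case: x => k; case: (eqVneq k l) => [->|_];
    try case: (eqVneq k r) => [->|_]; apply/eqP => // -[]; lia.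
- rewrite !ffunE; case: x => k; case: (eqVneq k l) => [->|kl]; rewrite ?rl ?eqxx //;
    case: (eqVneq k r) => [->|kr]; rewrite ?lr ?eqxx //;
    by rewrite (negbTE kl) (negbTE kr).
apply/forallP => y; rewrite !ffunE.
have V (k : 'I_n) : (k == l) = (k == i :> nat) by [].
have V' (k : 'I_n) : (k == r) = (k == i.+1 :> nat) by [].
have [il ir] := cupcap_subproof.
case: x y => k [] j; rewrite !V !V'; move: (ltn_ord k) (ltn_ord j);
  (case: (eqVneq (k : nat) i) => ?; [|case: (eqVneq (k : nat) i.+1) => ?]);
  (case: (eqVneq (j : nat) i) => ?; [|case: (eqVneq (j : nat) i.+1) => ?]);
  rewrite /position /=; lia.
Qed.

Definition cupcap : diagram n n := Diagram cupcap_noncrossing.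
End CupCap.

Local Close Scope quotient_scope.

Section TemperleyLieb.
Variables (K : fieldType) (q : K) (n : nat).

(* the generator f_(i+1) *)
Definition TL_gen (i : 'I_n.-1) : TL q n := TL_basis q (cupcap i).

(* the subalgebra TL_m, generated by f_1, ..., f_(m-1) *)
Definition TL_sub (m : nat) (x : TL q n) : Prop :=
  generated_subalgebra (fun y => exists2 i : 'I_n.-1, (i.+1 < m)%N & y = TL_gen i) x.

Definition is_jones_wenzl (m : nat) (E : TL q n) : Prop :=
  [/\ TL_sub m E, E != 0, E * E = E &
    forall i : 'I_n.-1, (i.+1 < m)%N -> TL_gen i * E = 0 /\ E * TL_gen i = 0].

End TemperleyLieb.

(* L_t(n) *)
Definition cell_head (K : fieldType) (q : K) (t n : nat) : Type :=
  quot_module (radical_submod q t n).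
HB.instance Definition _ (K : fieldType) (q : K) t n :=
  GRing.Lmodule.on (cell_head q t n).

Lemma TL_basisM (K : fieldType) (q : K) n (D E : diagram n n) :
  TL_basis q D * TL_basis q E = loop_value q ^+ loops D E *: TL_basis q (compose D E).
Proof.
apply/ffunP => F; rewrite !ffunE (bigD1 D) //= [X in _ + X]big1; last first.
  by move=> D' /negbTE ne; apply: big1 => E' _; rewrite ffunE ne !mul0r.
rewrite addr0 (bigD1 E) //= big1 => [|E' /negbTE ne]; last first.
  by rewrite [X in _ * X * _]ffunE ne mulr0 mul0r.
rewrite addr0 !ffunE !eqxx !mul1r /mul_coef [F == _]eq_sym /GRing.scale /=.
by case: eqP => _; rewrite ?mulr1 ?mulr0.
Qed.

Section Walks.
Variables (t n m : nat) (D : diagram n m) (E : diagram t n).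
Local Notation e := (stack D E).
Local Notation lo := (@lower3 t n m).
Local Notation up := (@upper3 t n m).

Lemma walk_lower x y : E x = y -> connect e (lo x) (lo y).
Proof. by move=> <-; apply: connect1; rewrite /stack /= (edges_partner lo). Qed.

Lemma walk_upper x y : D x = y -> connect e (up x) (up y).
Proof. by move=> <-; apply: connect1; rewrite /stack /= (edges_partner up) orbT. Qed.

Lemma walk_compose x y : x != y -> connect e (outer3 n x) (outer3 n y) -> compose D E x = y.
Proof. by rewrite connect_stack eq_sym => /negbTE-> /eqP. Qed.

Lemma loops_eq0 :
  (forall j, exists u, connect e (inl (inr j)) (outer3 n u)) -> loops D E = 0%N.
Proof.
move=> h; apply/eqP; rewrite cards_eq0; apply/eqP/setP => C; rewrite [RHS]inE.
apply/negP => /components_offP[x _ hx].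
suff [u /hx] : exists u, connect e x (outer3 n u) by rewrite codom_f.
case: x {hx} => [[i|j]|k]; [by exists (inl i)|exact: h|by exists (inr k)].
Qed.
End Walks.

Section Relations.
Variable n : nat.
Local Notation U := (@cupcap n).

Definition paired (i : 'I_n.-1) (a b : 'I_n) : bool :=
  ((a == i :> nat) && (b == i.+1 :> nat)) || ((a == i.+1 :> nat) && (b == i :> nat)).

Lemma paired_neq i a b : paired i a b -> a != b.
Proof. by rewrite /paired => h; apply/eqP => E; subst b; lia. Qed.

Lemma paired_sym i a b : paired i a b -> paired i b a.
Proof. rewrite /paired; lia. Qed.

Lemma cupcap_paired i a b : paired i a b -> U i (inl a) = inl b /\ U i (inr a) = inr b.
Proof.
move=> ab; rewrite !ffunE; set l := Ordinal _; set r := Ordinal _.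
have [E|] := eqVneq a l.
  have -> : b = r by apply: val_inj; move: ab; rewrite /paired E /=; lia.
  by [].
move=> al; have [_|] := eqVneq a r.
  have -> // : b = l.
  by apply: val_inj; move: ab al; rewrite /paired -val_eqE /=; lia.
by move: ab al; rewrite /paired -!val_eqE /=; lia.
Qed.

Lemma cupcap_through i a b k : paired i a b -> k != a -> k != b ->
  U i (inl k) = inr k /\ U i (inr k) = inl k.
Proof.
move=> ab ka kb; rewrite !ffunE; set l := Ordinal _; set r := Ordinal _.
have -> : (k == l) = false by move: ab ka kb; rewrite /paired -!val_eqE /=; lia.
by have -> : (k == r) = false by move: ab ka kb; rewrite /paired -!val_eqE /=; lia.
Qed.

Lemma exists_paired i : exists a b, paired i a b.
Proof.
have [il ir] := cupcap_subproof i.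
by exists (Ordinal il), (Ordinal ir); rewrite /paired /= !eqxx.
Qed.

Lemma compose_cupcap_same i : compose (U i) (U i) = U i.
Proof.
apply: compose_unique => x; have [a [b ab]] := exists_paired i.
have H k : connect (stack (U i) (U i)) (outer3 n (inl k)) (outer3 n (U i (inl k))) /\
   (U i (inr k) = inl k \/ connect (stack (U i) (U i)) (outer3 n (inr k)) (outer3 n (U i (inr k)))).
  have [E|ka] := eqVneq k a.
    subst k; have [-> ->] := cupcap_paired ab; split; last right.
      by apply: (@walk_lower _ _ _ _ _ (inl a) (inl b)); rewrite (cupcap_paired ab).1.
    by apply: (@walk_upper _ _ _ _ _ (inr a) (inr b)); rewrite (cupcap_paired ab).2.
  have [E|kb] := eqVneq k b.
    subst k; move/paired_sym in ab; have [-> ->] := cupcap_paired ab; split; last right.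
      by apply: (@walk_lower _ _ _ _ _ (inl b) (inl a)); rewrite (cupcap_paired ab).1.
    by apply: (@walk_upper _ _ _ _ _ (inr b) (inr a)); rewrite (cupcap_paired ab).2.
  have [E1 E2] := cupcap_through ab ka kb; rewrite E1 E2; split; last by left.
  apply: connect_trans (walk_lower _ E1) _.
  exact: (walk_upper _ E1).
case: x => k; first exact: (H k).1.
have [[h1 _] [_ [E|//]]] := (H k, H k); rewrite E.
rewrite sym_connect_sym; last exact: stack_sym.
by move: h1; rewrite -E partnerK.
Qed.

Lemma loops_cupcap_same i : loops (U i) (U i) = 1%N.
Proof.
have [a [b ab]] := exists_paired i.
set e := stack (U i) (U i).
have ba := paired_sym ab.
pose mid k : level3 n n n := inl (inr k).
have midab : connect e (mid a) (mid b).
  exact: (walk_lower _ (cupcap_paired ab).2).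
have se : connect_sym e by exact/sym_connect_sym/stack_sym.
have st x y c d : paired i c d -> e x y -> x = mid c -> y = mid d.
  move=> cd /orP[]/edgesP[u -> ->].
    by case: u => k // [->]; rewrite (cupcap_paired cd).2.
  by case: u => k // [->]; rewrite (cupcap_paired cd).1.
have cl : forall y, connect e (mid a) y -> y = mid a \/ y = mid b.
  refine (connect_ind _ _) => [|y z _ [] E yz]; first by left.
    by right; apply: (st _ _ _ _ ab yz).
  by left; apply: (st _ _ _ _ ba yz).
apply/eqP/cards1P; exists (component e (mid a)); apply/setP => C; rewrite [RHS]inE.
apply/components_offP/eqP => [[x -> h]|->]; last first.
  by exists (mid a) => // y /cl[]->; apply/negP => /codomP[[]].
case: x h => [[k|k]|k] h.
- by move: (h _ (connect0 _ _)); rewrite (codom_f _ (inl k)).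
- have [->//|ka] := eqVneq k a.
  have [->|kb] := eqVneq k b; first by apply: component_eq => //; rewrite se.
  have /negP[] := h _ (walk_lower (U i) (cupcap_through ab ka kb).2).
  by apply/codomP; exists (inl k).
- by move: (h _ (connect0 _ _)); rewrite (codom_f _ (inr k)).
Qed.

(* for neighbouring i and j, with {p, s} = {i, i+1} and {s, r} = {j, j+1} *)
Section Neighbours.
Variables (i j : 'I_n.-1) (p s r : 'I_n).
Hypotheses (ps : paired i p s) (sr : paired j s r) (pr : p != r).

Let sp := paired_sym ps.
Let rs := paired_sym sr.
Let nps := paired_neq ps.
Let nsr := paired_neq sr.
Let Ui_r : U i (inl r) = inr r /\ U i (inr r) = inl r.
Proof. by apply: (cupcap_through ps); rewrite eq_sym. Qed.
Let Uj_p : U j (inl p) = inr p /\ U j (inr p) = inl p.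
Proof. exact: (cupcap_through sr). Qed.

Let D := compose (U i) (U j).

Let D_p : D (inl p) = inr r.
Proof.
apply: walk_compose => //.
apply: connect_trans (walk_lower _ Uj_p.1) _.
apply: connect_trans (walk_upper _ (cupcap_paired ps).1) _.
apply: connect_trans (walk_lower _ (cupcap_paired sr).2) _.
exact: (walk_upper _ Ui_r.1).
Qed.

Let D_r : D (inl r) = inl s.
Proof.
apply: walk_compose; first by apply: contra_neq nsr => -[].
exact: (walk_lower _ (cupcap_paired rs).1).
Qed.

Let D_top a b : paired i a b -> D (inr a) = inr b.
Proof.
move=> ab; apply: walk_compose; first by apply: contra_neq (paired_neq ab) => -[].
exact: (walk_upper _ (cupcap_paired ab).2).
Qed.

Let D_through k : k != p -> k != s -> k != r -> D (inl k) = inr k.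
Proof.
move=> kp ks kr; apply: walk_compose => //.
apply: connect_trans (walk_lower _ (cupcap_through sr ks kr).1) _.
exact: (walk_upper _ (cupcap_through ps kp ks).1).
Qed.

Lemma compose_cupcap_neighbours : compose (compose (U i) (U j)) (U i) = U i.
Proof.
have thr k : k != p -> k != s ->
    connect (stack D (U i)) (outer3 n (inl k)) (outer3 n (inr k)).
  move=> kp ks; apply: connect_trans (walk_lower _ (cupcap_through ps kp ks).1) _.
  have [E|kr] := eqVneq k r; last exact: (walk_upper _ (D_through kp ks kr)).
  subst k; apply: connect_trans (walk_upper _ D_r) _.
  apply: connect_trans (walk_lower _ (cupcap_paired sp).2) _.
  exact: (walk_upper _ D_p).
have cap a b : paired i a b -> forall x, x = inl a \/ x = inr a ->
    connect (stack D (U i)) (outer3 n x) (outer3 n (U i x)).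
  move=> ab x [] ->.
    by rewrite (cupcap_paired ab).1; apply: (walk_lower _ (cupcap_paired ab).1).
  by rewrite (cupcap_paired ab).2; apply: (walk_upper _ (D_top ab)).
apply: compose_unique => x.
have [k xk] : exists k, x = inl k \/ x = inr k by case: x => k; exists k; auto.
have [E|kp] := eqVneq k p; first by apply: (cap _ _ ps); rewrite -E.
have [E|ks] := eqVneq k s; first by apply: (cap _ _ sp); rewrite -E.
have [E1 E2] := cupcap_through ps kp ks.
case: xk => ->; rewrite ?E1 ?E2; first exact: thr.
by rewrite sym_connect_sym; [exact: thr | exact: stack_sym].
Qed.

Lemma loops_cupcap_neighbours :
  loops (U i) (U j) = 0%N /\ loops (compose (U i) (U j)) (U i) = 0%N.
Proof.
split; apply: loops_eq0 => k.
  have [->|ks] := eqVneq k s.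
    exists (inr r); apply: connect_trans (walk_lower _ (cupcap_paired sr).2) _.
    exact: (walk_upper _ Ui_r.1).
  have [->|kr] := eqVneq k r; first by exists (inr r); apply: (walk_upper _ Ui_r.1).
  by exists (inl k); apply: (walk_lower _ (cupcap_through sr ks kr).2).
have [->|kp] := eqVneq k p; first by exists (inr r); apply: (walk_upper _ D_p).
have [->|ks] := eqVneq k s.
  exists (inr r); apply: connect_trans (walk_lower _ (cupcap_paired sp).2) _.
  exact: (walk_upper _ D_p).
by exists (inl k); apply: (walk_lower _ (cupcap_through ps kp ks).2).
Qed.
End Neighbours.

Section Distant.
Variables (i j : 'I_n.-1) (a b c d : 'I_n).
Hypotheses (ab : paired i a b) (cd : paired j c d).
Hypothesis dist : [&& a != c, a != d, b != c & b != d].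

Lemma loops_cupcap_distant : loops (U i) (U j) = 0%N.
Proof.
apply: loops_eq0 => k; have [ac ad bc bd] := and4P dist.
have [E|kc] := eqVneq k c.
  exists (inr k); apply: (walk_upper _ (cupcap_through ab _ _).1); rewrite E eq_sym //.
have [E|kd] := eqVneq k d.
  exists (inr k); apply: (walk_upper _ (cupcap_through ab _ _).1); rewrite E eq_sym //.
by exists (inl k); apply: (walk_lower _ (cupcap_through cd kc kd).2).
Qed.

Lemma compose_cupcap_distant k :
  compose (U i) (U j) (inl k) =
    (if (k == c) || (k == d) then U j (inl k) else U i (inl k)) /\
  compose (U i) (U j) (inr k) =
    (if (k == a) || (k == b) then U i (inr k) else U j (inr k)).
Proof.
have [ac ad bc bd] := and4P dist.
have far x y : paired i x y -> (x != c) && (x != d).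
  by move: ab; rewrite /paired -!val_eqE /= => ? ?; move: ac ad bc bd; rewrite -!val_eqE /=; lia.
have far' x y : paired j x y -> (x != a) && (x != b).
  by move: cd; rewrite /paired -!val_eqE /= => ? ?; move: ac ad bc bd; rewrite -!val_eqE /=; lia.
have cap x y : paired j x y -> compose (U i) (U j) (inl x) = inl y.
  move=> xy; apply: walk_compose; first by apply: contra_neq (paired_neq xy) => -[].
  exact: (walk_lower _ (cupcap_paired xy).1).
have cup x y : paired i x y -> compose (U i) (U j) (inr x) = inr y.
  move=> xy; apply: walk_compose; first by apply: contra_neq (paired_neq xy) => -[].
  exact: (walk_upper _ (cupcap_paired xy).2).
have zigl x y : paired i x y -> compose (U i) (U j) (inl x) = inl y.
  move=> xy; apply: walk_compose; first by apply: contra_neq (paired_neq xy) => -[].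
  have /andP[xc xd] := far _ _ xy; have /andP[yc yd] := far _ _ (paired_sym xy).
  apply: connect_trans (walk_lower _ (cupcap_through cd xc xd).1) _.
  apply: connect_trans (walk_upper _ (cupcap_paired xy).1) _.
  exact: (walk_lower _ (cupcap_through cd yc yd).2).
have zigr x y : paired j x y -> compose (U i) (U j) (inr x) = inr y.
  move=> xy; apply: walk_compose; first by apply: contra_neq (paired_neq xy) => -[].
  have /andP[xc xd] := far' _ _ xy; have /andP[yc yd] := far' _ _ (paired_sym xy).
  apply: connect_trans (walk_upper _ (cupcap_through ab xc xd).2) _.
  apply: connect_trans (walk_lower _ (cupcap_paired xy).2) _.
  exact: (walk_upper _ (cupcap_through ab yc yd).1).
have ba := paired_sym ab; have dc := paired_sym cd.
have [E|ka] := eqVneq k a.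
  have h : paired i k b by rewrite E.
  rewrite (zigl _ _ h) (cup _ _ h).
  by have /andP[/negbTE-> /negbTE->] := far _ _ h; have [-> ->] := cupcap_paired h.
have [E|kb] := eqVneq k b.
  have h : paired i k a by rewrite E.
  rewrite (zigl _ _ h) (cup _ _ h).
  by have /andP[/negbTE-> /negbTE->] := far _ _ h; have [-> ->] := cupcap_paired h.
have [E|kc] := eqVneq k c.
  have h : paired j k d by rewrite E.
  rewrite (cap _ _ h) (zigr _ _ h).
  by have [-> ->] := cupcap_paired h.
have [E|kd] := eqVneq k d.
  have h : paired j k c by rewrite E.
  rewrite (cap _ _ h) (zigr _ _ h).
  by have [-> ->] := cupcap_paired h.
have [-> _] := cupcap_through ab ka kb; have [hj ->] := cupcap_through cd kc kd.
have E : compose (U i) (U j) (inl k) = inr k.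
  apply: walk_compose => //; apply: connect_trans (walk_lower _ hj) _.
  exact: (walk_upper _ (cupcap_through ab ka kb).1).
by split=> //; rewrite -[in LHS]E partnerK.
Qed.
End Distant.
End Relations.

Section GeneratorRelations.
Variables (K : fieldType) (q : K) (n : nat).
Implicit Types i j : 'I_n.-1.

Lemma TL_gen_sq i : TL_gen q i * TL_gen q i = - (q + q^-1) *: TL_gen q i.
Proof. by rewrite TL_basisM compose_cupcap_same loops_cupcap_same. Qed.

Lemma TL_gen_neighbours i j : j = i.+1 :> nat \/ i = j.+1 :> nat ->
  TL_gen q i * TL_gen q j * TL_gen q i = TL_gen q i.
Proof.
move=> ij.
have [p [s [r [ps sr pr]]]] : exists p s r, [/\ paired i p s, paired j s r & p != r].
  have [il ir] := cupcap_subproof i; have [jl jr] := cupcap_subproof j.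
  case: ij => ij.
    exists (Ordinal il), (Ordinal jl), (Ordinal jr).
    by rewrite /paired -!val_eqE /=; split; lia.
  exists (Ordinal ir), (Ordinal il), (Ordinal jl).
  by rewrite /paired -!val_eqE /=; split; lia.
have [l1 l2] := loops_cupcap_neighbours ps sr pr.
by rewrite TL_basisM l1 scale1r TL_basisM l2 scale1r (compose_cupcap_neighbours ps sr pr).
Qed.

Lemma TL_gen_distant i j : (i.+2 <= j)%N \/ (j.+2 <= i)%N ->
  TL_gen q i * TL_gen q j = TL_gen q j * TL_gen q i.
Proof.
move=> ij; have [a [b ab]] := exists_paired i; have [c [d cd]] := exists_paired j.
have dist : [&& a != c, a != d, b != c & b != d].
  by move: ab cd; rewrite /paired -!val_eqE /=; lia.
have dist' : [&& c != a, c != b, d != a & d != b].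
  by move: ab cd; rewrite /paired -!val_eqE /=; lia.
rewrite !TL_basisM (loops_cupcap_distant ab cd dist) (loops_cupcap_distant cd ab dist').
congr (_ *: TL_basis _ _); apply: diagram_eq => x.
have [ac ad bc bd] := and4P dist.
case: x => k; have [h1 h2] := compose_cupcap_distant ab cd dist k;
  have [h3 h4] := compose_cupcap_distant cd ab dist' k.
  rewrite h1 h3; case: ifP => hcd; case: ifP => hab //.
    by case/orP: hcd hab => /eqP->; rewrite ?(negbTE ac) 1?eq_sym ?(negbTE ac) 1?[_ == b]eq_sym
      ?(negbTE bc) ?(negbTE ad) ?(negbTE bd).
  move/negbT: hcd; move/negbT: hab; rewrite !negb_or => /andP[ka kb] /andP[kc kd].
  by rewrite (cupcap_through ab ka kb).1 (cupcap_through cd kc kd).1.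
rewrite h2 h4; case: ifP => hcd; case: ifP => hab //.
  by move/orP: hcd; move/orP: hab => -[]/eqP E1 -[]/eqP E2; move: ac ad bc bd; rewrite -E1 -E2 eqxx.
move/negbT: hcd; move/negbT: hab; rewrite !negb_or => /andP[ka kb] /andP[kc kd].
by rewrite (cupcap_through ab kc kd).2 (cupcap_through cd ka kb).2.
Qed.
End GeneratorRelations.

(* Main.v *)
(* Label the regions of a diagram by heights in {0, ..., ell - 2}, adjacent regions
   having heights that differ by one; weighting each arc by a quantum integer turns
   an element v of W_t(n) into a function on the walks from 0 to t of length n in
   {0, ..., ell - 2} (the restricted path model of the ABF/RSOS type), on which the
   generators act locally. A state killed by f_1, ..., f_(ell-2) vanishes: by induction
   it vanishes on the walks that first go straight to i + 1 and then turn back, and no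
   walk goes straight to ell - 1. Hence the states of E W_t(n) vanish for t <= ell - 2.
   The vectors with vanishing state are stable under the generators, and lie in the
   radical of the form, because every monic diagram is obtained by generators from
   the one with cups (1,2), (3,4), ..., whose state at the zigzag walk is not zero.
   So E acts as zero on L_t(n). For t >= ell - 1, E fixes the diagram with t through
   strands on the left, which is not in the radical since the loop value is not zero.
   Cellularity gives the classification: a simple module M is a quotient of W_t(n) for
   the least t such that a diagram with t through strands does not kill M. *)

From HB Require Import structures.
Require Import Defs.
From mathcomp Require Import all_boot all_algebra.
From mathcomp Require Import zify ring.
From mathcomp Require Import boolp reals complex.
Set Implicit Arguments.
Unset Strict Implicit.
Unset Printing Implicit Defensive.
Import GRing.Theory.

(** * Composition with a generator *)

Section Surgery.
Variables (t n : nat) (i : 'I_n.-1) (a b : 'I_n) (D : diagram t n).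
Hypothesis ab : paired i a b.
Local Notation D' := (compose (cupcap i) D).

Lemma cupcap_outer_lower x : x != inr a -> x != inr b ->
  connect (stack (cupcap i) D) (outer3 n x) (lower3 n x).
Proof.
case: x => [k _ _|k ka kb]; first exact: connect0.
apply: (@walk_upper _ _ _ _ _ (inr k) (inl k)).
by apply: (cupcap_through ab _ _).2; [apply: contra_neq ka|apply: contra_neq kb] => ->.
Qed.

Let lower_outer x : x != inr a -> x != inr b ->
  connect (stack (cupcap i) D) (lower3 n x) (outer3 n x).
Proof.
move=> xa xb; rewrite sym_connect_sym; last exact: stack_sym.
exact: cupcap_outer_lower.
Qed.

Lemma compose_cupcap_arc : D' (inr a) = inr b.
Proof.
apply: walk_compose; first by apply: contra_neq (paired_neq ab) => -[].
exact: (walk_upper _ (cupcap_paired ab).2).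
Qed.

Lemma compose_cupcap_far x :
  x != inr a -> x != inr b -> D x != inr a -> D x != inr b -> D' x = D x.
Proof.
move=> xa xb ya yb; apply: walk_compose; first by rewrite eq_sym partner_neq.
apply: connect_trans (cupcap_outer_lower xa xb) _.
apply: connect_trans (lower_outer ya yb).
exact: walk_lower.
Qed.

(** The strand from [x] reaches [a], crosses the cap of the generator to [b], and follows the arc of
    [D] that starts there. *)
Lemma compose_cupcap_near x :
  x != inr a -> x != inr b -> D x = inr a -> D' x = D (inr b).
Proof.
move=> xa xb Dx; have Da : D (inr a) = x by rewrite -Dx partnerK.
have ba : (b != a) by rewrite eq_sym (paired_neq ab).
apply: walk_compose.
  apply/eqP => xE; have := partnerK D (inr b); rewrite -xE Dx => -[E].
  by rewrite E eqxx in ba.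
apply: connect_trans (cupcap_outer_lower xa xb) _.
apply: connect_trans (walk_lower _ Dx) _.
apply: (@connect_trans _ _ (lower3 n (inr b))).
  exact: (@walk_upper _ _ _ _ _ (inl a) (inl b) (cupcap_paired ab).1).
apply: connect_trans (walk_lower _ (erefl (D (inr b)))) (lower_outer _ _).
  apply/eqP => E; have := partnerK D (inr b); rewrite E Da => xE.
  by rewrite xE eqxx in xb.
exact: partner_neq.
Qed.

Lemma loops_cupcap_eq0 : D (inr a) != inr b -> loops (cupcap i) D = 0%N.
Proof.
move=> Dab; have ba : (b != a) by rewrite eq_sym (paired_neq ab).
have mid k : D (inr k) != inr a -> D (inr k) != inr b ->
    exists u, connect (stack (cupcap i) D) (inl (inr k)) (outer3 n u).
  move=> ka kb; exists (D (inr k)).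
  exact: connect_trans (walk_lower _ (erefl (D (inr k)))) (lower_outer ka kb).
apply: loops_eq0 => k.
have [->|ka] := eqVneq k a; first by apply: mid => //; apply: partner_neq.
have [->|kb] := eqVneq k b.
  apply: mid; last exact: partner_neq.
  by apply: contra_neq Dab => <-; rewrite partnerK.
exists (inr k); apply: (lower_outer (x := inr k)).
  by apply: contra_neq ka => -[].
by apply: contra_neq kb => -[].
Qed.

Lemma compose_cupcap_id : D (inr a) = inr b -> D' = D.
Proof.
move=> Da; have Db : D (inr b) = inr a by rewrite -Da partnerK.
apply: diagram_eq => x.
have [->|xa] := eqVneq x (inr a); first by rewrite compose_cupcap_arc.
have [->|xb] := eqVneq x (inr b).
  by rewrite Db -[in inr b]compose_cupcap_arc partnerK.
apply: compose_cupcap_far => //.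
  by apply: contra_neq xb => E; rewrite -Da -E partnerK.
by apply: contra_neq xa => E; rewrite -Db -E partnerK.
Qed.

(** Counting the loops of $f_i f_i D$ in both bracketings gives $2x = 1 + x$, because [D'] is
    [D]. *)
Lemma loops_cupcap_eq1 : D (inr a) = inr b -> loops (cupcap i) D = 1%N.
Proof.
move=> Da; have := loopsA D (cupcap i) (cupcap i).
by rewrite loops_cupcap_same compose_cupcap_same compose_cupcap_id //; lia.
Qed.
End Surgery.

Lemma reflection_cupcap n (i : 'I_n.-1) : reflection (cupcap i) = cupcap i.
Proof.
apply: diagram_eq => x; rewrite reflectionE !ffunE.
by case: x => k /=; case: ifP => // _; case: ifP.
Qed.

Lemma compose_cupcap_r t n (i : 'I_t.-1) (D : diagram t n) :
  compose D (cupcap i) = reflection (compose (cupcap i) (reflection D)).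
Proof. by rewrite -{2}(reflection_cupcap i) compose_reflection reflectionK. Qed.

Lemma loops_cupcap_r t n (i : 'I_t.-1) (D : diagram t n) :
  loops D (cupcap i) = loops (cupcap i) (reflection D).
Proof. by rewrite -{2}(reflection_cupcap i) loops_reflection. Qed.

(** * Monic diagrams and their through strands *)

Section Through.
Variables (t n : nat) (D : diagram t n).

Lemma is_monicP : reflect (forall i, exists j, D (inl i) = inr j) (is_monic D).
Proof.
apply: (iffP forallP) => h i.
  by have /existsP[j /eqP ?] := h i; exists j.
by have [j ?] := h i; apply/existsP; exists j; apply/eqP.
Qed.

Lemma through_mono i i' j j' : D (inl i) = inr j -> D (inl i') = inr j' ->
  (i < i')%N -> (j < j')%N.
Proof.
move=> Di Di' ii'; rewrite ltnNge leq_eqVlt; apply/negP => /orP[/eqP/val_inj E|j'j].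
  have := partnerK D (inl i); rewrite Di -E -Di' partnerK => -[E'].
  by rewrite E' ltnn in ii'.
apply: (@partner_noncrossing _ _ D (inl i) (inl i')) => //=; rewrite ?Di ?Di' /=;
  move: (ltn_ord i') (ltn_ord j); lia.
Qed.

Hypothesis Dm : is_monic D.

Lemma through_lower c : (forall i j, D (inl i) = inr j -> (c <= j)%N) ->
  forall i j, D (inl i) = inr j -> (c + i <= j)%N.
Proof.
move=> cj [i it] /=; elim: i it => [|i IH] it j Dj; first by rewrite addn0 (cj _ _ Dj).
have it' := ltnW it; have [j' Dj'] := is_monicP Dm (Ordinal it').
by have := through_mono Dj' Dj (ltnSn _); have := IH it' _ Dj'; lia.
Qed.

(** The strands to the right of [i] end to the right of [j] and need room there. *)
Lemma through_upper i j : D (inl i) = inr j -> (j + t <= n + i)%N.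
Proof.
case: i => i it /=; have [m] := ubnP (t - i); elim: m i it j => // m IH i it j mi Dj.
have [it'|] := ltnP i.+1 t; last by move: (ltn_ord j); lia.
have [j' Dj'] := is_monicP Dm (Ordinal it').
by have := through_mono Dj Dj' (ltnSn _); have := IH _ it' _ _ Dj'; lia.
Qed.

Lemma monic_leq : (t <= n)%N.
Proof.
have [->//|t0] := posnP t.
by have [j /through_upper] := is_monicP Dm (Ordinal t0); rewrite /=; lia.
Qed.
End Through.
Arguments is_monicP {t n D}.

Lemma monic_endo t (D : diagram t t) : is_monic D -> D = id_diagram t.
Proof.
move=> Dm; have E i : D (inl i) = inr i.
  have [j Dj] := is_monicP Dm i; rewrite Dj; congr inr; apply: val_inj => /=.
  have := through_upper Dm Dj; have := @through_lower _ _ _ Dm 0 _ _ _ Dj.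
  by move=> /(_ (fun _ _ _ => leq0n _)); lia.
apply: diagram_eq => x; rewrite id_diagramE; case: x => i //.
by rewrite -[in LHS](E i) partnerK.
Qed.

(** An innermost arc between bottom points joins neighbours: if [a] and [b] are not neighbours, the
    point after [a] is joined to a point inside the arc, which gives a shorter arc. *)
Lemma nonmonic_cap t n (D : diagram t n) : ~~ is_monic D ->
  exists i : 'I_t.-1, exists a b : 'I_t, [/\ a = i :> nat, b = i.+1 :> nat & D (inl a) = inl b].
Proof.
rewrite negb_forall => /existsP[a0 h].
have [a [b [ab Da]]] : exists a b : 'I_t, (a < b)%N /\ D (inl a) = inl b.
  case Da : (D (inl a0)) => [b|j]; last by move: h => /existsP[]; exists j; rewrite Da.
  case: (ltngtP a0 b) => [ab|ba|/val_inj E].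
  - by exists a0, b.
  - by exists b, a0; rewrite -Da partnerK.
  - by have := partner_neq D (inl a0); rewrite Da E eqxx.
have [m] := ubnP (b - a); elim: m a b ab Da => // m IH a b ab Da bm.
have [E|ab'] : b = a.+1 :> nat \/ (a.+1 < b)%N by lia.
  have ai : (a < t.-1)%N by move: (ltn_ord b); lia.
  by exists (Ordinal ai), a, b.
have at' : (a.+1 < t)%N by apply: ltn_trans ab' _.
pose c := Ordinal at'.
have nc := @partner_noncrossing _ _ D (inl a) (inl c).
rewrite Da /= in nc.
case Dc : (D (inl c)) => [d|j]; last first.
  by case: nc => //; rewrite Dc /=; move: (ltn_ord j) (ltn_ord b); lia.
have db : (d <= b)%N.
  by rewrite leqNgt; apply/negP => bd; case: nc => //; rewrite Dc /=.
have db' : (d : nat) <> b.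
  move=> /val_inj E; have := partnerK D (inl a); rewrite Da -E -Dc partnerK => /(congr1 (@position _ _)) /=; lia.
have da : (a <= d)%N.
  rewrite leqNgt; apply/negP => da.
  apply: (@partner_noncrossing _ _ D (inl d) (inl a)) => //=.
    by rewrite -Dc partnerK /=.
  by rewrite -Dc partnerK Da /=.
have da' : (d : nat) <> a.
  move=> /val_inj E; have := partnerK D (inl c); rewrite Dc E Da => /(congr1 (@position _ _)) /=; lia.
have dc : (d : nat) <> c.
  by move=> /val_inj E; have := partner_neq D (inl c); rewrite Dc E eqxx.
by apply: (IH c d) => //; rewrite /= in dc *; lia.
Qed.

(** * Diagrams with cups on the left *)

Definition left_cups k t n (D : diagram t n) : Prop :=
  forall a b : 'I_n, b = a.+1 :> nat -> ~~ odd a -> (a < k.*2)%N -> D (inr a) = inr b.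

Section LeftCups.
Variables (t n : nat).
Implicit Type D : diagram t n.

Lemma left_cups_pair k D (j : 'I_n) : (k.*2 <= n)%N -> left_cups k D -> (j < k.*2)%N ->
  exists2 j' : 'I_n, D (inr j) = inr j' & (j' : nat) = (if odd j then j.-1 else j.+1).
Proof.
move=> kn Dk jk; case: ifPn => oj.
  have jn : (j.-1 < n)%N by move: (ltn_ord j); lia.
  exists (Ordinal jn) => //=.
  have <- : D (inr (Ordinal jn)) = inr j by apply: Dk => /=; lia.
  exact: partnerK.
have jn : (j.+1 < n)%N by lia.
by exists (Ordinal jn) => //; apply: Dk.
Qed.

Lemma left_cups_through k D i j : (k.*2 <= n)%N -> left_cups k D ->
  D (inl i) = inr j -> (k.*2 <= j)%N.
Proof.
move=> kn Dk Di; rewrite leqNgt; apply/negP => /(left_cups_pair kn Dk)[j' Dj _].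
by have := partnerK D (inl i); rewrite Di Dj.
Qed.

(** The [t] through strands keep their order and fill the [t] positions right of the cups. *)
Lemma left_cups_monicE k D i j : n = (t + k.*2)%N -> is_monic D -> left_cups k D ->
  D (inl i) = inr j -> j = (k.*2 + i)%N :> nat.
Proof.
move=> nE Dm Dk Di; have kn : (k.*2 <= n)%N by lia.
have := through_upper Dm Di.
have := through_lower Dm (fun i j => @left_cups_through k D i j kn Dk) Di; lia.
Qed.

Lemma left_cups_unique k D D' : n = (t + k.*2)%N ->
  is_monic D -> left_cups k D -> is_monic D' -> left_cups k D' -> D = D'.
Proof.
move=> nE Dm Dk Dm' Dk'; have kn : (k.*2 <= n)%N by lia.
have E i : D (inl i) = D' (inl i).
  have [j Dj] := is_monicP Dm i; have [j' Dj'] := is_monicP Dm' i.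
  rewrite Dj Dj'; congr inr; apply: val_inj => /=.
  by rewrite (left_cups_monicE nE Dm Dk Dj) (left_cups_monicE nE Dm' Dk' Dj').
apply: diagram_eq => -[//|j]; have [jk|kj] := ltnP j k.*2.
  have [a Da av] := left_cups_pair kn Dk jk; have [b Db bv] := left_cups_pair kn Dk' jk.
  by rewrite Da Db; congr inr; apply: val_inj; rewrite /= av bv.
have it : (j - k.*2 < t)%N by move: (ltn_ord j); lia.
have Ej F : is_monic F -> left_cups k F -> F (inr j) = inl (Ordinal it).
  move=> Fm Fk; have [j' Fj] := is_monicP Fm (Ordinal it).
  suff E' : j' = j by move: Fj; rewrite E' => <-; rewrite partnerK.
  by apply: val_inj; rewrite /= (left_cups_monicE nE Fm Fk Fj) /=; lia.
by rewrite !Ej.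
Qed.

Lemma left_cups_compose k (i : 'I_n.-1) D : (k.*2 <= i)%N -> left_cups k D ->
  left_cups k (compose (cupcap i) D).
Proof.
move=> ki Dk a b bE oa ak; have [c [d cd]] := exists_paired i.
have Da := Dk a b bE oa ak.
have ne (x y : 'I_n) : x <> y :> nat -> inr x != inr y :> points t n.
  by move=> xy; apply/eqP => -[E]; case: xy; rewrite E.
rewrite (compose_cupcap_far cd) ?Da //; apply: ne; move: cd; rewrite /paired; lia.
Qed.

Lemma left_cupsS k (i : 'I_n.-1) D : i = k.*2 :> nat -> left_cups k D ->
  left_cups k.+1 (compose (cupcap i) D).
Proof.
move=> iE Dk a b bE oa ak.
have [ak'|ka] := ltnP a k.*2.
  by apply: left_cups_compose; rewrite ?iE.
by apply: compose_cupcap_arc; rewrite /paired bE; lia.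
Qed.

(** Read from the left, the top points form a word of openings and closings, in which a through
    strand is an opening that is never closed. *)
Definition opens D (j : 'I_n) : bool :=
  match D (inr j) with inl _ => true | inr y => (j < y)%N end.

(** An opening followed by a small cup is the pattern that the generator at [j] simplifies; see
    [closing_sum_lt]. *)
Definition reduced D : Prop := forall j a b : 'I_n,
  a = j.+1 :> nat -> b = j.+2 :> nat -> opens D j -> D (inr a) <> inr b.

(** Were [r'] joined to a point left of [r], the strand opened at [r] would have to cross this
    arc. *)
Lemma opens_next D (r r' : 'I_n) : r' = r.+1 :> nat -> opens D r -> ~~ opens D r' ->
  D (inr r) = inr r'.
Proof.
move=> r'E; rewrite /opens; case Dr' : (D (inr r')) => [//|y].
rewrite -leqNgt leq_eqVlt => h1 /orP[/eqP/val_inj E|yr'].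
  by have := partner_neq D (inr r'); rewrite Dr' E eqxx.
have Dy : D (inr y) = inr r' by rewrite -Dr' partnerK.
have [E|yr] := eqVneq (y : nat) r; first by rewrite -(val_inj E).
have {}yr : (y < r)%N by lia.
have lr' := ltn_ord r'.
exfalso; move: h1; case Dr : (D (inr r)) => [c|z]; [move=> _|move=> rz].
  have Dc : D (inl c) = inr r by rewrite -Dr partnerK.
  apply: (@partner_noncrossing _ _ D (inl c) (inr r')); rewrite ?Dc ?Dr' /=;
    move: (ltn_ord c) (ltn_ord r); lia.
have zr : z <> r' :> nat.
  by move=> /val_inj E; move: Dr'; rewrite -E -Dr partnerK => -[E']; rewrite E' ltnn in yr.
have Dz : D (inr z) = inr r by rewrite -Dr partnerK.
apply: (@partner_noncrossing _ _ D (inr z) (inr r')); rewrite ?Dz ?Dr' /=;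
    move: (ltn_ord z) (ltn_ord r); lia.
Qed.

(** If the next pair [a], [b] is not a cup, no point from [a] on closes: the first closing point
    would end a small cup preceded by an opening. So all these points end through strands, and there
    are more than [t] of them. *)
Lemma reduced_left_cups k D : n = (t + k.*2)%N -> is_monic D -> reduced D ->
  left_cups k D.
Proof.
move=> nE Dm Dr.
suff H i : (i <= k)%N -> left_cups i D by exact: H.
elim: i => [|i IH] ik; first by [].
have {}IH := IH (ltnW ik); have i2n : (i.*2 <= n)%N by lia.
move=> a b bE oa ai; have [ai'|ia] := ltnP a i.*2; first exact: IH.
have aE : a = i.*2 :> nat by lia.
apply/eqP; apply: contraT => /eqP Dab.
have op r : (a <= r)%N -> forall rn : (r < n)%N, opens D (Ordinal rn).
  elim/ltn_ind: r => r IHr ar rn.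
  have [E|ar'] : a = r :> nat \/ (a < r)%N by lia.
    have -> : Ordinal rn = a by apply: val_inj.
    rewrite /opens; case Da : (D _) => [//|y].
    rewrite ltnNge leq_eqVlt; apply/negP => /orP[/eqP/val_inj E'|ya].
      by have := partner_neq D (inr a); rewrite Da E' eqxx.
    have yi : (y < i.*2)%N by lia.
    have [y' Dy y'E] := left_cups_pair i2n IH yi.
    have : y' = a by have := partnerK D (inr a); rewrite Da Dy => -[].
    by move=> E'; move: y'E; rewrite E'; case: ifP; lia.
  case: r IHr ar ar' rn => // r IHr _ ar rn.
  have rn' := ltnW rn; apply/negPn/negP => nop.
  have Drr := @opens_next D (Ordinal rn') (Ordinal rn) (erefl _) (IHr r (ltnSn _) ar _) nop.
  have [E|ar'] : a = r :> nat \/ (a < r)%N by lia.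
    apply: Dab; have -> : a = Ordinal rn' by apply: val_inj.
    have -> // : b = Ordinal rn by apply: val_inj; rewrite /= bE E.
  case: r ar' {ar} IHr rn rn' nop Drr => // r ar IHr rn rn' nop Drr.
  apply: (Dr (Ordinal (ltnW rn')) (Ordinal rn') (Ordinal rn)) => //.
  by apply: IHr.
have th r : (a <= r)%N -> forall rn : (r < n)%N, exists2 c, D (inl c) = inr (Ordinal rn) &
    (r - a <= c)%N.
  elim/ltn_ind: r => r IHr ar rn; have := op _ ar rn; rewrite /opens.
  case Dc : (D (inr (Ordinal rn))) => [c|z]; last first.
    rewrite /= => rz; have az : (a <= z)%N by lia.
    have := op _ az (ltn_ord z); have -> : Ordinal (ltn_ord z) = z by apply: val_inj.
    by rewrite /opens -Dc partnerK /=; lia.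
  move=> _; have Dc' : D (inl c) = inr (Ordinal rn) by rewrite -Dc partnerK.
  exists c => //.
  have [E|ar'] : a = r :> nat \/ (a < r)%N by lia.
    by rewrite E subnn.
  case: r IHr ar ar' rn Dc Dc' => // r IHr _ ar rn Dc Dc'.
  have [c' Dr' rc'] := IHr r (ltnSn _) ar (ltnW rn).
  case: (ltngtP c' c) => [|/(through_mono Dc' Dr') /=|/val_inj E]; [lia|lia|].
  by move: Dr'; rewrite E Dc' => /(congr1 (@position _ _)) /=; lia.
(* The last top point would end a strand of index at least [t]. *)
have an := ltn_ord a; have an1 : (a <= n.-1)%N by lia.
have n1 : (n.-1 < n)%N by lia.
by have [c _] := th _ an1 n1; move: (ltn_ord c); lia.
Qed.
End LeftCups.

(** * Heights on the regions of a diagram *)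

Lemma partner_nested t n (D : diagram t n) x z :
  position x < position z < position (D x) ->
  position x < position (D z) < position (D x).
Proof.
move=> /andP[xz zx]; apply/andP; split; rewrite ltnNge leq_eqVlt; apply/negP => /orP[].
- by move=> /eqP/position_inj E; move: zx; rewrite -E partnerK ltnn.
- by move=> zx'; apply: (@partner_noncrossing _ _ D (D z) x); rewrite ?partnerK.
- by move=> /eqP/position_inj/(can_inj (@partnerK _ _ D)) E; move: xz; rewrite E ltnn.
by move=> xz'; apply: (@partner_noncrossing _ _ D x z).
Qed.

Lemma position_surj t n p : p < t + n -> exists x : points t n, position x = p.
Proof.
move=> pN; have [pt|tp] := ltnP p t; first by exists (inl (Ordinal pt)).
have jn : (t + n).-1 - p < n by lia.
by exists (inr (Ordinal jn)) => /=; lia.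
Qed.

(* The boundary circle of a diagram t -> n has t + n points; H assigns a label to
   each of the t + n + 1 gaps before, between and after them. It is compatible with D
   if it is induced by a labelling of the regions cut out by D. *)
Definition compatible t n (D : diagram t n) (H : nat -> nat) : bool :=
  [forall x, H (position x) == H (position (D x)).+1].

Section Compatible.
Variables (t n : nat) (D : diagram t n) (H : nat -> nat).

Lemma compatibleP : reflect (forall x, H (position x) = H (position (D x)).+1)
  (compatible D H).
Proof. by apply: (iffP forallP) => h x; apply/eqP. Qed.

(** Points joined among themselves leave the gaps before and after them in one region. The proof
    jumps over the arc that starts at [g] and repeats on the remaining interval. *)
Lemma compatible_interval g g' : compatible D H -> g <= g' <= t + n ->
  (forall z, g <= position z < g' -> g <= position (D z) < g') -> H g = H g'.
Proof.
move=> /compatibleP DH; have [m] := ubnP (g' - g).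
elim: m g => // m IH g gm /andP[gg' g'N] cl.
have [->//|{}gg'] : g = g' \/ g < g' by lia.
have [z zg] := @position_surj t n g (leq_trans gg' g'N).
have := cl z; rewrite zg leqnn gg' => /(_ isT)/andP[gz zg'].
have gz' : g <> position (D z).
  by move=> E; have := partner_neq D z; rewrite -(inj_eq (@position_inj _ _)) -E zg eqxx.
rewrite -zg DH; apply: IH; [lia|lia|] => w /andP[zw wg'].
have /andP[gw ->] : g <= position (D w) < g' by apply: cl; lia.
rewrite andbT ltnNge; apply/negP => wz.
have [E|{}gw] : g = position (D w) \/ g < position (D w) by lia.
  by move: E; rewrite -zg => /position_inj E; move: zw; rewrite E partnerK ltnn.
have [E|{}wz] : position (D w) = position (D z) \/ position (D w) < position (D z) by lia.
  move: E => /position_inj/(can_inj (@partnerK _ _ D)) E; move: zw; rewrite E zg; lia.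
have := @partner_nested _ _ D z (D w); rewrite partnerK zg; lia.
Qed.
End Compatible.

Definition upd (H : nat -> nat) (p v r : nat) : nat := if r == p then v else H r.

Definition adjacent (a b : nat) : bool := (b == a.+1) || (a == b.+1).

(** * Quantum weights of diagrams and the local action of the generators *)

Section Amplitude.
Variables (K : fieldType) (q : K).
Local Open Scope ring_scope.
Local Notation delta := (loop_value q).

(* (q - q^-1) times the quantum integer [k], up to the sign (-1)^k *)
Definition qint (k : nat) : K := (- q) ^+ k - (- q) ^- k.

Lemma qint0 : qint 0 = 0. Proof. by rewrite /qint expr0 invr1 subrr. Qed.

Hypothesis q_neq0 : q != 0.

(** The sign in [qint] makes the loop value the coefficient of this recursion. *)
Lemma qintSS k : qint k + qint k.+2 = delta * qint k.+1.
Proof.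
have nq : - q != 0 by rewrite oppr_eq0.
rewrite /qint /loop_value !exprS; field.
by rewrite expf_neq0 // nq q_neq0.
Qed.

(* The weight is the product over the arcs of [b+1], for b the label of the region
   under the arc. As [0] = [ell] = 0, a closed loop keeps its value when the labels
   are restricted to {0, ..., ell - 2}. *)
Definition amplitude t n (D : diagram t n) (H : nat -> nat) : K :=
  if compatible D H then
    \prod_x (if (position x < position (D x))%N then qint (H (position x).+1).+1 else 1)
  else 0.

Variable ell1 : nat.
Hypothesis qint_ell : qint ell1.+1 = 0.

(** This evaluates a closed loop in the restricted model: the neighbours of [a] cut off at either
    end would contribute [0] or [ell], which are zero. *)
Lemma sum_qint_adjacent a : (a < ell1)%N ->
  \sum_(c < ell1 | adjacent a c) qint c.+1 = delta * qint a.+1.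
Proof.
move=> al; rewrite -qintSS.
rewrite -(big_mkord (adjacent a) (fun c => qint c.+1)).
have E : qint a.+2 = \sum_(0 <= c < ell1 | c == a.+1 :> nat) qint c.+1.
  rewrite big_nat1_eq leq0n /=.
  by case: ltnP => // ?; have <- : ell1 = a.+1 by lia.
have E' : qint a = \sum_(0 <= c < ell1 | a == c.+1 :> nat) qint c.+1.
  case: a al {E} => [|a] al; first by rewrite big_pred0 ?qint0.
  under eq_bigl => c do rewrite eqSS eq_sym.
  by rewrite big_nat1_eq leq0n /= (ltnW al).
rewrite E E' [LHS]big_mkcond [X in _ = X + _]big_mkcond [X in _ = _ + X]big_mkcond.
rewrite -big_split; apply: eq_bigr => c _; rewrite /adjacent /=.
case: (eqVneq c a.+1) => [->|_] /=; last by rewrite addr0.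
by rewrite ifF ?add0r //; lia.
Qed.

Section Cupcap.
Variables (t n : nat) (i : 'I_n.-1) (a b : 'I_n) (D : diagram t n) (H : nat -> nat).
Hypotheses (aE : a = i :> nat) (bE : b = i.+1 :> nat).
Local Notation N := (t + n)%N.
Local Notation u := (inr a : points t n).
Local Notation v := (inr b : points t n).
Local Notation p := (position v).
Local Notation U := (compose (cupcap i) D).
Hypothesis H_step : forall r, (r < N)%N -> adjacent (H r) (H r.+1).
Hypothesis H_small : forall r, (r <= N)%N -> (H r < ell1)%N.

Let ab : paired i a b. Proof. by rewrite /paired aE bE !eqxx. Qed.
(** The top is read from right to left, so [b] comes before [a] on the boundary; the gaps around the
    pair are [p], [p.+1] and [p.+2]. *)
Let uE : position u = p.+1.
Proof. by move: (ltn_ord b) => /=; lia. Qed.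
Let uv : u != v.
Proof. by rewrite -(inj_eq (@position_inj _ _)) uE; lia. Qed.
Let Uu : U u = v. Proof. exact: compose_cupcap_arc. Qed.
Let Uv : U v = u. Proof. by rewrite -Uu partnerK. Qed.
Let pos_u z : z != u -> position z != p.+1.
Proof. by rewrite -uE (inj_eq (@position_inj _ _)). Qed.
Let pos_v z : z != v -> position z != p.
Proof. by rewrite (inj_eq (@position_inj _ _)). Qed.

Lemma amplitude_cupcap_neq : H p.+2 <> H p -> amplitude U H = 0.
Proof.
move=> Hp; rewrite /amplitude; case: ifP => // /compatibleP /(_ v).
by rewrite Uv uE => E; case: Hp.
Qed.

Hypothesis Hp : H p.+2 = H p.

(** Only the gap [p.+1] borders the region under the cup that [D] already has, so its label can be
    summed out. The quotient of the quantum integers at [H p.+1] and [H p] is the local weight of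
    the generator, with the denominator cleared. *)
Lemma amplitude_cupcap_loop : D u = v ->
  delta * amplitude U H * qint (H p).+1 =
  qint (H p.+1).+1 * \sum_(c < ell1 | adjacent (H p) c) amplitude D (upd H p.+1 c).
Proof.
move=> Du; have Dv : D v = u by rewrite -Du partnerK.
rewrite (compose_cupcap_id ab Du).
have cE c : compatible D (upd H p.+1 c) = compatible D H.
  apply: eq_forallb => z; rewrite /upd.
  have [->|zu] := eqVneq z u; first by rewrite Du uE !eqxx.
  have [->|zv] := eqVneq z v; first by rewrite Dv uE; do !case: eqP => //; lia.
  rewrite (negbTE (pos_u zu)) eqSS.
  have /pos_v/negbTE -> // : D z != v by apply: contra_neq zu => E; rewrite -Dv -E partnerK.
rewrite /amplitude; case: (boolP (compatible D H)) => [DH|/negbTE DH]; last first.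
  by under eq_bigr => c _ do rewrite cE DH /=; rewrite big1 // !mulr0 mul0r.
under [in RHS]eq_bigr => c _ do rewrite cE DH (bigD1 v) //= Dv uE ltnSn /upd eqxx.
rewrite [in LHS](bigD1 v) //= Dv uE ltnSn.
set P := (X in _ * (_ * X) * _).
under eq_bigr => c _.
  rewrite (_ : \prod_(_ | _) _ = P); last first.
    apply: eq_bigr => z zv; case: ifP => // _.
    by rewrite eqSS (negbTE (pos_v zv)).
  over.
rewrite -mulr_suml sum_qint_adjacent; last by apply: H_small; rewrite /=; lia.
by ring.
Qed.

(** The arcs xu and yv of [D] become xy and uv, the others stay. Compatibility with [D] forces [c]
    to be the label of the gap before [y], so one term of the sum remains, and the weights of two
    arcs are compared in each planar order of the points. *)
Lemma amplitude_cupcap_noloop : D u != v ->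
  amplitude U H * qint (H p).+1 =
  qint (H p.+1).+1 * \sum_(c < ell1 | adjacent (H p) c) amplitude D (upd H p.+1 c).
Proof.
move=> Duv; set x := D u; set y := D v.
have Dx : D x = u by rewrite /x partnerK.
have Dy : D y = v by rewrite /y partnerK.
have xu : x != u by apply: partner_neq.
have yv : y != v by apply: partner_neq.
have yu : y != u by apply: contra_neq Duv => E; rewrite -E /y partnerK.
have xy : x != y by rewrite (can_eq (@partnerK _ _ D)).
have Ux : U x = y by apply: (compose_cupcap_near ab).
have Uy : U y = x by rewrite -Ux partnerK.
have Uz z : z != u -> z != v -> z != x -> z != y -> U z = D z.
  move=> zu zv zx zy; apply: (compose_cupcap_far ab) => //.
    by apply: contra_neq zx => E; rewrite /x -E partnerK.
  by apply: contra_neq zy => E; rewrite /y -E partnerK.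
have [px px1 py py1] : [/\ position x != p, position x != p.+1, position y != p & position y != p.+1].
  by split; [exact: pos_v|exact: pos_u|exact: pos_v|exact: pos_u].
have pxy : position x != position y by rewrite (inj_eq (@position_inj _ _)).
have lx := position_lt x; have ly := position_lt y; have lu := position_lt u; rewrite uE in lu.
(* Planarity leaves three cases: [x] and [y] on different sides of the pair, both after it, or both
   before it; in the last two cases the arcs are nested. *)
have order : [\/ (position y < p)%N && (p.+1 < position x)%N,
    (p.+1 < position x < position y)%N | (position x < position y < p)%N].
  have := @partner_nested _ _ D u v; have := @partner_nested _ _ D x v.
  have := @partner_nested _ _ D v u; have := @partner_nested _ _ D y u.
  rewrite Dx Dy -/x -/y uE => n1 n2 n3 n4.
  clear -n1 n2 n3 n4 px px1 py py1.
  have [h|h] : (position y < p)%N \/ (p.+1 < position y)%N by lia.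
    have [h'|h'] : (position x < p)%N \/ (p.+1 < position x)%N by lia.
      by constructor 3; lia.
    by constructor 1; lia.
  by constructor 2; lia.
(* The gap after [y] and the gap [p] border the same region of the product, since the points between
   the pair and [x], or between [y] and the pair, are joined among themselves. *)
have glue : compatible U H -> H (position y).+1 = H p.
  move=> UH; have /compatibleP UH' := UH.
  have E1 : H p.+2 = H p by rewrite -uE -Uv -UH'.
  have E2 : H (position x) = H (position y).+1 by rewrite -Ux -UH'.
  have [px'|yp] : (p.+1 < position x)%N \/ (position y < p)%N by clear -order; case: order; lia.
    rewrite -E2 -E1; apply/esym/(compatible_interval UH); first by clear -px' lx; lia.
    move=> z /andP[uz zx]; have h := @partner_nested _ _ D u z.
    rewrite -/x uE uz zx in h; have {}h := h isT.
    rewrite Uz; first by clear -h; lia.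
    - by apply/eqP => E; move: uz; rewrite E uE ltnn.
    - by apply/eqP => E; move: uz; rewrite E ltnNge leqW.
    - by apply/eqP => E; move: zx; rewrite E ltnn.
    by apply/eqP => E; move: order uz zx; rewrite E; clear; case; lia.
  apply: (compatible_interval UH); first by clear -yp lu; lia.
  move=> z /andP[yz zv]; have h := @partner_nested _ _ D y z.
  rewrite Dy yz zv in h; have {}h := h isT.
  rewrite Uz; first by clear -h; lia.
  - by apply/eqP => E; move: zv; rewrite E uE ltnNge leqnSn.
  - by apply/eqP => E; move: zv; rewrite E ltnn.
  - by apply/eqP => E; move: order yz zv; rewrite E; clear; case; lia.
  by apply/eqP => E; move: yz; rewrite E ltnn.
have updE c r : r != p.+1 -> upd H p.+1 c r = H r by rewrite /upd => /negbTE ->.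
have upd1 c : upd H p.+1 c p.+1 = c by rewrite /upd eqxx.
have p1 : p != p.+1 by rewrite ltn_eqF.
have p2 : p.+2 != p.+1 by rewrite gtn_eqF.
have Hc c : compatible D (upd H p.+1 c) = compatible U H && (c == H (position y)).
  have oth z : z != u -> z != v -> z != x -> z != y ->
      (upd H p.+1 c (position z) == upd H p.+1 c (position (D z)).+1) =
      (H (position z) == H (position (U z)).+1).
    move=> zu zv zx zy; rewrite Uz // !updE ?pos_u // eqSS pos_v //.
    by apply: contra_neq zy => E; rewrite /y -E partnerK.
  apply/idP/andP => [/compatibleP DH|[UH /eqP cE]].
    have hu := DH u; rewrite -/x uE upd1 updE ?eqSS // in hu.
    have hv := DH v; rewrite -/y !updE ?eqSS // in hv.
    have hx := DH x; rewrite Dx uE !updE // in hx.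
    have hy := DH y; rewrite Dy upd1 updE // in hy.
    split; last by rewrite hy.
    apply/compatibleP => z.
    have [->|zu] := eqVneq z u; first by rewrite Uu uE.
    have [->|zv] := eqVneq z v; first by rewrite Uv uE Hp.
    have [->|zx] := eqVneq z x; first by rewrite Ux hx Hp hv.
    have [->|zy] := eqVneq z y; first by rewrite Uy hy hu.
    by apply/eqP; rewrite -oth // DH.
  have g := glue UH; have /compatibleP UH' := UH.
  have hx := UH' x; rewrite Ux in hx.
  have hy := UH' y; rewrite Uy in hy.
  apply/forallP => z.
  have [->|zu] := eqVneq z u.
    by rewrite -/x uE upd1 updE ?eqSS // cE hy.
  have [->|zv] := eqVneq z v; first by rewrite -/y !updE ?eqSS // g.
  have [->|zx] := eqVneq z x; first by rewrite Dx uE !updE // hx g Hp.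
  have [->|zy] := eqVneq z y; first by rewrite Dy upd1 updE // cE.
  by rewrite oth // UH'.
rewrite /amplitude; case: (boolP (compatible U H)) => [UH|/negbTE UH]; last first.
  rewrite mul0r big1 ?mulr0 // => c _; case: ifP => //.
  by rewrite Hc UH.
have g := glue UH; have /compatibleP UH' := UH.
have hy := UH' y; rewrite Uy in hy.
(* The only label of the gap [p.+1] compatible with [D]; by [glue] it is a neighbour of [H p]. *)
set c0 := H (position y).
have c0l : (c0 < ell1)%N by apply/H_small/ltnW.
have c0a : adjacent (H p) c0.
  by have := H_step ly; rewrite g /adjacent orbC.
rewrite (bigD1 (Ordinal c0l)) // -[nat_of_ord (Ordinal c0l)]/c0 Hc UH eqxx andbT.
rewrite [X in _ = _ * (_ + X)]big1 ?addr0; last first.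
  move=> c /andP[_ cc]; case: ifP => //; rewrite Hc UH andTb => /eqP E.
  by case/negP: cc; apply/eqP/val_inj.
have four (F : points t n -> K) : \prod_z F z = F u * (F v * (F x * (F y *
    \prod_(z | [&& z != u, z != v, z != x & z != y]) F z))).
  rewrite (bigD1 u) //= (bigD1 v) 1?eq_sym //= (bigD1 x) ?xu //= (bigD1 y) ?yu ?yv 1?eq_sym //=.
  by do 4!congr (_ * _); apply: eq_bigl => z; rewrite !andbA.
have lpp : (p.+1 < p)%N = false by rewrite ltnNge leqnSn.
rewrite [in LHS]four [in RHS]four Uu Uv Ux Uy Dx Dy -/x -/y uE ltnSn lpp.
rewrite upd1 (updE _ p.+2) // (updE _ (position x).+1) ?eqSS //.
rewrite (updE _ (position y).+1) ?eqSS // g -hy -/c0 Hp.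
set P := (X in _ = _ * (_ * (_ * (_ * (_ * X))))).
rewrite (_ : \prod_(_ | _) _ = P); last first.
  apply: eq_bigr => z /and4P[zu zv zx zy]; rewrite Uz //; case: ifP => // _.
  by rewrite updE // eqSS pos_v.
have ltp k l : (k < l)%N -> (l < k)%N = false by move=> /ltnW; rewrite leqNgt => /negbTE.
case: order => [/andP[h1 h2]|/andP[h1 h2]|/andP[h1 h2]].
- have h3 : (position y < position x)%N by clear -h1 h2; lia.
  rewrite h1 h2 h3 !(ltp _ _ h1, ltp _ _ h2, ltp _ _ h3).
  ring.
- have h3 : (p < position y)%N by clear -h1 h2; lia.
  rewrite h1 h2 h3 !(ltp _ _ h1, ltp _ _ h2, ltp _ _ h3).
  ring.
- have h3 : (position x < p.+1)%N by clear -h1 h2; lia.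
  have h4 : (position y < position x)%N = false by clear -h1 h2; lia.
  rewrite h1 h2 h3 !(ltp _ _ h1, ltp _ _ h2, ltp _ _ h3).
  ring.
Qed.
End Cupcap.
End Amplitude.

Local Open Scope ring_scope.

(** * Coordinates in the cell modules *)

Section CellBasis.
Variables (K : fieldType) (q : K).
Local Notation delta := (loop_value q).

Lemma basis_actE t n (D : diagram n n) (v : cell q t n) F :
  (TL_basis q D *: v) F = \sum_(E : monic_diagram t n) v E * mul_coef q D (val E) (val F).
Proof.
rewrite ffunE (bigD1 D) //= [X in _ + X]big1 ?addr0 => [|D' /negbTE ne].
  by apply: eq_bigr => E _; rewrite ffunE eqxx mul1r.
by apply: big1 => E _; rewrite ffunE ne !mul0r.
Qed.

(** Since [g] vanishes on the non-monic diagrams, the products that the cell module sets to zero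
    would not contribute. *)
Lemma sum_basis_act t n (D : diagram n n) (v : cell q t n) (g : diagram t n -> K) :
  (forall F, ~~ is_monic F -> g F = 0) ->
  \sum_(F : monic_diagram t n) (TL_basis q D *: v) F * g (val F) =
  \sum_(E : monic_diagram t n) v E * (delta ^+ loops D (val E) * g (compose D (val E))).
Proof.
move=> g0; under eq_bigr => F _ do rewrite basis_actE mulr_suml.
rewrite exchange_big /=; apply: eq_bigr => E _.
under eq_bigr => F _ do rewrite -mulrA.
rewrite -mulr_sumr; congr (_ * _); rewrite -sum_mul_coef_l.
rewrite -(sum_monic (f := fun F => mul_coef q D (val E) F * g F)) // => F /g0 ->.
by rewrite mulr0.
Qed.
End CellBasis.

(** * The restricted path model *)

Section Path.
Variables (t n ell1 : nat).
Local Notation N := (t + n)%N.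

(* a walk on {0, ..., ell - 2} around the boundary circle, straight on the bottom;
   [ell1] stands for ell - 1 *)
Definition boundary_path (H : nat -> nat) : Prop :=
  [/\ forall r, (r <= t)%N -> H r = r, H N = 0%N,
    forall r, (r < N)%N -> adjacent (H r) (H r.+1) & forall r, (r <= N)%N -> (H r < ell1)%N].

Lemma boundary_path_upd H p c : boundary_path H -> (t <= p)%N -> (p.+2 <= N)%N ->
  H p.+2 = H p -> (c < ell1)%N -> adjacent (H p) c -> boundary_path (upd H p.+1 c).
Proof.
move=> [Hb HN Hs Hl] tp pN Hp cl ac; split=> [r rt||r rN|r rN]; rewrite /upd.
- by rewrite ifF ?Hb //; lia.
- by rewrite ifF //; lia.
- rewrite eqSS; have [->|rp1] := eqVneq r p.+1.
    by rewrite gtn_eqF // Hp; move: ac; rewrite /adjacent orbC.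
  by have [->|rp] := eqVneq r p; [|apply: Hs].
by case: eqP => // _; apply: Hl.
Qed.

End Path.

Section PathModel.
Variables (K : fieldType) (q : K).
Local Notation delta := (loop_value q).
Local Notation qint := (qint q).
Hypothesis q_neq0 : q != 0.
Variable ell1 : nat.
Hypothesis qint_ell : qint ell1.+1 = 0.
Hypothesis qint_neq0 : forall k, (k < ell1)%N -> qint k.+1 != 0.
Variables (t n : nat).
Local Notation N := (t + n)%N.
Local Notation path := (boundary_path t n ell1).
Implicit Types (v : cell q t n) (H : nat -> nat).

(** A cap between bottom points [a] and [b] needs equal labels on its two sides, but a path that is
    straight on the bottom has heights differing by two there. *)
Lemma amplitude_nonmonic H (D : diagram t n) :
  (forall r, (r <= t)%N -> H r = r) -> ~~ is_monic D -> amplitude q D H = 0.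
Proof.
move=> Hb /nonmonic_cap[i0 [a [b [aE bE Dab]]]]; rewrite /amplitude ifF //.
apply/negP => /compatibleP/(_ (inl a)); rewrite Dab /= !Hb; last by exact: ltnW.
  lia.
exact: ltn_ord.
Qed.

Definition state v H : K := \sum_(D : monic_diagram t n) v D * amplitude q (val D) H.

Lemma state_basis (D : diagram n n) v H : path H -> state (TL_basis q D *: v) H =
  \sum_(E : monic_diagram t n)
    v E * (delta ^+ loops D (val E) * amplitude q (compose D (val E)) H).
Proof.
case=> Hb _ _ _; apply: (@sum_basis_act _ _ _ _ _ _ (fun E => amplitude q E H)) => F.
exact: amplitude_nonmonic.
Qed.

Lemma state0 H : state 0 H = 0.
Proof. by rewrite /state big1 // => E _; rewrite ffunE mul0r. Qed.

Section Generator.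
Variables (i : 'I_n.-1) (b : 'I_n) (H : nat -> nat).
Hypotheses (bE : b = i.+1 :> nat) (pH : path H).
Local Notation p := (position (inr b : points t n)).

Lemma state_gen_neq v : H p.+2 <> H p -> state (TL_gen q i *: v) H = 0.
Proof.
move=> Hp; rewrite state_basis // big1 // => E _.
have an : (i < n)%N by move: (ltn_ord b); lia.
by rewrite (amplitude_cupcap_neq (a := Ordinal an) _ _ _ bE Hp) ?mulr0.
Qed.

(** The two amplitude formulas have the same right side, so the generator acts on the label of one
    gap, whether or not it closes a loop with a diagram of [v]. *)
Lemma state_gen v : H p.+2 = H p -> state (TL_gen q i *: v) H * qint (H p).+1 =
  qint (H p.+1).+1 * \sum_(c < ell1 | adjacent (H p) c) state v (upd H p.+1 c).
Proof.
move=> Hp; rewrite state_basis // exchange_big mulr_suml mulr_sumr.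
have an : (i < n)%N by move: (ltn_ord b); lia.
apply: eq_bigr => E _; rewrite -mulr_sumr [RHS]mulrCA -mulrA; congr (_ * _).
have ab : paired i (Ordinal an) b by rewrite /paired /= bE !eqxx.
case: pH => Hb _ Hs Hl.
have [Eab|Eab] := eqVneq (val E (inr (Ordinal an))) (inr b).
  rewrite (loops_cupcap_eq1 ab Eab) expr1.
  exact: (amplitude_cupcap_loop q_neq0 qint_ell (a := Ordinal an) _ bE).
rewrite (loops_cupcap_eq0 ab Eab) expr0 mul1r.
exact: (amplitude_cupcap_noloop q_neq0 (a := Ordinal an) _ bE).
Qed.
End Generator.

Definition state_kernel v : Prop := forall H, path H -> state v H = 0.

Lemma state_kernel_gen i v : state_kernel v -> state_kernel (TL_gen q i *: v).
Proof.
move=> v0 H pH; have bn : (i.+1 < n)%N by have := ltn_ord i; lia.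
pose b := Ordinal bn; pose p := position (inr b : points t n).
have [Hp|/eqP Hp] := eqVneq (H p.+2) (H p); last exact: (state_gen_neq (b := b)).
have tp : (t <= p)%N by rewrite /p /=; lia.
have pN : (p.+2 <= N)%N by rewrite /p /=; lia.
have := state_gen (b := b) erefl pH v Hp; rewrite big1 => [|c ca]; last first.
  by apply/v0/boundary_path_upd.
case: pH => _ _ _ Hl; rewrite mulr0 => /eqP; rewrite mulf_eq0.
by rewrite (negbTE (qint_neq0 _)) ?orbF => [/eqP //|]; apply: Hl; lia.
Qed.

Hypothesis ell1_le : (ell1 <= n)%N.

(* all boundary paths leave the straight path before the height ell - 1 *)
Lemma state_kernel_annihilated v :
  (forall i : 'I_n.-1, (i.+1 < ell1)%N -> TL_gen q i *: v = 0) -> state_kernel v.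
Proof.
move=> v0.
(* Read from its end, [H] goes straight up to [j.+1] and back to [j]. The relation of the generator
   at [j] links [H] only to the path whose peak is lowered to [j.-1], which turns back earlier. *)
have dev j : (j.+1 < ell1)%N -> forall H, path H ->
    (forall k, (k <= j.+1)%N -> H (N - k)%N = k) -> H (N - j.+2)%N = j -> state v H = 0.
  elim/ltn_ind: j => j IH jl H pH Hk Hj.
  have jn : (j < n.-1)%N by lia.
  have bn : (j.+1 < n)%N by lia.
  pose b := Ordinal bn; pose p := position (inr b : points t n).
  have p0 : p = (N - j.+2)%N by rewrite /p /=; lia.
  have p1 : p.+1 = (N - j.+1)%N by lia.
  have p2 : p.+2 = (N - j)%N by lia.
  have Hp0 : H p = j by rewrite p0.
  have Hp1 : H p.+1 = j.+1 by rewrite p1 Hk.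
  have Hp2 : H p.+2 = H p by rewrite p2 Hk // Hp0.
  have := state_gen (i := Ordinal jn) (b := b) erefl pH v Hp2.
  rewrite v0 // state0 mul0r -/p Hp1 Hp0 => /esym/eqP.
  rewrite mulf_eq0 (negbTE (qint_neq0 jl)) (bigD1 (Ordinal jl)) /=; last first.
    by rewrite /adjacent eqxx.
  have -> : upd H p.+1 j.+1 = H.
    by apply/funext => r; rewrite /upd; case: eqP => // ->.
  rewrite big1 ?addr0 => [/eqP //|c /andP[/orP[/eqP cj|/eqP jc] cne]].
    by case/negP: cne; apply/eqP/val_inj.
  apply: (IH c) => //; first by lia.
  - by lia.
  - apply: boundary_path_upd => //; rewrite ?Hp0 /adjacent ?jc ?eqxx ?orbT //; lia.
  - by move=> k kc; rewrite /upd ifF ?Hk //; lia.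
  by rewrite /upd -jc p1 eqxx.
move=> H pH; apply/eqP; apply: contraT => vH; case: (pH) => _ HN Hs Hl.
(* A path with nonzero state would go straight up to [ell1], a height that it cannot take. *)
suff Hk k : (k <= ell1)%N -> forall k', (k' <= k)%N -> H (N - k')%N = k'.
  by have := Hl (N - ell1)%N (leq_subr _ _); rewrite (Hk ell1) ?ltnn.
elim: k => [|k IH] kl; first by case=> // _; rewrite subn0.
move=> k'; rewrite leq_eqVlt ltnS => /orP[/eqP->|]; last by apply: IH; lia.
have Hk : H (N - k)%N = k by apply: IH; lia.
have : adjacent (H (N - k.+1)%N) k.
  have E : (N - k = (N - k.+1).+1)%N by lia.
  by rewrite -[X in adjacent _ X]Hk E; apply: Hs; lia.
case/orP => /eqP E; last by rewrite E.
case: k kl IH Hk E => // k kl IH Hk [E].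
by case/eqP: vH; apply: (dev k) => // j jk; apply: IH; lia.
Qed.
End PathModel.

(** * Vectors with vanishing state lie in the radical *)

Section CellForm.
Variables (K : fieldType) (q : K).
Local Notation delta := (loop_value q).

(* zero if D is not monic *)
Definition cell_basis t n (D : diagram t n) : cell q t n := [ffun F => (val F == D)%:R].

Lemma cell_basis_nonmonic t n (D : diagram t n) : ~~ is_monic D -> cell_basis D = 0.
Proof.
move=> Dm; apply/ffunP => F; rewrite !ffunE; case: eqP => // FD.
by case/negP: Dm; rewrite -FD (valP F).
Qed.

Lemma sum_cell_basis t n (E : monic_diagram t n) (f : monic_diagram t n -> K) :
  \sum_F cell_basis (val E) F * f F = f E.
Proof.
rewrite (bigD1 E) //= ffunE eqxx mul1r big1 ?addr0 // => F /negbTE ne.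
by rewrite ffunE (inj_eq val_inj) ne mul0r.
Qed.

Lemma cell_formE t n (v w : cell q t n) :
  cell_form v w = \sum_(E : monic_diagram t n) w E * cell_form v (cell_basis (val E)).
Proof.
rewrite /cell_form exchange_big /=; apply: eq_bigr => E _.
rewrite mulr_sumr; apply: eq_bigr => D _.
under [X in _ = _ * X]eq_bigr => F _ do rewrite mulrAC mulrC.
by rewrite sum_cell_basis; ring.
Qed.

Lemma cell_form0r t n (v : cell q t n) : cell_form v 0 = 0.
Proof. by rewrite cell_formE big1 // => E _; rewrite ffunE mul0r. Qed.

Lemma cell_form0l t n (v : cell q t n) : cell_form 0 v = 0.
Proof. by rewrite /cell_form big1 // => D _; rewrite big1 // => E _; rewrite ffunE !mul0r. Qed.

Lemma basis_act_basis t n (D : diagram n n) (E : monic_diagram t n) F :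
  (TL_basis q D *: cell_basis (val E)) F =
  delta ^+ loops D (val E) * cell_basis (compose D (val E)) F.
Proof.
rewrite basis_actE sum_cell_basis /mul_coef ffunE eq_sym.
by case: eqP; rewrite ?mulr1 ?mulr0.
Qed.

Lemma cell_form_basis t n (D : diagram n n) (v : cell q t n) (E : monic_diagram t n) :
  cell_form v (TL_basis q D *: cell_basis (val E)) =
  delta ^+ loops D (val E) * cell_form v (cell_basis (compose D (val E))).
Proof.
rewrite cell_formE [in RHS]cell_formE mulr_sumr; apply: eq_bigr => F _.
by rewrite basis_act_basis mulrA.
Qed.

(** A generator is its own reflection, so [TL_star] fixes it. *)
Lemma cell_form_gen t n i (v w : cell q t n) :
  cell_form (TL_gen q i *: v) w = cell_form v (TL_gen q i *: w).
Proof.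
rewrite cell_form_act; congr (cell_form _ (_ *: _)); apply/ffunP => D.
by rewrite !ffunE -(inj_eq (can_inj (@reflectionK n n))) reflectionK reflection_cupcap.
Qed.

Lemma radicalP t n (v : cell q t n) :
  reflect (forall E : monic_diagram t n, cell_form v (cell_basis (val E)) = 0)
    (v \in radical q t n).
Proof.
apply: (iffP idP) => [/asboolP h E|h]; first exact: h.
by apply/asboolP => w; rewrite cell_formE big1 // => E _; rewrite h mulr0.
Qed.
End CellForm.

Section ClosingSum.
Variables (t n : nat).

(** The induction measure of [state_kernel_radical]; it is small when the arcs close far to the
    left. *)
Definition closing_sum (D : diagram t n) : nat := (\sum_(k < n) ~~ opens D k * k)%N.

(** The product joins [j] to [a] and gives the old partner of [j] to [b], so a closing moves from
    [b] to [a]; all other points keep their type. *)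
Lemma closing_sum_lt (i : 'I_n.-1) (j a b : 'I_n) (D : diagram t n) :
  j = i :> nat -> a = j.+1 :> nat -> b = j.+2 :> nat -> opens D j -> D (inr a) = inr b ->
  (closing_sum (compose (cupcap i) D) < closing_sum D)%N.
Proof.
move=> ji aj bj oj Da; set D' := compose _ _.
have Db : D (inr b) = inr a by rewrite -Da partnerK.
have ja : paired i a j by rewrite /paired ji aj; lia.
have aj' : paired i j a by apply: paired_sym.
have ne (x y : 'I_n) : x <> y :> nat -> inr x != inr y :> points t n.
  by move=> xy; apply/eqP => -[E]; case: xy; rewrite E.
have Dj' : D' (inr j) = inr a by apply: (compose_cupcap_arc D aj').
have Da' : D' (inr a) = inr j by rewrite -Dj' partnerK.
have Db' : D' (inr b) = D (inr j).
  by apply: (compose_cupcap_near ja) => //; apply: ne; lia.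
have Djab : (D (inr j) != inr a) && (D (inr j) != inr b).
  apply/andP; split; apply/eqP => E; have := partnerK D (inr j).
    by rewrite E Da => /(congr1 (@position _ _)) /=; move: (ltn_ord b); lia.
  by rewrite E Db => /(congr1 (@position _ _)) /=; move: (ltn_ord b); lia.
have same k : k != a -> k != b -> opens D' k = opens D k.
  move=> ka kb; have [->|kj] := eqVneq k j.
    by rewrite oj /opens Dj' aj ltnSn.
  have [E|kE] := eqVneq (D (inr k)) (inr j).
    have Dk : D (inr j) = inr k by rewrite -E partnerK.
    have jk : (j < k)%N by move: oj; rewrite /opens Dk.
    have D'k : D' (inr k) = inr b by rewrite -[inr k]Dk -Db' partnerK.
    rewrite /opens D'k E.
    have : (k : nat) <> a by move/val_inj/eqP; rewrite (negbTE ka).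
    by lia.
  have kne (x : 'I_n) : k != x -> inr k != inr x :> points t n by apply: contra_neq => -[].
  have Dka : D (inr k) != inr a.
    apply: contraNneq kb => E; suff [->] : inr k = inr b :> points t n by [].
    by rewrite -Da -E partnerK.
  by rewrite /opens (compose_cupcap_far ja (kne _ ka) (kne _ kj) Dka kE).
have ab : b != a by rewrite -val_eqE /=; lia.
rewrite /closing_sum (bigD1 a) // [X in (_ < X)%N](bigD1 a) //.
rewrite (bigD1 b) // [X in (_ < _ + X)%N](bigD1 b) //=.
rewrite (eq_bigr (fun k : 'I_n => ~~ opens D k * k)%N); last first.
  by move=> k /andP[ka kb]; rewrite same.
have -> : opens D a = true by rewrite /opens Da; lia.
have -> : opens D b = false by rewrite /opens Db; lia.
have -> : opens D' a = false by rewrite /opens Da'; lia.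
have -> : opens D' b = true.
  move: oj Djab; rewrite /opens Db'; case: (D (inr j)) => // y jy /andP[ya yb].
  have : y <> a :> nat by move/val_inj => E; rewrite E eqxx in ya.
  have : y <> b :> nat by move/val_inj => E; rewrite E eqxx in yb.
  by lia.
by rewrite /=; lia.
Qed.
End ClosingSum.

Section Radical.
Variables (K : fieldType) (q : K).
Local Notation delta := (loop_value q).
Hypothesis q_neq0 : q != 0.
Hypothesis delta_neq0 : delta != 0.
Variable ell1 : nat.
Hypothesis qint_ell : qint q ell1.+1 = 0.
Hypothesis qint_neq0 : forall k, (k < ell1)%N -> qint q k.+1 != 0.
Hypothesis ell1_gt1 : (1 < ell1)%N.
Variables (t k : nat).
Local Notation n := (t + k.*2)%N.
Local Notation N := (t + n)%N.
Hypothesis t_lt : (t < ell1)%N.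
Implicit Types (v : cell q t n).

(* the path of the diagram whose cups are (0,1), (2,3), ..., seen from the top left *)
Let top (r : nat) : nat := if (k.*2 <= r)%N then (r - k.*2)%N else odd r.
Let zigzag (p : nat) : nat := if (p <= t)%N then p else top (N - p).

Let zigzag_top r : (r <= n)%N -> zigzag (N - r) = top r.
Proof.
move=> rn; rewrite /zigzag; have -> : (N - (N - r) = r)%N by lia.
by case: ifP => // h; rewrite /top ifT; lia.
Qed.

Let top_adjacent r : adjacent (top r.+1) (top r).
Proof.
rewrite /top /adjacent; have [kr|rk] := leqP k.*2 r.
  by rewrite leqW // subSn // eqxx orbT.
have [kr|rk'] := leqP k.*2 r.+1.
  have -> : k.*2 = r.+1 by lia.
  have -> : odd r = true by lia.
  by rewrite subnn.
by rewrite /=; case: odd.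
Qed.

Let zigzag_path : boundary_path t n ell1 zigzag.
Proof.
split=> [r rt||r rN|r rN].
- by rewrite /zigzag rt.
- rewrite -[N]subn0 zigzag_top // /top; case: ifP => //; lia.
- have [rt|tr] := ltnP r t; first by rewrite /zigzag rt (ltnW rt) /adjacent eqxx.
  have rE : r = (N - (N - r.+1).+1)%N by clear -rN; lia.
  have rE' : r.+1 = (N - (N - r.+1))%N by clear -rN; lia.
  rewrite rE' {1}rE !zigzag_top; first exact: top_adjacent.
    by clear -tr rN; lia.
  by clear -tr rN; lia.
rewrite /zigzag; case: ifP => [rt|rt]; first exact: leq_ltn_trans t_lt.
rewrite /top; case: ifP => [h|_].
  by clear -rt t_lt; lia.
by apply: leq_trans ell1_gt1; case: odd.
Qed.

(** Along the cups the zigzag has height 0 outside and 1 inside, and it agrees at both ends of each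
    through strand. All labels are below [ell1], so no weight vanishes. *)
Let amplitude_zigzag (D : diagram t n) : is_monic D -> left_cups k D ->
  amplitude q D zigzag != 0.
Proof.
move=> Dm Dk; have kn : (k.*2 <= n)%N by lia.
rewrite /amplitude ifT; last first.
  have th i j : D (inl i) = inr j ->
      zigzag i = zigzag (N.-1 - j).+1 /\ zigzag (N.-1 - j) = zigzag i.+1.
    move=> /(left_cups_monicE erefl Dm Dk) ->; have := ltn_ord i.
    move: (i : nat) => r rt; clear -rt top_adjacent zigzag_top.
    have -> : ((N.-1 - (k.*2 + r)).+1 = N - (k.*2 + r))%N by lia.
    have -> : (N.-1 - (k.*2 + r) = N - (k.*2 + r).+1)%N by lia.
    rewrite !zigzag_top; [|lia|lia].
    rewrite /zigzag /top rt (ltnW rt) leq_addr (leqW (leq_addr _ _)); lia.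
  apply/compatibleP => -[i|j].
    by have [j Di] := is_monicP Dm i; rewrite Di; case: (th _ _ Di).
  case Dj : (D (inr j)) => [i|j'].
    have Di : D (inl i) = inr j by rewrite -Dj partnerK.
    by case: (th _ _ Di).
  have [kj|jk] := leqP k.*2 j.
    have it : (j - k.*2 < t)%N by move: (ltn_ord j); lia.
    have [j0 Di] := is_monicP Dm (Ordinal it).
    have E := left_cups_monicE erefl Dm Dk Di.
    have E' : j0 = j by apply: val_inj; rewrite /= E /=; lia.
    by have := partnerK D (inl (Ordinal it)); rewrite Di E' Dj.
  have [j0] := left_cups_pair kn Dk jk; rewrite Dj => -[<-] E.
  have jn := ltn_ord j; have j'n := ltn_ord j'.
  have -> : position (inr j : points t n) = (N - j.+1)%N by rewrite /=; clear -jn; lia.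
  have -> : (position (inr j' : points t n)).+1 = (N - j')%N by rewrite /=; clear -j'n; lia.
  rewrite !zigzag_top // ?(ltnW j'n) //; move: E; rewrite /top.
  by clear -jk; case: ifP => oj ->; do ![case: ifP]; lia.
apply/prodf_neq0 => x _; case: ifP => _; last exact: oner_neq0.
apply: qint_neq0; case: zigzag_path => _ _ _; apply.
exact: position_lt.
Qed.

(** The form with [D] is treated by induction on [closing_sum]. Generators move to the other side of
    the form by adjointness, and a reduced [D] is the diagram with its cups on the left. *)
Lemma state_kernel_radical v : state_kernel ell1 v -> v \in radical q t n.
Proof.
move=> v0; apply/radicalP => -[D Dm] /=.
have [m] := ubnP (closing_sum D); elim: m D Dm v v0 => // m IH D Dm v v0 Dlt.
pose dD : monic_diagram t n := Sub D Dm.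
have form_cup (i : 'I_n.-1) (a b : 'I_n) w : paired i a b -> D (inr a) = inr b ->
    cell_form w (TL_gen q i *: cell_basis q D) = delta * cell_form w (cell_basis q D).
  move=> ab Da; rewrite (cell_form_basis _ _ dD) /=.
  by rewrite (loops_cupcap_eq1 ab Da) (compose_cupcap_id ab Da) expr1.
have [[j [a [b [aj bj oj Da]]]]|nr] := pselect (exists j a b : 'I_n,
    [/\ a = j.+1 :> nat, b = j.+2 :> nat, opens D j & D (inr a) = inr b]).
  (* D is f_i1 f_i0 D, and f_i0 D has a smaller closing sum. *)
  have jn : (j < n.-1)%N by move: (ltn_ord b); lia.
  have an : (a < n.-1)%N by move: (ltn_ord b); lia.
  pose i0 := Ordinal jn; pose i1 := Ordinal an.
  have ab : paired i1 a b by rewrite /paired /= aj bj; lia.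
  apply: (mulfI delta_neq0); rewrite mulr0 -(form_cup i1 a b _ ab Da).
  have <- : TL_gen q i1 * TL_gen q i0 * TL_gen q i1 = TL_gen q i1.
    by apply: TL_gen_neighbours; right.
  rewrite -!scalerA -2!cell_form_gen (form_cup i1 a b _ ab Da) cell_form_gen.
  rewrite (cell_form_basis _ _ dD) /=.
  case: (boolP (is_monic (compose (cupcap i0) D))) => [D'm|/cell_basis_nonmonic ->]; last first.
    by rewrite cell_form0r !mulr0.
  rewrite (IH _ D'm) ?mulr0 //; first exact: state_kernel_gen.
  by have := closing_sum_lt (i := i0) erefl aj bj oj Da; lia.
have Dk : left_cups k D.
  apply: reduced_left_cups => // j a b aj bj oj Da; apply: nr.
  by exists j, a, b.
(* Up to a scalar, D is f_1 f_3 ... D, and these generators can be moved to v, where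
   they leave a multiple of D; the state at the zigzag path shows that it is zero. *)
suff H j w : (j <= k)%N -> state_kernel ell1 w ->
    (forall F : monic_diagram t n, w F != 0 -> left_cups (k - j) (val F)) ->
    cell_form w (cell_basis q D) = 0.
  by apply: (H k v) => // F _; rewrite subnn.
elim: j w => [|j IHj] w jk w0 wk.
  rewrite subn0 in wk.
  (* With all [k] cups in place, the support of [w] contains at most [D]. *)
  have wF F : F != dD -> w F = 0.
    move=> FD; apply/eqP; apply: contraT => /wk Fk; case/negP: FD; apply/eqP/val_inj.
    exact: (left_cups_unique erefl (valP F) Fk Dm Dk).
  have w0' : w = 0.
    apply/ffunP => F; rewrite ffunE; have [->|/wF //] := eqVneq F dD.
    have := w0 _ zigzag_path; rewrite /state (bigD1 dD) //= big1 ?addr0 => [/eqP|F' /wF ->].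
      by rewrite mulf_eq0 (negbTE (amplitude_zigzag Dm Dk)) orbF => /eqP.
    by rewrite mul0r.
  by rewrite w0' cell_form0l.
(* The generator at this position adds the next left cup to every diagram in the support of [w]. *)
have rn : ((k - j.+1).*2 < n.-1)%N by lia.
pose i := Ordinal rn.
have an : ((k - j.+1).*2 < n)%N by lia.
have bn : ((k - j.+1).*2.+1 < n)%N by lia.
have ab : paired i (Ordinal an) (Ordinal bn) by rewrite /paired /= !eqxx.
apply: (mulfI delta_neq0); rewrite mulr0 -(form_cup i _ _ _ ab); last first.
  by apply: Dk => /=; lia.
rewrite -cell_form_gen; apply: IHj; [lia|exact: state_kernel_gen|move=> F].
rewrite basis_actE => nz.
have [E /eqP wE] : exists E, w E * mul_coef q (cupcap i) (val E) (val F) <> 0.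
  apply: contrapT => nE; case/negP: nz; apply/eqP/big1 => E _.
  by apply: contrapT => wE; apply: nE; exists E.
have wE0 : w E != 0 by apply/eqP => E0; move: wE; rewrite E0 mul0r eqxx.
move: wE; rewrite /mul_coef; case: (compose _ _ =P _) => [<- _|_]; last by rewrite mulr0 eqxx.
have -> : (k - j = (k - j.+1).+1)%N by lia.
by apply: left_cupsS => //; apply: wk.
Qed.
End Radical.

(** * Heads of modules *)

Local Open Scope quotient_scope.

Section QuotPi.
Variables (A : pzRingType) (M : lmodType A) (S0 : {pred M}) (S0_submod : submod_closed S0).

Let S : zmodClosed M :=
  HB.pack S0 (GRing.isZmodClosed.Build M S0 (GRing.submod_closedB S0_submod)).

Definition quot_pi (v : M) : quot_module S0_submod := \pi_(quot_module S0_submod) v.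

Lemma quot_pi_eq u v : (quot_pi u == quot_pi v) = (u - v \in S0).
Proof. by rewrite -[RHS]/(_ \in S) Quotient.idealrBE. Qed.

Lemma quot_piK x : quot_pi (repr x) = x.
Proof. exact: reprK. Qed.

Fact quot_pi_zmod_morphism : zmod_morphism quot_pi.
Proof. by move=> a b; rewrite /quot_pi raddfB. Qed.
HB.instance Definition _ :=
  GRing.isZmodMorphism.Build M (quot_module S0_submod) quot_pi quot_pi_zmod_morphism.

Fact quot_pi_scalable : scalable quot_pi.
Proof. by move=> a v; rewrite /quot_pi -pi_quot_scale. Qed.
HB.instance Definition _ :=
  GRing.isScalable.Build A M (quot_module S0_submod) *:%R quot_pi quot_pi_scalable.

Lemma quot_pi_eq0 v : (quot_pi v == 0) = (v \in S0).
Proof. by rewrite -(raddf0 quot_pi) quot_pi_eq subr0. Qed.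
End QuotPi.

Local Close Scope quotient_scope.

Lemma isomorphicI (A : pzRingType) (M N : lmodType A) (f : M -> N) :
  linear f -> injective f -> (forall y, exists x, f x = y) -> isomorphic M N.
Proof.
move=> f_lin f_inj f_surj.
pose F : {linear M -> N} := HB.pack f (GRing.isLinear.Build A M N *:%R f f_lin).
exists F; pose g y := sval (cid (f_surj y)).
have gK : cancel g f by move=> y; rewrite /g; case: cid.
by exists g => // x; apply: f_inj; rewrite gK.
Qed.

Lemma isomorphic_sym (A : pzRingType) (M N : lmodType A) : isomorphic M N -> isomorphic N M.
Proof.
move=> [f [g fK gK]]; apply: (@isomorphicI _ _ _ g).
- by move=> a u v; apply: (can_inj fK); rewrite linearP !gK.
- exact: can_inj gK.
by move=> x; exists (f x).
Qed.

Lemma isomorphic_trans (A : pzRingType) (M N P : lmodType A) :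
  isomorphic M N -> isomorphic N P -> isomorphic M P.
Proof. by move=> [f fb] [g gb]; exists (g \o f)%FUN; apply: bij_comp. Qed.

(* A module with a largest proper submodule [rad]. *)
Section Head.
Variables (A : pzRingType) (W : lmodType A) (rad : {pred W}).
Hypotheses (rad_submod : submod_closed rad) (w0 : W) (w0_rad : w0 \notin rad).
Hypothesis rad_max : forall v, v \notin rad -> forall u, exists a, u = a *: v.
Local Notation head := (quot_module rad_submod).

Lemma head_simple : simple_module head.
Proof.
split; first by exists (quot_pi rad_submod w0); rewrite quot_pi_eq0.
move=> S S_submod.
have [[x [xS x0]]|nS] := pselect (exists x, x \in S /\ x != 0); [right|left] => y.
  rewrite [RHS]inE -[y]quot_piK.
  have xr : repr x \notin rad by rewrite -(quot_pi_eq0 rad_submod) quot_piK.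
  have [a ->] := rad_max xr (repr y); rewrite linearZ /= quot_piK.
  by apply: (GRing.subsemimod_closedZ (GRing.submod_closed_semi S_submod)).
rewrite !inE; apply/idP/eqP => [yS|->]; last by case: S_submod.
by apply/eqP; apply: contraT => y0; case: nS; exists y.
Qed.

(** The kernel of [f] is [rad]. It lies in [rad] because [f] is not zero. And [f] cannot map [rad]
    onto [M], as [w0] would then differ from an element of [rad] by an element of the kernel. *)
Lemma head_iso (M : lmodType A) (f : {linear W -> M}) w1 :
  simple_module M -> f w1 != 0 -> isomorphic M head.
Proof.
move=> [_ simM] fw1.
have ker_rad v : f v = 0 -> v \in rad.
  move=> fv; apply: contraNT fw1 => /rad_max/(_ w1)[a ->].
  by rewrite linearZ /= fv scaler0.
have img T : submod_closed T -> submod_closed [pred m | `[<exists2 v, v \in T & f v = m>]].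
  move=> T_submod; split; first by apply/asboolP; exists 0; [case: T_submod|rewrite raddf0].
  move=> a _ _ /asboolP[u uT <-] /asboolP[v vT <-]; apply/asboolP.
  by exists (a *: u + v); [case: T_submod => _; apply|rewrite linearP].
have f_rad v : v \in rad -> f v = 0.
  move=> vr; have [E|E] := simM _ (img _ rad_submod).
    apply/eqP; rewrite -[_ == _]/(f v \in pred1 0) -E; apply/asboolP.
    by exists v.
  have /asboolP[r rr fr] : f w0 \in [pred m | `[<exists2 v, v \in rad & f v = m>]].
    by rewrite E.
  case/negP: w0_rad; rewrite -(subrK r w0).
  apply: (GRing.subsemimod_closedD (GRing.submod_closed_semi rad_submod)).2 => //.
  by apply: ker_rad; rewrite linearB fr subrr.
have f_surj m : exists v, f v = m.
  have [|E|E] := simM _ (img predT _); first by split.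
    have : f w1 \in [pred m | `[<exists2 v, v \in predT & f v = m>]].
      by apply/asboolP; exists w1.
    by rewrite E inE (negbTE fw1).
  have /asboolP[v _ <-] : m \in [pred m | `[<exists2 v, v \in predT & f v = m>]].
    by rewrite E.
  by exists v.
have f_repr v : f (repr (quot_pi rad_submod v)) = f v.
  apply/eqP; rewrite -subr_eq0 -raddfB; apply/eqP/f_rad.
  by rewrite -(quot_pi_eq rad_submod) quot_piK.
apply: isomorphic_sym; apply: (@isomorphicI _ _ _ (fun x : head => f (repr x))).
- move=> a x y; rewrite -{1}[x]quot_piK -{1}[y]quot_piK -linearP f_repr.
  by rewrite linearP.
- move=> x y /eqP; rewrite -subr_eq0 -raddfB => /eqP/ker_rad.
  by rewrite -(quot_pi_eq rad_submod) !quot_piK => /eqP.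
by move=> m; have [v <-] := f_surj m; exists (quot_pi rad_submod v).
Qed.
End Head.

Lemma compose_reflection_monic t n (D : diagram t n) :
  is_monic D -> compose (reflection D) D = id_diagram t.
Proof.
move=> Dm; apply/monic_endo/is_monicP => i; exists i.
have [j Dj] := is_monicP Dm i.
apply: walk_compose => //; apply: connect_trans (walk_lower _ Dj) _.
apply: (@walk_upper _ _ _ _ _ (inl j) (inr i)).
by rewrite reflectionE /= -Dj partnerK.
Qed.

Lemma loops_reflection_monic t n m (X : diagram t m) (D : diagram t n) :
  is_monic D -> loops X (reflection D) = 0%N.
Proof.
move=> Dm; apply: loops_eq0 => i; have [j Dj] := is_monicP Dm i.
by exists (inl j); apply: (@walk_lower _ _ _ _ _ (inr i) (inl j)); rewrite reflectionE /= Dj.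
Qed.

(** * Monic diagrams with all cups on the left or on the right *)

Section Standard.
Variables (t k : nat).
Local Notation n := (t + k.*2)%N.

(** The cast puts the block of the cups before that of the through strands. The default value of
    [insubd] is never taken, since the first block has even length. *)
Definition standard_partner : {ffun points t n -> points t n} :=
  [ffun x => match x with
   | inl i => inr (cast_ord (addnC _ _) (rshift k.*2 i))
   | inr j => match split (cast_ord (addnC _ _) j) with
     | inl _ => inr (insubd j (if odd j then j.-1 else j.+1))
     | inr i => inl i end end].

Lemma standardE_inl i : exists2 j : 'I_n, standard_partner (inl i) = inr j & j = (k.*2 + i)%N :> nat.
Proof. by rewrite ffunE; eexists; first by []. Qed.

Lemma standardE_inr (j : 'I_n) : 
  if (j < k.*2)%N then exists2 j' : 'I_n, standard_partner (inr j) = inr j' &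
    (j' : nat) = (if odd j then j.-1 else j.+1)
  else exists2 i : 'I_t, standard_partner (inr j) = inl i & j = (k.*2 + i)%N :> nat.
Proof.
rewrite ffunE; case: split_ordP => i /(congr1 val) /= ji.
  rewrite ji ltn_ord; eexists; first by [].
  rewrite insubdK // -[_ \in _]/(_ < _)%N; case: ifP; move: (ltn_ord j) (ltn_ord i); lia.
rewrite ji ltnNge leq_addr /=; eexists; by [].
Qed.

Lemma standard_noncrossing : noncrossing_pairing standard_partner.
Proof.
have ext (x y : points t n) : position x = position y -> x = y by apply: position_inj.
(* In boundary positions the through strands are nested around the right side and the cups come
   after them, so planarity becomes arithmetic. *)
pose s p := if (p < t.*2)%N then (t.*2.-1 - p)%N else if odd p then p.-1 else p.+1.
have S x : position (standard_partner x) = s (position x).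
  case: x => [i|j]; rewrite /s /=.
    have [j -> jE] := standardE_inl i; have := ltn_ord i.
    by move=> it; rewrite ifT /= ?jE; clear -it; lia.
  have := standardE_inr j; have := ltn_ord j.
  case: ifP => jk jn [x -> xE] /=.
    rewrite ifF ?xE; last by clear -jn jk; lia.
    by clear -jn jk; do ![case: ifP]; lia.
  by have it := ltn_ord x; rewrite xE ifT; clear -it; lia.
apply/and3P; split; apply/forallP => x.
- apply/eqP => E; have := S x; rewrite E; move: (position x) => p.
  by rewrite /s; clear; do ![case: ifP]; lia.
- apply/eqP/ext; rewrite !S; move: (position x) => p.
  by rewrite /s; clear; do ![case: ifP]; lia.
apply/forallP => y; rewrite !S; move: (position x) (position y) => p r.
by rewrite /s; clear; do ![case: ifP]; lia.
Qed.

Definition standard : diagram t n := Diagram standard_noncrossing.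
End Standard.

Lemma standard_monic t k : is_monic (standard t k).
Proof. by apply/is_monicP => i; have [j] := standardE_inl k i; exists j. Qed.

Lemma standard_left_cups t k : left_cups k (standard t k).
Proof.
move=> a b bE oa ak; have := standardE_inr a; rewrite ak (negbTE oa) => -[j] /= -> jE.
by congr inr; apply: val_inj; rewrite /= jE.
Qed.

Section RightStandard.
Variables (t k : nat).
Local Notation n := (t + k.*2)%N.

(** With the through strands on the left, the first generators meet only through strands; [E] is
    tested on this diagram. *)
Definition right_partner : {ffun points t n -> points t n} :=
  [ffun x => match x with
   | inl i => inr (lshift k.*2 i)
   | inr j => match split j with
     | inl i => inl i
     | inr j' => inr (insubd j (if odd j' then j.-1 else j.+1)) end end].

Lemma right_noncrossing : noncrossing_pairing right_partner.
Proof.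
pose s p := if (p < t)%N || (n <= p)%N then ((t + n).-1 - p)%N else
  if odd (p - t) then p.-1 else p.+1.
have S x : position (right_partner x) = s (position x).
  rewrite /s; case: x => [i|j]; rewrite ffunE /=; first by rewrite ltn_ord.
  case: split_ordP => j' /(congr1 val) /= jE; have := ltn_ord j'.
    by move=> jt; rewrite jE ifT; clear -jt; lia.
  move=> jk; rewrite [RHS]ifF; last by rewrite jE; clear -jk; lia.
  rewrite insubdK; last first.
    by rewrite -[_ \in _]/(_ < _)%N jE; clear -jk; case: ifP; lia.
  by rewrite jE; clear -jk; do ![case: ifP]; lia.
apply/and3P; split; apply/forallP => x.
- apply/eqP => E; have := S x; rewrite E; move: (position x) (position_lt x) => p.
  by rewrite /s; clear; do ![case: ifP]; lia.
- apply/eqP/position_inj; rewrite !S; move: (position x) (position_lt x) => p.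
  by rewrite /s; clear; do ![case: ifP]; lia.
apply/forallP => y; rewrite !S; move: (position_lt x) (position_lt y).
move: (position x) (position y) => p r.
by rewrite /s; clear; do ![case: ifP]; lia.
Qed.

Definition right_standard : diagram t n := Diagram right_noncrossing.

Lemma right_standardE i : right_standard (inl i) = inr (lshift k.*2 i).
Proof. by rewrite /= ffunE. Qed.

Lemma right_standard_monic : is_monic right_standard.
Proof. by apply/is_monicP => i; exists (lshift k.*2 i); rewrite right_standardE. Qed.
End RightStandard.

(** * Modules over the quotient ring *)

Section Descend.
Variables (A : pzRingType) (x : A) (N : lmodType A).
Hypothesis kill : forall (r : A) (v : N), r \in ideal2 x -> r *: v = 0.

(** The proof that the ideal acts as zero is a parameter of the type, because the module structure
    over the quotient ring depends on it. *)
Definition descend of (forall (r : A) (v : N), r \in ideal2 x -> r *: v = 0) : Type := N.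
Local Notation M := (descend kill).
HB.instance Definition _ := GRing.Zmodule.copy M N.

Definition descend_scale (u : quot_ring x) (v : M) : M := repr u *: (v : N).

Lemma descend_proj a (v : M) : descend_scale (quot_proj x a) v = a *: (v : N).
Proof.
apply/eqP; rewrite /descend_scale -subr_eq0 -scalerBl kill //.
by rewrite -quot_projP quot_projK.
Qed.

Fact descend_scaleA a b v : descend_scale a (descend_scale b v) = descend_scale (a * b) v.
Proof.
by rewrite -[a]quot_projK -[b]quot_projK -rmorphM !descend_proj scalerA.
Qed.
Fact descend_scale1 : left_id 1 descend_scale.
Proof. by move=> v; rewrite -(rmorph1 (quot_proj x)) descend_proj scale1r. Qed.
Fact descend_scaleDr : right_distributive descend_scale +%R.
Proof. by move=> a u v; rewrite /descend_scale scalerDr. Qed.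
Fact descend_scaleDl v : {morph descend_scale^~ v : a b / a + b}.
Proof.
move=> a b; rewrite -[a]quot_projK -[b]quot_projK -rmorphD !descend_proj.
exact: scalerDl.
Qed.
HB.instance Definition _ := GRing.Zmodule_isLmodule.Build (quot_ring x) M
  descend_scaleA descend_scale1 descend_scaleDr descend_scaleDl.

Lemma descend_isomorphic : isomorphic (restrict_scalars (quot_proj x) M) N.
Proof.
apply: (@isomorphicI _ _ _ (fun v : restrict_scalars (quot_proj x) M => (v : N))) => //.
  move=> a u v; congr (_ + _); exact: descend_proj.
by move=> y; exists y.
Qed.

Lemma descend_simple : simple_module N -> simple_module M.
Proof.
move=> [[v v0] simN]; split; first by exists v.
move=> S S_submod; apply: simN; split; first by case: S_submod.
move=> a u w uS wS; case: S_submod => _ /(_ (quot_proj x a) u w uS wS).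
by congr (_ + _ \in S); apply: descend_proj.
Qed.
End Descend.

Lemma restrict_scalars_simple (A : pzRingType) (x : A) (M : lmodType (quot_ring x)) :
  simple_module M -> simple_module (restrict_scalars (quot_proj x) M).
Proof.
move=> [v0 simM]; split=> // S [S0 SZ]; apply: simM; split=> // a u v uS vS.
by rewrite -[a]quot_projK; apply: (SZ (repr a)).
Qed.

Lemma isomorphic_kill (A : pzRingType) (M N : lmodType A) (a : A) :
  isomorphic M N -> (forall v : M, a *: v = 0) -> forall w : N, a *: w = 0.
Proof. by move=> [f [g fK gK]] a0 w; rewrite -[w]gK -linearZ /= a0 linear0. Qed.

(** * Cellularity and the radical *)

Section CellAlgebra.
Variables (K : fieldType) (q : K).
Local Notation delta := (loop_value q).

Lemma TL_expand n (a : TL q n) : a = \sum_D a D *: TL_basis q D.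
Proof.
apply/ffunP => F; rewrite sum_ffunE (bigD1 F) //= big1 ?addr0 => [|D /negbTE ne].
  by rewrite !ffunE eqxx /GRing.scale /= mulr1.
by rewrite !ffunE eq_sym ne /GRing.scale /= mulr0.
Qed.

Lemma cell_scaleE t n c (a : TL q n) (v : cell q t n) F :
  ((c *: a) *: v) F = c * (a *: v) F.
Proof.
rewrite !ffunE mulr_sumr; apply: eq_bigr => D _; rewrite mulr_sumr.
by apply: eq_bigr => E _; rewrite ffunE /GRing.scale /= !mulrA.
Qed.

(** If $X F^* G$ is monic, so is $F^* G$, which is then the identity. This is the cellular identity
    $X F^* G = (F, G) X$ modulo non-monic diagrams. *)
Lemma mul_coef_cell t n (X F G P : diagram t n) : is_monic F -> is_monic P ->
  mul_coef q (compose X (reflection F)) G P =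
  mul_coef q (reflection F) G (id_diagram t) * (X == P)%:R.
Proof.
move=> Fm Pm; rewrite /mul_coef -composeA.
have [FG|FG] := eqVneq (compose (reflection F) G) (id_diagram t).
  rewrite FG id_compose; have := loopsA G (reflection F) X.
  rewrite FG loops_id_r loops_reflection_monic // addn0 add0n => <-.
  by case: eqP; rewrite ?mulr1 ?mulr0.
rewrite mul0r; case: eqP => // XP.
case/eqP: FG; apply: monic_endo; apply: (@compose_monic _ _ _ X).
by rewrite XP.
Qed.

Lemma cell_form_basisE t n (v : cell q t n) (E : monic_diagram t n) :
  cell_form v (cell_basis q (val E)) =
  \sum_(D : monic_diagram t n) v D * mul_coef q (reflection (val D)) (val E) (id_diagram t).
Proof.
rewrite /cell_form; apply: eq_bigr => D _.
under eq_bigr => F _ do rewrite -mulrA mulrCA.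
exact: sum_cell_basis.
Qed.

Hypothesis delta_neq0 : delta != 0.

(** The value of the form on the pair [D], [D] is a power of the loop value. *)
Lemma cell_basis_radical t n (D : diagram t n) : is_monic D ->
  cell_basis q D \notin radical q t n.
Proof.
move=> Dm; apply/radicalP => /(_ (Sub D Dm)) /eqP.
rewrite cell_form_basisE (sum_cell_basis _ (Sub D Dm) (fun F => _)) /mul_coef /=.
by rewrite compose_reflection_monic // eqxx expf_eq0 (negbTE delta_neq0) andbF.
Qed.

(** Choose [F] with $(v, F) \neq 0$; then $X F^*$ maps [v] to $(v, F) X$, so every basis vector is
    reached. *)
Lemma radical_max t n (v : cell q t n) : v \notin radical q t n ->
  forall u : cell q t n, exists a : TL q n, u = a *: v.
Proof.
move=> /radicalP vr u.
have [F Fv] : exists F : monic_diagram t n, cell_form v (cell_basis q (val F)) != 0.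
  by apply: contrapT => nF; apply: vr => F; apply: contrapT => /eqP Fv; apply: nF; exists F.
have act X P : (TL_basis q (compose (val X) (reflection (val F))) *: v) P =
    cell_form v (cell_basis q (val F)) * (val X == val P)%:R.
  rewrite basis_actE cell_form_basisE mulr_suml; apply: eq_bigr => G _.
  rewrite (mul_coef_cell _ _ (valP F) (valP P)) mulrA; congr (_ * _ * _).
  by rewrite -mul_coef_reflection reflectionK reflection_id.
exists (\sum_(X : monic_diagram t n) (u X / cell_form v (cell_basis q (val F))) *:
   TL_basis q (compose (val X) (reflection (val F)))).
apply/ffunP => P; rewrite scaler_suml sum_ffunE (bigD1 P) //= big1 ?addr0 => [|X /negbTE ne].
  by rewrite cell_scaleE act eqxx mulr1 divfK.
by rewrite cell_scaleE act (inj_eq val_inj) ne !mulr0.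
Qed.
End CellAlgebra.

(** * Simple Temperley-Lieb modules *)

Lemma compose_top_arc s t n (D : diagram t n) (E : diagram s t) a b :
  D (inr a) = inr b -> compose D E (inr a) = inr b.
Proof.
move=> Dab; apply: walk_compose; first by apply: contra_neq (partner_neq D (inr a)) => -[ab]; rewrite Dab ab.
exact: (walk_upper _ Dab).
Qed.

Section StandardIdempotent.
Variables (t k : nat).
Local Notation n := (t + k.*2)%N.
Local Notation d := (standard t k).

(** It kills $L_{t'}(n)$ for $t' > t$ but not $L_t(n)$, and so tells these modules apart. *)
Definition standard_endo : diagram n n := compose d (reflection d).

Lemma standard_endo_left_cups : left_cups k standard_endo.
Proof. by move=> a b bE oa ak; apply/compose_top_arc/standard_left_cups. Qed.

Lemma standard_endo_through (j : 'I_n) : (k.*2 <= j)%N -> standard_endo (inl j) = inr j.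
Proof.
move=> kj; have := standardE_inr j; rewrite ltnNge kj /= => -[i di _].
apply: walk_compose => //; apply: (@connect_trans _ _ (lower3 n (inr i))).
  by apply: walk_lower; rewrite reflectionE /= di.
by apply: (@walk_upper _ _ _ _ _ (inl i) (inr j)); rewrite -[inr j](partnerK d) /= di.
Qed.

Lemma standard_endo_compose s (D : diagram s n) : left_cups k D ->
  compose standard_endo D = D.
Proof.
move=> Dk; have kn : (k.*2 <= n)%N by lia.
(* At the points outside the left cups the strands of [standard_endo] are vertical. *)
pose good (x : points s n) := if x is inr j then (k.*2 <= j)%N else true.
have low x : good x -> connect (stack standard_endo D) (outer3 n x) (lower3 n x).
  case: x => [i _|j kj]; first exact: connect0.
  rewrite sym_connect_sym; last exact: stack_sym.
  exact: (@walk_upper _ _ _ _ _ (inl j) (inr j) (standard_endo_through kj)).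
apply: compose_unique => x; have [gx|] := boolP (good x).
  apply: connect_trans (low _ gx) _; apply: (connect_trans (walk_lower _ (erefl (D x)))).
  rewrite sym_connect_sym; last exact: stack_sym.
  apply: low; case Dx : (D x) => [//|j] /=; rewrite leqNgt; apply/negP => jk.
  have [j' Dj' j'E] := left_cups_pair kn Dk jk.
  by move: gx; rewrite -[x](partnerK D) Dx Dj' /= j'E; case: ifP; lia.
case: x => // j; rewrite /= -ltnNge => jk.
have [j' -> j'E] := left_cups_pair kn Dk jk.
have [j2 ej j2E] := left_cups_pair kn standard_endo_left_cups jk.
have -> : j' = j2 by apply: val_inj; rewrite /= j'E j2E.
exact: (walk_upper _ ej).
Qed.
End StandardIdempotent.

Section Simple.
Variables (K : fieldType) (q : K).
Local Notation delta := (loop_value q).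
Hypothesis delta_neq0 : delta != 0.

Lemma cell_head_simple t k : simple_module (cell_head q t (t + k.*2)).
Proof.
apply: head_simple; first exact: (cell_basis_radical delta_neq0 (standard_monic t k)).
by move=> v vr u; apply: radical_max.
Qed.

Section Kill.
Variables (n k : nat) (M : lmodType (TL q n)).
Hypothesis kill : forall (D : diagram n n) (m : M), (k.+1.*2 <= n)%N ->
  left_cups k.+1 (reflection D) -> TL_basis q D *: m = 0.

(** A cap can be moved to the left: [D] equals [D] times the generators at [i0] and [i], and the
    first of these products has a cap at [i0]. At position [k.*2] the cap joins the [k] left ones
    and [kill] applies. *)
Lemma kill_cap (i : 'I_n.-1) (a b : 'I_n) (D : diagram n n) (m : M) :
  (k.*2 <= i)%N -> a = i :> nat -> b = i.+1 :> nat -> left_cups k (reflection D) ->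
  reflection D (inr a) = inr b -> TL_basis q D *: m = 0.
Proof.
have [j] := ubnP i; elim: j i a b D m => // j IH i a b D m ij ki aE bE Dk Dab.
have [E|ki'] : i = k.*2 :> nat \/ (k.*2 < i)%N by lia.
  apply: kill; first by move: (ltn_ord b); lia.
  move=> a' b' b'E oa' a'k; have [a'k'|ka'] := ltnP a' k.*2; first exact: Dk.
  have -> : a' = a by apply: val_inj; rewrite /=; lia.
  have -> // : b' = b by apply: val_inj; rewrite /=; lia.
have i0n : (i.-1 < n.-1)%N by move: (ltn_ord i); lia.
pose i0 := Ordinal i0n.
have a0n : (i.-1 < n)%N by move: (ltn_ord i); lia.
pose a0 := Ordinal a0n.
have a0a : paired i0 a0 a by rewrite /paired /= aE; lia.
have ab : paired i a b by rewrite /paired aE bE !eqxx.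
have Di : TL_basis q D * TL_gen q i = delta *: TL_basis q D.
  rewrite TL_basisM loops_cupcap_r (loops_cupcap_eq1 ab Dab) expr1 compose_cupcap_r.
  by rewrite (compose_cupcap_id ab Dab) reflectionK.
have E : delta *: TL_basis q D = delta *: (TL_basis q D * TL_gen q i0 * TL_gen q i).
  rewrite -Di -[in LHS](TL_gen_neighbours q (i := i) (j := i0)); last by right => /=; lia.
  by rewrite !mulrA Di -!scalerAl.
have -> : TL_basis q D = TL_basis q D * TL_gen q i0 * TL_gen q i.
  by apply: (scalerI delta_neq0).
rewrite -scalerA TL_basisM -[_ *: TL_basis q _]mulr_algl -scalerA.
rewrite (IH i0 a0 a) ?scaler0 //.
- by rewrite /=; clear -ij ki'; lia.
- by rewrite /=; clear -ki'; lia.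
- by rewrite aE /=; clear -ki'; lia.
- rewrite compose_cupcap_r reflectionK; apply: left_cups_compose => //=.
  by clear -ki'; lia.
by rewrite compose_cupcap_r reflectionK; apply: compose_cupcap_arc.
Qed.
End Kill.

Section CellMap.
Variables (t k : nat).
Local Notation n := (t + k.*2)%N.
Variables (M : lmodType (TL q n)) (m : M).
Local Notation d := (standard t k).
Hypothesis kill : forall (D : diagram n n) (m : M), (k.+1.*2 <= n)%N ->
  left_cups k.+1 (reflection D) -> TL_basis q D *: m = 0.

Let B (X : diagram t n) : TL q n := TL_basis q (compose X (reflection d)).

(** A cap of [Z] joins two through strands of [d], which gives the product a further cap right of
    its [k] left ones. *)
Lemma kill_nonmonic (Z : diagram t n) (m' : M) : ~~ is_monic Z -> B Z *: m' = 0.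
Proof.
move=> /nonmonic_cap[i [a [b [aE bE Zab]]]].
have [j dj jE] := standardE_inl k a; have [j' dj' j'E] := standardE_inl k b.
have in1 : (k.*2 + a < n.-1)%N by have := ltn_ord b; lia.
have R : reflection (compose Z (reflection d)) = compose d (reflection Z).
  by rewrite -compose_reflection reflectionK.
apply: (kill_cap kill (i := Ordinal in1) (a := j) (b := j')) => //; rewrite ?R.
- exact: leq_addr.
- by rewrite /= j'E bE aE addnS.
- by move=> x y yE ox xk; apply/compose_top_arc/standard_left_cups.
have jj' : inr j != inr j' :> points n n.
  by apply/eqP => -[E]; move: jE j'E; rewrite E aE bE; clear; lia.
apply: walk_compose; first by apply: contra_neq jj' => -[->].
apply: (@connect_trans _ _ (lower3 n (inr a))).
  by apply: (@walk_upper _ _ _ _ _ (inr j) (inl a)); rewrite -[inl a](partnerK d) /= dj.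
apply: (@connect_trans _ _ (lower3 n (inr b))).
  by apply: walk_lower; rewrite reflectionE /= Zab.
by apply: (@walk_upper _ _ _ _ _ (inl b) (inr j')).
Qed.

Definition cell_map (v : cell q t n) : M := \sum_(X : monic_diagram t n) (v X *: B (val X)) *: m.

(** Composition with $d^*$ closes no loop, and [kill_nonmonic] matches the rule that non-monic
    products vanish in the cell module. *)
Lemma cell_map_linear : linear cell_map.
Proof.
have add u v : cell_map (u + v) = cell_map u + cell_map v.
  rewrite /cell_map -big_split; apply: eq_bigr => X _ /=.
  by rewrite ffunE !scalerDl.
move=> a u v; rewrite add; congr (_ + _).
rewrite [in RHS](TL_expand a) /cell_map scaler_suml.
under [RHS]eq_bigr => D _ do rewrite scaler_sumr.
under [LHS]eq_bigr => F _ do rewrite ffunE !scaler_suml.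
rewrite exchange_big; apply: eq_bigr => D _.
under [LHS]eq_bigr => F _ do rewrite !scaler_suml.
rewrite exchange_big; apply: eq_bigr => E _ /=.
rewrite scalerA -scalerAl -scalerAr TL_basisM scalerA.
have L : loops D (compose (val E) (reflection d)) = loops D (val E).
  have := loopsA (reflection d) (val E) D.
  by rewrite !(loops_reflection_monic _ (standard_monic t k)); lia.
rewrite L composeA -/(B _).
transitivity (\sum_F ((((a D * u E * mul_coef q D (val E) F) *: B F) : TL q n) *: m : M)).
  rewrite [RHS](bigID (@is_monic t n)) /= [X in _ + X]big1 ?addr0; last first.
    move=> F Fm; rewrite -[_ *: B F]mulr_algl -scalerA kill_nonmonic // scaler0.
    by [].
  rewrite -(big_sub (@is_monic t n) (fun F => (((a D * u E * mul_coef q D (val E) F) *: B F) : TL q n) *: m : M)).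
  by [].
rewrite (bigD1 (compose D (val E))) //= big1 ?addr0 => [|F]; last first.
  by rewrite eq_sym /mul_coef => /negbTE ->; rewrite mulr0 !scale0r.
by rewrite /mul_coef eqxx scalerA.
Qed.

Lemma cell_map_basis X : is_monic X -> cell_map (cell_basis q X) = B X *: m.
Proof.
move=> Xm; rewrite /cell_map (bigD1 (Sub X Xm)) //= ffunE eqxx scale1r big1 ?addr0 //.
move=> F FX; rewrite ffunE; have [E|_] := eqVneq (val F) X; last by rewrite /= !scale0r.
by case/eqP: FX; apply: val_inj.
Qed.

(** The caps of [D] absorb $d d^*$, so $D = X d^*$ with $X = D d$, and the cell map sends [X] to a
    nonzero vector. *)
Lemma simple_isomorphic_cell_head (D : diagram n n) : simple_module M ->
  left_cups k (reflection D) -> TL_basis q D *: m != 0 ->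
  isomorphic M (cell_head q t n).
Proof.
move=> simM Dk Dm; pose X := compose D d.
have BX : B X = TL_basis q D.
  rewrite /B -composeA -/(standard_endo t k) -[in LHS](reflectionK D).
  rewrite -[standard_endo t k]reflectionK compose_reflection.
  have -> : reflection (standard_endo t k) = standard_endo t k.
    by rewrite -compose_reflection reflectionK.
  by rewrite standard_endo_compose ?reflectionK.
have Xm : is_monic X.
  by apply: contraNT Dm => Xm; rewrite -BX kill_nonmonic.
pose f : {linear cell q t n -> M} :=
  HB.pack cell_map (GRing.isLinear.Build _ _ _ *:%R cell_map cell_map_linear).
apply: (@head_iso _ _ _ _ (cell_basis q d) _ _ M f (cell_basis q X)) => //.
- exact: (cell_basis_radical delta_neq0 (standard_monic t k)).
- by move=> v vr u; apply: radical_max.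
by rewrite -[f _]/(cell_map _) cell_map_basis // BX.
Qed.
End CellMap.

Lemma simple_TL_module n (M : lmodType (TL q n)) : simple_module M ->
  exists t, [/\ (t <= n)%N, t = n %[mod 2] & isomorphic M (cell_head q t n)].
Proof.
move=> simM.
(* The largest [k] for which some diagram with [k] left caps does not kill [M]; the identity shows
   that 0 qualifies. *)
pose P k := (k.*2 <= n)%N && `[< exists D (m : M),
  left_cups k (reflection D) /\ TL_basis q D *: m != 0 >].
have exP : exists k, P k.
  have [[v v0] _] := simM; exists 0%N; apply/asboolP; exists (id_diagram n), v.
  by split=> //; rewrite -[TL_basis _ _]/(1 : TL q n) scale1r.
have ubP k : P k -> (k <= n)%N by case/andP; lia.
have [k /andP[kn /asboolP[D [m [Dk Dm]]]] kmax] := ex_maxnP exP ubP.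
have [t nE] : exists t, n = (t + k.*2)%N by exists (n - k.*2)%N; lia.
subst n; exists t; split; [exact: leq_addr|lia|].
apply: (@simple_isomorphic_cell_head _ _ _ m _ D) => // D' m' k'n D'k.
apply/eqP; apply: contraT => D'm; have := kmax k.+1; rewrite ltnn; apply.
by rewrite /P k'n; apply/asboolP; exists D', m'.
Qed.

(** The product factors through [t] points, too few for the [t'] strands of a monic diagram. *)
Lemma standard_endo_kill t k t' (w : cell_head q t' (t + k.*2)) : (t < t')%N ->
  TL_basis q (standard_endo t k) *: w = 0.
Proof.
move=> tt'; rewrite -[w]quot_piK -linearZ /=.
have -> : TL_basis q (standard_endo t k) *: (repr w : cell q t' (t + k.*2)) = 0.
  apply/ffunP => F; rewrite basis_actE ffunE big1 // => E _.
  rewrite /mul_coef; case: eqP => [EF|]; last by rewrite mulr0.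
  have : is_monic (compose (reflection (standard t k)) (val E)).
    apply: (@compose_monic _ _ _ (standard t k)).
    by rewrite composeA EF (valP F).
  by move/monic_leq; rewrite leqNgt tt'.
by rewrite raddf0.
Qed.

Lemma standard_endo_act t k : exists w : cell_head q t (t + k.*2),
  TL_basis q (standard_endo t k) *: w != 0.
Proof.
have dm := standard_monic t k; set d := standard t k in dm *.
exists (quot_pi _ (cell_basis q d)); rewrite -linearZ /= quot_pi_eq0.
apply: contra (cell_basis_radical delta_neq0 dm); set e := TL_basis q _ => ed.
pose c := delta ^+ loops (standard_endo t k) d.
have -> : cell_basis q d = (c^-1 *: e) *: cell_basis q d.
  apply/ffunP => F; rewrite cell_scaleE (basis_act_basis q _ (Sub d dm)) /=.
  rewrite standard_endo_compose; last exact: standard_left_cups.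
  by rewrite mulKf // expf_neq0.
rewrite -mulr_algl -scalerA.
exact: (GRing.subsemimod_closedZ (GRing.submod_closed_semi (radical_submod q t _))).
Qed.

Lemma cell_head_inj n t t' : (t <= n)%N -> t = n %[mod 2] -> (t' <= n)%N -> t' = n %[mod 2] ->
  isomorphic (cell_head q t n) (cell_head q t' n) -> t = t'.
Proof.
have main s s' : (s < s')%N -> (s <= n)%N -> s = n %[mod 2] ->
    isomorphic (cell_head q s' n) (cell_head q s n) -> False.
  move=> ss' sn sm iso.
  have [k nE] : exists k, n = (s + k.*2)%N by exists (n - s)./2; lia.
  subst n; have [w] := standard_endo_act s k; apply/negP/negPn/eqP.
  by apply: (isomorphic_kill iso) => v; apply: standard_endo_kill.
move=> tn tm t'n t'm iso; case: (ltngtP t t') => // h; exfalso.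
  exact: main h tn tm (isomorphic_sym iso).
exact: main h t'n t'm iso.
Qed.
End Simple.

(** * The action of the Jones-Wenzl idempotent *)

Section RightStandardAct.
Variables (K : fieldType) (q : K) (t k : nat).
Local Notation n := (t + k.*2)%N.
Variable E : TL q n.

(** The generator joins two through strands. *)
Lemma gen_right_standard (i : 'I_n.-1) : (i.+1 < t)%N ->
  TL_gen q i *: cell_basis q (right_standard t k) = 0.
Proof.
move=> it; set d := right_standard t k; have dm : is_monic d by apply: right_standard_monic.
apply/ffunP => F; rewrite (basis_act_basis q _ (Sub d dm)) /=.
rewrite cell_basis_nonmonic ?ffunE ?mulr0 //; apply/negP => /is_monicP h.
pose a : 'I_t := Ordinal (ltnW it); pose b : 'I_t := Ordinal it.
have ab : paired i (lshift k.*2 a) (lshift k.*2 b) by rewrite /paired /= !eqxx.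
have [j] := h a; rewrite (compose_cupcap_near ab) ?right_standardE //.
by rewrite -right_standardE partnerK.
Qed.

(** An element of the subalgebra scales [E] from the right and [w] from the left by the same scalar;
    for [E] itself idempotency makes this scalar 1. *)
Lemma jones_wenzl_right_standard m : is_jones_wenzl m E -> (m <= t)%N ->
  E *: cell_basis q (right_standard t k) = cell_basis q (right_standard t k).
Proof.
move=> [subE E0 EE genE] mt; set w := cell_basis q _.
pose S := [pred x : TL q n | `[< exists c, E * x = c *: E /\ x *: w = c%:A *: w >]].
have [c [Ec ->]] : exists c, E * E = c *: E /\ E *: w = c%:A *: w.
  apply/asboolP; apply: (subE S); [split|] => [|a x y|x y|_ [i im ->]].
  - by apply/asboolP; exists 1; rewrite mulr1 !scale1r.
  - move=> /asboolP[c [xE xw]] /asboolP[d [yE yw]]; apply/asboolP; exists (a * c + d).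
    split; first by rewrite mulrDr -scalerAr xE yE scalerA scalerDl.
    rewrite [LHS]scalerDl yw -[a *: x]mulr_algl -[X in X + _]scalerA xw scalerA.
    by rewrite mulr_algl scalerA -[LHS]scalerDl -scalerDl.
  - move=> /asboolP[c [xE xw]] /asboolP[d [yE yw]]; apply/asboolP; exists (c * d).
    split; first by rewrite mulrA xE -scalerAl yE scalerA.
    rewrite -[LHS]scalerA yw [LHS]scalerA -scalerAr mulr1 -[d *: x]mulr_algl.
    by rewrite -[LHS]scalerA xw [LHS]scalerA mulr_algl scalerA mulrC.
  apply/asboolP; exists 0; rewrite (genE i im).2 !scale0r; split=> //.
  by apply: gen_right_standard; lia.
move: Ec; rewrite EE -{1}[E]scale1r => /eqP; rewrite -subr_eq0 -scalerBl scaler_eq0 (negbTE E0) orbF.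
by rewrite subr_eq0 => /eqP <-; rewrite !scale1r.
Qed.

End RightStandardAct.

(** * Quantum integers at a root of unity *)

Section JonesWenzl.
Variables (K : fieldType) (q : K) (ell : nat).
Hypotheses (q_neq0 : q != 0) (q_order : ell.-primitive_root (q ^+ 2)) (ell_ge3 : (3 <= ell)%N).
Local Notation delta := (loop_value q).

(** Multiplication by $(-q)^k$ turns it into $q^{2k} - 1$. *)
Lemma qint_eq0 k : (qint q k == 0) = (ell %| k)%N.
Proof.
have qk : (- q) ^+ k != 0 by rewrite expf_neq0 // oppr_eq0.
rewrite (prim_order_dvd q_order) /qint subr_eq0 -exprM -[q ^+ _]mulr1.
have -> : q ^+ (2 * k) = (- q) ^+ k * (- q) ^+ k by rewrite -exprD addnn -mul2n !exprM sqrrN.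
by rewrite -(inj_eq (mulfI qk)) divff // mulr1.
Qed.

(** Otherwise $q^2 = -1$ and [ell] would divide 2. *)
Lemma loop_value_neq0 : delta != 0.
Proof.
apply/eqP => /(congr1 (fun x => x * (- q))) /eqP; rewrite mul0r /loop_value mulrNN mulrDl mulVf //.
rewrite -expr2 addr_eq0 => /eqP q2.
have : (ell %| 2)%N by rewrite (prim_order_dvd q_order) q2 sqrrN expr1n.
by move/dvdn_leq => /(_ isT); lia.
Qed.

Section Act.
Variables (t k : nat).
Local Notation n := (t + k.*2)%N.
Variable E : TL q n.

Lemma jones_wenzl_radical (v : cell q t n) : is_jones_wenzl (ell - 1) E ->
  (ell - 1 <= n)%N -> (t <= ell - 2)%N -> E *: v \in radical q t n.
Proof.
move=> [_ _ _ genE] elln tell; have ellE : ((ell - 1).+1 = ell)%N by lia.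
apply: (@state_kernel_radical _ _ q_neq0 loop_value_neq0 (ell - 1)); try lia.
- by apply/eqP; rewrite ellE qint_eq0.
- by move=> j jl; rewrite qint_eq0; apply/negP => /dvdn_leq => /(_ isT); lia.
apply: state_kernel_annihilated => //.
- by apply/eqP; rewrite ellE qint_eq0.
- by move=> j jl; rewrite qint_eq0; apply/negP => /dvdn_leq => /(_ isT); lia.
by move=> i /genE[gE _]; rewrite scalerA gE scale0r.
Qed.
End Act.
End JonesWenzl.

Lemma parity_split t n : (t <= n)%N -> t = n %[mod 2] -> exists k, n = (t + k.*2)%N.
Proof. by move=> tn tm; exists (n - t)./2; lia. Qed.

Theorem theorem7p5 (R : realType) (q : R[i]) (ell n : nat)
    (q_neq0 : q != 0) (q_order : ell.-primitive_root (q ^+ 2))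
    (ell_ge3 : (3 <= ell)%N) (n_ge : (ell - 1 <= n)%N)
    (E : TL q n) (E_jw : is_jones_wenzl (ell - 1) E) :
  [/\ forall t : nat, (t <= n)%N -> t = n %[mod 2] -> (t <= ell - 2)%N ->
        forall (r : TL q n) (v : cell_head q t n), r \in ideal2 E -> r *: v = 0,
      forall t : nat, (t <= n)%N -> t = n %[mod 2] ->
        ((exists M : lmodType (quot_ring E), simple_module M /\
            isomorphic (restrict_scalars (quot_proj E) M) (cell_head q t n))
          <-> (t <= ell - 2)%N)
    & forall M : lmodType (quot_ring E), simple_module M ->
        exists! t : nat, [/\ (t <= n)%N, t = n %[mod 2], (t <= ell - 2)%N &
          isomorphic (restrict_scalars (quot_proj E) M) (cell_head q t n)]].
Proof.
have delta_neq0 := loop_value_neq0 q_neq0 q_order ell_ge3.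
have kill t : (t <= n)%N -> t = n %[mod 2] -> (t <= ell - 2)%N ->
    forall (r : TL q n) (v : cell_head q t n), r \in ideal2 E -> r *: v = 0.
  move=> tn tm tl r v /asboolP[s ->].
  have [k nE] := parity_split tn tm; subst n.
  rewrite scaler_suml big1 // => p _.
  rewrite -!scalerA; set w := p.2 *: v.
  have -> : E *: w = 0.
    rewrite -[w]quot_piK -linearZ; apply/eqP; rewrite /= quot_pi_eq0.
    exact: (jones_wenzl_radical q_neq0 q_order ell_ge3).
  by rewrite scaler0.
(* For larger [t] the idempotent fixes the class of [right_standard], which is not zero, while it
   acts as zero on every module over the quotient. *)
have small t (M : lmodType (quot_ring E)) : (t <= n)%N -> t = n %[mod 2] ->
    isomorphic (restrict_scalars (quot_proj E) M) (cell_head q t n) -> (t <= ell - 2)%N.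
  move=> tn tm iso; rewrite leqNgt; apply/negP => lt.
  have [k nE] := parity_split tn tm; subst n.
  have E0 (v : restrict_scalars (quot_proj E) M) : E *: v = 0.
    rewrite -[_ *: v]/(quot_proj E E *: (v : M)).
    have -> : quot_proj E E = 0.
      apply/eqP; rewrite -(raddf0 (quot_proj E)) quot_projP subr0; apply/asboolP.
      by exists [:: (1, 1)]; rewrite big_seq1 mul1r mulr1.
    exact: (scale0r (v : M)).
  have := isomorphic_kill iso E0 (quot_pi _ (cell_basis q (right_standard t k))).
  rewrite -linearZ /= (jones_wenzl_right_standard E_jw); last by lia.
  move/eqP; rewrite quot_pi_eq0; apply/negP.
  exact/cell_basis_radical/right_standard_monic.
split=> // [t tn tm|M simM].
  split=> [[M [_ iso]]|tl]; first exact: small iso.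
  have killt := kill t tn tm tl.
  exists (descend killt); split; last exact: descend_isomorphic.
  apply: descend_simple; have [k nE] := parity_split tn tm; subst n.
  exact: cell_head_simple.
have [t [tn tm iso]] := simple_TL_module delta_neq0 (restrict_scalars_simple simM).
exists t; split; first by split=> //; apply: small iso.
move=> t' [t'n t'm _ iso']; apply: (cell_head_inj delta_neq0 tn tm t'n t'm).
exact: isomorphic_trans (isomorphic_sym iso) iso'.
Qed.
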